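(* Let $d$ be a graphical degree function on a finite set $V$. Then the realization graph $G(d)$ is maximally Hamiltonian.
   Context: All graphs are finite and simple. A degree function on a finite set $V$ with $|V|=n$ is a map $d:V\to\{0,1,\dots,n-1\}$; it is graphical if some simple graph on vertex set $V$ has $\deg(u)=d(u)$ for all $u\in V$. Such a (labeled) graph is a realization of $d$. The realization graph $G(d)$ has as vertices all realizations of $d$; two realizations are adjacent when the symmetric difference of their edge sets has exactly four elements (equivalently, one is obtained from the other by a single 2-switch: on four distinct vertices, edges $ab,cd$ are replaced by $ad,cb$, where $ad,cb$ were absent). A graph is Hamilton-connected if every two distinct vertices are the endpoints of a Hamilton path. A bipartite graph with a proper 2-coloring using both colors is Hamilton-laceable (for that coloring) if every two vertices of opposite colors are the endpoints of a Hamilton path. A graph is maximally Hamiltonian if it is bipartite and Hamilton-laceable for a proper 2-coloring with both color classes nonempty, or it is non-bipartite and Hamilton-connected; by convention $K_1$ (and $K_2$) are maximally Hamiltonian. *)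

(* Defs.v *)
From mathcomp Require Import all_boot.

Set Implicit Arguments.
Unset Strict Implicit.
Unset Printing Implicit Defensive.

Section HamiltonianProperties.
Variables (T : finType) (e : rel T).

(* The path is given as its source x followed by the sequence p. *)
Definition hamilton_path (x y : T) (p : seq T) : Prop :=
  [/\ path e x p, last x p = y, uniq (x :: p) & forall z, z \in x :: p].

Definition hamilton_connected : Prop :=
  forall x y, x != y -> exists p, hamilton_path x y p.

Definition proper_2coloring (c : T -> bool) : Prop :=
  forall x y, e x y -> c x != c y.

Definition bipartite : Prop := exists c, proper_2coloring c.

Definition hamilton_laceable (c : T -> bool) : Prop :=
  forall x y, c x != c y -> exists p, hamilton_path x y p.

Definition is_complete (k : nat) : Prop :=
  #|T| = k /\ forall x y, e x y = (x != y).

(* K_1 has no proper 2-coloring that uses both colors, hence the separate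
   clause; K_2 is listed with it although the first clause covers it. *)
Definition maximally_hamiltonian : Prop :=
  [\/ exists c : T -> bool,
        [/\ proper_2coloring c,
            exists x, c x = true,
            exists y, c y = false
          & hamilton_laceable c],
      ~ bipartite /\ hamilton_connected
    | is_complete 1 \/ is_complete 2].

End HamiltonianProperties.

Section Realizations.
Variable V : finType.

(* A simple graph on V is represented by its edge set, a set of 2-subsets. *)
Definition simple_edges (E : {set {set V}}) : bool :=
  [forall e in E, #|e| == 2].

Definition degree (E : {set {set V}}) (u : V) : nat :=
  #|[set e in E | u \in e]|.

Definition realizes (d : V -> 'I_#|V|) (E : {set {set V}}) : bool :=
  simple_edges E && [forall u, degree E u == d u].

Definition graphical (d : V -> 'I_#|V|) : Prop := exists E, realizes d E.

Definition realization (d : V -> 'I_#|V|) : finType :=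
  {E : {set {set V}} | realizes d E}.

Definition symdiff (E F : {set {set V}}) : {set {set V}} :=
  (E :\: F) :|: (F :\: E).

Definition realization_graph (d : V -> 'I_#|V|) : rel (realization d) :=
  fun E F => #|symdiff (val E) (val F)| == 4.

Lemma realization_graph_sym d : symmetric (@realization_graph d).
Proof. by move=> E F; rewrite /realization_graph /symdiff setUC. Qed.

Lemma realization_graph_irrefl d : irreflexive (@realization_graph d).
Proof.
by move=> E; rewrite /realization_graph /symdiff setDv setU0 cards0.
Qed.

End Realizations.

(* Main.v *)
Require Import Defs.
From mathcomp Require Import all_boot all_fingroup.
From mathcomp Require Import zify.

(** The graphs with degree function f are handled by induction on the sum of
    the degrees. Fix a vertex v. The graphs in which v has a given
    neighbourhood S are, after deletion of v, the graphs of a smaller degree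
    function, so each such class is Hamilton-laceable or Hamilton-connected by
    induction (max_ham_class). A Hamilton path between two graphs x and y in
    which v has different neighbourhoods is to be found by traversing the
    classes one after the other. This needs an ordering of the classes and a
    control of the places where one class is left and the next one is entered.

    The ordering. Call two sets adjacent when they differ by the exchange of
    one element. The family of the neighbourhoods of v is shifted: it is
    closed under replacing an element by one of at least the same degree. Two
    members of a shifted family are the ends of a Hamilton path of the family
    unless they form a 2-cut of a very special kind (shifted_ham_path). When
    this happens for the neighbourhoods of v in x and y, the vertices of the
    same degree as v are exactly v and the two vertices exchanged
    (exceptional_level), and one of these can replace v (good_vertex).

    The passage. Let two consecutive neighbourhoods differ by the exchange of
    a and b. If f a and f b differ, each graph of one of the two classes has
    two adjacent neighbours in the other one, and since a path that has to end
    at one of two adjacent graphs can always be found, the parity of the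
    colour classes is no obstacle. If f a = f b, swapping the names a and b
    maps one class onto the other, and each graph has two adjacent neighbours
    there or is adjacent to its image. It follows (chain) that the path exists
    unless v is rigid: every class is bipartite with at least two elements and
    only vertices of equal degree are exchanged in the neighbourhood of v.

    Let v be rigid. If the whole graph has a proper colouring and x, y have
    different colours, each class is left at a graph of the colour opposite to
    that of its entry, and the colours fit at the end (parity_ham_path).
    Suppose there is no proper colouring. All exchanges take place inside one
    level, the set of the vertices other than v of one degree. If swapping the
    names of two vertices of the level on the same side of the neighbourhood
    were always a switch, the sign of permutations of the level would extend a
    colouring of one class to all graphs (sign_col_proper). So some swap is
    not a switch, and looking at the private neighbours of the two vertices
    (twin_cases) leaves two possibilities. Either some graph contains a fork
    at a vertex of the level; forks exclude rigidity, and the argument is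
    repeated with a vertex of the level that is exchanged between x and y. Or
    the level has three elements; then there are three copies of one bipartite
    class, any two joined by a perfect matching, and some graph is fixed by a
    swap. Such a configuration is traversed directly, by a zigzag through two
    of the copies if necessary (three_class). *)

Set Implicit Arguments.
Unset Strict Implicit.
Unset Printing Implicit Defensive.

(** * Spanning paths, laceability and connectedness *)

Section SpanningPaths.
Variables (T : finType) (e : rel T).
Implicit Types (C D : {set T}) (x y z : T).

(** The vertex set is a parameter because classes of graphs are traversed
    separately and the paths are then joined. *)
Definition ham_path C x y :=
  exists p, [/\ path e x p, last x p = y, uniq (x :: p) & x :: p =i C].

Definition proper_col (c : T -> bool) C :=
  forall x y, x \in C -> y \in C -> e x y -> c x != c y.

Definition bipartite_on C := [exists c : {ffun T -> bool},
  [forall x in C, forall y in C, e x y ==> (c x != c y)]].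

(** The property proved by induction. Laceability is asked for every proper
    colouring of C and says nothing about the sizes of the colour classes; the
    last clause makes both colours occur as soon as there are two vertices. *)
Record max_ham C : Prop := MaxHam {
  mh_lace : forall c, proper_col c C ->
    forall x y, x \in C -> y \in C -> c x != c y -> ham_path C x y;
  mh_conn : ~~ bipartite_on C ->
    forall x y, x \in C -> y \in C -> x != y -> ham_path C x y;
  mh_edge : 1 < #|C| -> exists x y, [/\ x \in C, y \in C & e x y] }.

Lemma bipartite_onP C : reflect (exists c, proper_col c C) (bipartite_on C).
Proof.
apply: (iffP existsP) => [[c /forall_inP cP]|[c cP]].
  by exists c => x y xC yC; apply/implyP; move/forall_inP: (cP x xC); apply.
exists [ffun x => c x]; apply/forall_inP => x xC; apply/forall_inP => y yC.
by apply/implyP => exy; rewrite !ffunE cP.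
Qed.

Lemma ham_path_memL C x y : ham_path C x y -> x \in C.
Proof. by case=> p [_ _ _ <-]; rewrite mem_head. Qed.

Lemma ham_path1 x : ham_path [set x] x x.
Proof. by exists [::]; split => // z; rewrite !inE. Qed.

Lemma ham_path_cat C D x u w y :
  ham_path C x u -> ham_path D w y -> e u w -> [disjoint C & D] -> ham_path (C :|: D) x y.
Proof.
move=> [p [pp lp up mp]] [q [pq lq uq mq]] euw dCD.
exists (p ++ w :: q); split.
- by rewrite cat_path pp /= lp euw.
- by rewrite last_cat.
- rewrite -cat_cons cat_uniq up uq andbT. rewrite andTb.
  apply/hasPn => z; rewrite mq mp => zD; apply: contraL dCD => zC.
  by apply/pred0Pn; exists z; rewrite /= zC.
- by move=> z; rewrite -cat_cons mem_cat mp mq inE.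
Qed.

Lemma ham_path_sym C x y : symmetric e -> ham_path C x y -> ham_path C y x.
Proof.
move=> esym [p [pp lp up mp]]; exists (rev (belast x p)); split.
- by rewrite -lp rev_path (eq_path (e' := e)).
- by rewrite -lp; case: p {pp lp up mp} => //= a p; rewrite rev_cons last_rcons.
- by rewrite -lp -rev_rcons -lastI rev_uniq.
- by move=> z; rewrite -lp -rev_rcons -lastI mem_rev mp.
Qed.

Lemma path_parity c C x p : proper_col c C -> {subset x :: p <= C} -> path e x p ->
  c (last x p) = c x (+) odd (size p).
Proof.
move=> cP; elim: p x => [|w p IH] x sub /=; first by rewrite addbF.
case/andP=> exw pp; rewrite IH //; last by move=> z zp; rewrite sub // inE zp orbT.
have := cP x w; rewrite !sub ?mem_head ?inE ?eqxx ?orbT // => /(_ isT isT exw).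
by case: (c x); case: (c w); case: (odd _).
Qed.

(** Both colourings change at every step of a path, so their sum does not. *)
Lemma colour_rigid c d C x y z : proper_col c C -> proper_col d C -> ham_path C x y ->
  z \in C -> c z (+) d z = c x (+) d x.
Proof.
move=> cP dP [p [pp _ _ mp]] zC; have zp: z \in x :: p by rewrite mp.
case/splitPl: zp pp mp => p1 p2 lp pp mp.
have pp1: path e x p1 by move: pp; rewrite cat_path => /andP[].
have sub: {subset x :: p1 <= C}.
  by move=> u up; rewrite -mp -cat_cons mem_cat up.
rewrite -lp (path_parity cP sub pp1) (path_parity dP sub pp1).
by case: (c x); case: (d x); case: (odd _).
Qed.

Hypothesis esym : symmetric e.
Hypothesis eirr : irreflexive e.

(** Two adjacent targets are enough to avoid any parity condition: in the
    bipartite case they have different colours, in the other case one of them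
    differs from x. *)
Lemma mh_hit C x h1 h2 : max_ham C -> x \in C -> h1 \in C -> h2 \in C ->
  e h1 h2 -> ham_path C x h1 \/ ham_path C x h2.
Proof.
move=> [lace conn _] xC h1C h2C e12.
have [/bipartite_onP[c cP]|nbi] := boolP (bipartite_on C).
  have := cP _ _ h1C h2C e12; have [cx1|cx1] := eqVneq (c x) (c h1) => c12.
    by right; apply: (lace c) => //; rewrite cx1.
  by left; apply: (lace c).
have [->|x1] := eqVneq x h1; last by left; apply: conn.
right; apply: conn => //; apply: contraTneq e12 => ->.
by rewrite eirr.
Qed.

Lemma mh_reach C x : max_ham C -> x \in C -> exists2 y, y \in C & ham_path C x y.
Proof.
move=> mh xC; have [le1|/(mh_edge mh)[u [w [uC wC euw]]]] := leqP #|C| 1.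
  exists x => //; suff ->: C = [set x] by apply: ham_path1.
  by apply/eqP; rewrite eq_sym eqEcard sub1set xC cards1 le1.
by case: (mh_hit mh xC uC wC euw) => h; [exists u|exists w].
Qed.

Lemma nonbipartite_card C : ~~ bipartite_on C -> 2 < #|C|.
Proof.
apply: contraR; rewrite -leqNgt => le2; apply/bipartite_onP.
have [->|[x xC]] := set_0Vmem C; first by exists xpredT => x y; rewrite inE.
exists (pred1 x) => u w uC wC euw.
have uw: u != w by apply: contraTneq euw => ->; rewrite eirr.
rewrite /=; have [ux|ux] := eqVneq u x.
  by have [wx|wx] := eqVneq w x; rewrite ?ux ?wx ?eqxx // in uw *.
have [wx|wx] := eqVneq w x => //.
have sub: [set u; w; x] \subset C by rewrite !subUset !sub1set uC wC xC.
have := subset_leq_card sub; rewrite setUC cardsU1 cards2 !inE uw.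
by rewrite eq_sym (negPf ux) eq_sym (negPf wx) /= => /leq_trans/(_ le2).
Qed.

(** In the prism over a path, cross to the other copy in every column; the
    parity of the number of columns tells in which copy the walk ends. *)
Lemma zigzag (t : T -> T) x p : involutive t -> {mono t : x y / e x y} ->
  (forall z, z \in x :: p -> e z (t z)) ->
  path e x p -> uniq (x :: p) -> (forall z, z \in x :: p -> t z \notin x :: p) ->
  exists q, [/\ path e x q,
    last x q = (if odd (size p) then last x p else t (last x p)),
    uniq (x :: q) & forall z, (z \in x :: q) = (z \in x :: p) || (t z \in x :: p)].
Proof.
move=> tK te; elim: p x => [|w p IH] x ext.
  move=> _ _ dis; exists [:: t x]; split=> //=.
  - by rewrite ext ?mem_head.
  - rewrite andbT inE; apply: contra (dis x (mem_head _ _)) => /eqP <-.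
    exact: mem_head.
  - by move=> z; rewrite !inE (can2_eq tK tK).
move=> /= /andP[exw pp] /andP[xwp uwp] dis.
have [||||q [pq lq uq mq]] := IH w.
- by move=> z zp; apply: ext; rewrite inE zp orbT.
- by [].
- by [].
- move=> z zp; have: t z \notin x :: w :: p by apply: dis; rewrite inE zp orbT.
  by rewrite inE negb_or => /andP[].
have mtq z : (z \in t w :: map t q) = (z \in w :: q).
  by rewrite -map_cons -{1}[z]tK (mem_map (can_inj tK)) !mq tK orbC.
exists (t x :: t w :: map t q); split.
- rewrite /= ext ?mem_head // te exw /= path_map.
  by rewrite (eq_path (e' := e)) // => a b /=; rewrite te.
- by rewrite /= last_map lq; case: (odd (size p)); rewrite /= ?tK.
- have uq': uniq (t w :: map t q) by rewrite -map_cons map_inj_uniq //; apply: can_inj tK.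
  have xn: x \notin w :: p by [].
  have dx := dis x (mem_head _ _).
  have txn: t x \notin w :: p.
    by apply: contra dx; rewrite [t x \in x :: _]inE => ->; rewrite orbT.
  have txx: x != t x.
    by apply: contra dx => /eqP <-; exact: mem_head.
  apply/andP; split; last apply/andP; last split=> //.
    by rewrite in_cons negb_or txx mtq mq negb_or xn txn.
  by rewrite mtq mq negb_or tK xn txn.
- move=> z; rewrite !inE -[(z == t w) || _]/(z \in t w :: map t q) mtq mq.
  by rewrite (can2_eq tK tK) !inE; do !case: (_ == _) => //=; rewrite ?orbT.
Qed.

End SpanningPaths.

Section Transport.
Variables (T T' : finType) (e : rel T) (e' : rel T') (phi : T -> T').
Implicit Types (C : {set T}).

Lemma ham_path_map C x y : {in C &, injective phi} ->
  {in C &, forall x y, e' (phi x) (phi y) = e x y} ->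
  ham_path e C x y -> ham_path e' (phi @: C) (phi x) (phi y).
Proof.
move=> inj mono [p [pp lp up mp]]; exists (map phi p).
have sub z : z \in x :: p -> z \in C by rewrite mp.
split.
- by rewrite (mono_path_in (P := mem C) (e := e)) //; apply/allP.
- by rewrite last_map lp.
- rewrite -map_cons map_inj_in_uniq // => a b aC bC; apply: inj; exact: sub.
- move=> z; rewrite -map_cons; apply/mapP/imsetP => -[a aC ->]; exists a => //.
    exact: sub.
  by rewrite mp.
Qed.

Lemma bipartite_on_map C : {in C &, forall x y, e x y -> e' (phi x) (phi y)} ->
  bipartite_on e' (phi @: C) -> bipartite_on e C.
Proof.
move=> homo /bipartite_onP[c cP]; apply/bipartite_onP; exists (c \o phi) => x y xC yC exy.
by apply: cP; rewrite ?imset_f ?homo.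
Qed.

Lemma max_ham_map C : {in C &, injective phi} ->
  {in C &, forall x y, e' (phi x) (phi y) = e x y} ->
  max_ham e C -> max_ham e' (phi @: C).
Proof.
move=> inj mono mh; split.
- move=> c cP _ _ /imsetP[x xC ->] /imsetP[y yC ->] cxy.
  apply: ham_path_map => //; apply: (mh_lace mh (c := c \o phi)) => // u w uC wC euw.
  by apply: cP; rewrite ?imset_f ?mono.
- move=> nbi _ _ /imsetP[x xC ->] /imsetP[y yC ->] nxy.
  apply: ham_path_map => //; apply: (mh_conn mh) => //; last first.
    by apply: contraNneq nxy => ->.
  apply: contra nbi => /bipartite_onP[c cP]; apply/bipartite_onP.
  (* The colouring transported along phi, which is injective on C only. *)
  pose c' z := [exists x in C, (phi x == z) && c x].
  have E w : w \in C -> c' (phi w) = c w.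
    move=> wC; apply/exists_inP/idP => [[v vC /andP[/eqP/inj-> //]]|cw].
    by exists w; rewrite ?eqxx.
  exists c' => _ _ /imsetP[u uC ->] /imsetP[w wC ->].
  by rewrite mono // !E //; apply: cP.
- rewrite card_in_imset // => /(mh_edge mh)[x [y [xC yC exy]]].
  by exists (phi x), (phi y); rewrite !imset_f // mono.
Qed.

End Transport.

(** * Exchanges in families of sets *)

Section Exchange.
Variable V : finType.
Implicit Types (S W Z X Y : {set V}) (F : {set {set V}}).

Definition exch S a b := b |: (S :\ a).

Definition exch_adj S S' := (#|S :\: S'| == 1) && (#|S' :\: S| == 1).

Lemma exch_adj_sym : symmetric exch_adj.
Proof. by move=> S S'; rewrite /exch_adj andbC. Qed.

Lemma exch_adjP S S' :
  reflect (exists a b, [/\ a \in S, b \notin S & S' = exch S a b]) (exch_adj S S').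
Proof.
apply: (iffP andP) => [[/cards1P[a ea] /cards1P[b eb]]|[a [b [aS bS ->]]]].
  have aSS: a \in S :\: S' by rewrite ea inE.
  have bSS: b \in S' :\: S by rewrite eb inE.
  move: aSS bSS; rewrite !inE => /andP[aS' aS] /andP[bS bS'].
  exists a, b; split=> //; apply/setP=> x; rewrite !inE.
  have [->|xb] := eqVneq x b; first by rewrite bS'.
  have [->|xa] /= := eqVneq x a; first by rewrite (negPf aS').
  have := in_set1 x a; rewrite -ea inE (negPf xa).
  have := in_set1 x b; rewrite -eb inE (negPf xb).
  by case: (x \in S); case: (x \in S').
have ab: a != b by apply: contraNneq bS => <-.
split; apply/cards1P; [exists a|exists b]; apply/setP=> x; rewrite !inE.
  have [->|xa] := eqVneq x a; first by rewrite (negPf ab) aS.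
  by case: (x \in S); rewrite ?orbT ?andbF.
have [->|xb] := eqVneq x b; first by rewrite bS.
by case: (x \in S); rewrite ?andbF.
Qed.

Lemma exch_adj_exch S a b : a \in S -> b \notin S -> exch_adj S (exch S a b).
Proof. by move=> aS bS; apply/exch_adjP; exists a, b. Qed.

Lemma card_exch S a b : a \in S -> b \notin S -> #|exch S a b| = #|S|.
Proof.
move=> aS bS; rewrite cardsU1 !inE (negPf bS) andbF (cardsD1 a S) aS.
by [].
Qed.

(** Let the sets in F have equal size. When X and Y are removed, a member of F
    above C = X :&: Y has the form C plus a new element, a member below X :|:
    Y misses an element of C, and such sets are not adjacent. So X and Y form
    a 2-cut of the family, and they are not the ends of a Hamilton path. By
    shifted_ham_path this is the only obstruction in a shifted family. *)
Definition exceptional F X Y := [&& exch_adj X Y,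
  [forall S in F, (X :&: Y \subset S) || (S \subset X :|: Y)],
  [exists S in F, ~~ (S \subset X :|: Y)] &
  [exists S in F, ~~ (X :&: Y \subset S)]].

Lemma exceptional_sym F X Y : exceptional F X Y = exceptional F Y X.
Proof. by rewrite /exceptional exch_adj_sym setIC setUC. Qed.

Lemma exchI S a b : a \in S -> b \notin S -> S :&: exch S a b = S :\ a.
Proof.
move=> aS bS; apply/setP=> x; rewrite !inE.
have [->|xb] := eqVneq x b; first by rewrite (negPf bS) andbF.
by case: (x \in S); rewrite ?andbF.
Qed.

Lemma exchU S a b : a \in S -> S :|: exch S a b = b |: S.
Proof.
move=> aS; apply/setP=> x; rewrite !inE.
have [->|xa] := eqVneq x a; first by rewrite aS !orbT.
by case: (x \in S); rewrite ?orbT ?orbF.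
Qed.

Lemma exceptionalP F X Y : exceptional F X Y -> exists b e,
  [/\ b \in X, e \notin X & Y = exch X b e] /\
  [/\ forall S, S \in F -> X :\ b \subset S \/ S \subset e |: X,
      exists S, [/\ S \in F, X :\ b \subset S & ~~ (S \subset e |: X)] &
      exists S, [/\ S \in F, ~~ (X :\ b \subset S) & S \subset e |: X]].
Proof.
case/and4P=> /exch_adjP[b [e [bX eX ->]]]; rewrite exchI // exchU //.
move=> /forall_inP al /exists_inP[S1 S1F n1] /exists_inP[S2 S2F n2].
exists b, e; split=> //; split.
- by move=> S SF; apply/orP/al.
- exists S1; split=> //. by have := al _ S1F; rewrite (negPf n1) orbF.
- exists S2; split=> //. by have := al _ S2F; rewrite (negPf n2).
Qed.

Definition same_card F := forall S S', S \in F -> S' \in F -> #|S| = #|S'|.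

Lemma sub_same F S S' : same_card F -> S \in F -> S' \in F -> S \subset S' -> S = S'.
Proof. by move=> sc SF S'F s; apply/eqP; rewrite eqEcard s (sc _ _ S'F SF) leqnn. Qed.

Lemma exch_adj_setD F S S' x : same_card F -> S \in F -> S' \in F ->
  S :\: S' = [set x] -> exch_adj S S'.
Proof.
move=> sc SF S'F E; rewrite /exch_adj E cards1 eqxx /=.
have h1 := cardsID S' S; have h2 := cardsID S S'.
rewrite E cards1 setIC in h1; move: h1 h2; rewrite (sc _ _ S'F SF).
by move=> <- /addnI ->.
Qed.

(** The members of F on the two sides of the cut determine the inserted and
    the removed element. *)
Lemma exceptional_mate F X Y Y' : same_card F -> X \in F -> Y \in F ->
  exceptional F X Y -> exceptional F X Y' -> Y = Y'.
Proof.
move=> sc XF YF /exceptionalP[b [e [[bX eX YE] [_ [S1 [S1F T1 U1]] [S2 [S2F T2 U2]]]]]].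
case/exceptionalP=> [b' [e' [[b'X e'X ->] [al' _ _]]]]; rewrite YE.
have ee: e = e'.
  apply/eqP; apply: contraNT T2 => ne.
  have S2X : S2 \subset e' |: X -> X :\ b \subset S2.
    move=> U'; suff -> : S2 = X by rewrite subsetDl.
    apply: (sub_same sc) => //; apply/subsetP => x xS.
    have := subsetP U2 x xS; have := subsetP U' x xS; rewrite !inE.
    by have [->|//] := eqVneq x e'; rewrite eq_sym (negPf ne).
  have [bb|bb] := eqVneq b b'; first by case: (al' _ S2F) => // ; rewrite bb.
  have YU: Y \subset e' |: X.
    have [sub|//] := al' _ YF.
    have: b \in Y by apply: (subsetP sub); rewrite !inE bb.
    by rewrite YE /exch !inE eqxx orbF => /eqP be; rewrite -be bX in eX.
  have := subsetP YU e; rewrite YE /exch !inE eqxx (negPf eX) orbF /= => /(_ isT).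
  by rewrite (negPf ne).
have [<-|bb] := eqVneq b b'; first by rewrite ee.
case/negP: U1; rewrite ee in T1 *.
case: (al' _ S1F) => // T1'; suff <- : X = S1 by rewrite subsetUr.
apply: (sub_same sc) => //; apply/subsetP => x xX.
have [xb|xb] := eqVneq x b; last by apply: (subsetP T1); rewrite !inE xb.
by apply: (subsetP T1'); rewrite !inE xX xb bb.
Qed.

(** The sets at which a Hamilton path of F started at X may be expected to
    end, as proved in shifted_ham_path; in a one-element family this is X
    itself. *)
Definition good F X W := if F == [set X] then W == X else (W != X) && ~~ exceptional F X W.

(** X has a single mate, namely W, and S is neither of the two. *)
Lemma exceptional_goodU F X W S : same_card F -> X \in F -> W \in F -> exceptional F X W ->
  S \in F -> ~~ (S \subset X :|: W) -> good F X S.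
Proof.
move=> sc XF WF ex SF nS; rewrite /good ifN; last first.
  by apply: contraNneq nS => E; move: SF; rewrite E inE => /eqP->; apply: subsetUl.
apply/andP; split; first by apply: contraNneq nS => ->; apply: subsetUl.
by apply: contra nS => ex1; rewrite -(exceptional_mate sc XF WF ex ex1) subsetUr.
Qed.

Lemma exceptional_goodI F X W S : same_card F -> X \in F -> W \in F -> exceptional F X W ->
  S \in F -> ~~ (X :&: W \subset S) -> good F X S.
Proof.
move=> sc XF WF ex SF nS; rewrite /good ifN; last first.
  by apply: contraNneq nS => E; move: SF; rewrite E inE => /eqP->; apply: subsetIl.
apply/andP; split; first by apply: contraNneq nS => ->; apply: subsetIl.
by apply: contra nS => ex1; rewrite -(exceptional_mate sc XF WF ex ex1) subsetIr.
Qed.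

Lemma good_exists F X : same_card F -> X \in F -> exists2 W, W \in F & good F X W.
Proof.
move=> sc XF; have [FX|FX] := eqVneq F [set X].
  by exists X; rewrite // /good FX !eqxx.
have [W WF WX] : exists2 W, W \in F & W != X.
  apply/exists_inP; apply: contraNT FX => /exists_inPn h.
  rewrite eqEsubset sub1set XF andbT; apply/subsetP=> W /h; rewrite inE negbK //.
have [ex|nex] := boolP (exceptional F X W); last by exists W; rewrite // /good ifN // WX.
have /and4P[_ _ /exists_inP[S SF nS] _] := ex.
by exists S => //; apply: exceptional_goodU ex _ _.
Qed.

Lemma not_good F X W W' : W \in F -> W' \in F -> W != W' -> ~~ good F X W ->
  W = X \/ exceptional F X W.
Proof.
move=> WF W'F ne; rewrite /good ifN.
  by rewrite negb_and !negbK => /orP[/eqP|]; [left|right].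
by apply: contraNneq ne => FE; move: WF W'F; rewrite FE !inE => /eqP-> /eqP->.
Qed.

End Exchange.

(** * Shifted families *)

Section Shifted.
Variables (V : finType) (key : V -> nat).
Hypothesis keyI : injective key.
Implicit Types (S W Z X Y D : {set V}) (F : {set {set V}}).

(** The elements outside D are frozen. After it has been decided whether a
    pivot in D belongs to the sets, both parts of the family are again
    shifted, with the pivot frozen. Smaller keys are better; there are k free
    elements in each set. *)
Record shifted D k F : Prop := Shifted {
  sh_card : forall S, S \in F -> #|S :&: D| = k;
  sh_fix : forall S S', S \in F -> S' \in F -> S :\: D = S' :\: D;
  sh_up : forall S a b, S \in F -> a \in S -> a \in D -> b \in D -> b \notin S ->
    key b < key a -> exch S a b \in F }.

Lemma sh_same D k F : shifted D k F -> same_card F.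
Proof.
move=> [c f _] S S' SF S'F.
by rewrite -(cardsID D S) -(cardsID D S') !c // (f S S').
Qed.

Definition fam_in F e := [set S in F | e \in S].
Definition fam_out F e := [set S in F | e \notin S].

Lemma same_fam_in F e : same_card F -> same_card (fam_in F e).
Proof. by move=> sc S S'; rewrite !inE => /andP[? _] /andP[? _]; apply: sc. Qed.

Lemma same_fam_out F e : same_card F -> same_card (fam_out F e).
Proof. by move=> sc S S'; rewrite !inE => /andP[? _] /andP[? _]; apply: sc. Qed.

Lemma shifted_in D k F e : e \in D -> shifted D k F -> shifted (D :\ e) k.-1 (fam_in F e).
Proof.
move=> eD [c f u]; split.
- move=> S; rewrite inE => /andP[SF eS].
  by rewrite -(c S SF) (cardsD1 e (S :&: D)) inE eS eD setIDA.
- move=> S S'; rewrite !inE => /andP[SF eS] /andP[S'F eS'].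
  apply/setP=> x; rewrite !inE; have /setP/(_ x) := f _ _ SF S'F; rewrite !inE.
  by have [->|//] := eqVneq x e; rewrite eS eS'.
- move=> S a b; rewrite !inE => /andP[SF eS] aS /andP[ae aD] /andP[be bD] bS lt.
  by rewrite u // eS orbC eq_sym ae.
Qed.

Lemma shifted_out D k F e : e \in D -> shifted D k F -> shifted (D :\ e) k (fam_out F e).
Proof.
move=> eD [c f u]; split.
- move=> S; rewrite inE => /andP[SF eS].
  by rewrite -(c S SF) setIDA (setDidPl _) // disjoint_sym disjoints1 inE (negPf eS).
- move=> S S'; rewrite !inE => /andP[SF eS] /andP[S'F eS'].
  apply/setP=> x; rewrite !inE; have /setP/(_ x) := f _ _ SF S'F; rewrite !inE.
  by have [->|//] := eqVneq x e; rewrite (negPf eS) (negPf eS').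
- move=> S a b; rewrite !inE => /andP[SF eS] aS /andP[ae aD] /andP[be bD] bS lt.
  by rewrite u // (negPf eS) eq_sym (negPf be) andbF.
Qed.

(** Hamilton paths of the two parts of F at the pivot e, started at X and at
    Y, cannot be joined by an exchange. *)
Definition unbridged F e X Y := forall W Z, W \in fam_in F e -> Z \in fam_out F e ->
  exch_adj W Z -> good (fam_in F e) X W -> good (fam_out F e) Y Z -> False.

Lemma exch_triangle W e c1 c2 : e \in W -> c1 \notin W -> c2 \notin W -> c1 != c2 ->
  exch W e c1 :\ c1 = W :\ e /\ c2 |: exch W e c1 = c2 |: (c1 |: W :\ e).
Proof.
move=> eW c1W c2W ne; split; apply/setP=> x; rewrite !inE.
have [->|] := eqVneq x c1; first by rewrite (negPf c1W) andbF.
by [].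
by [].
Qed.

(** Neither of the two sets obtained from W is a good end, so they are Y and
    its mate. Then the members above their intersection W :\ e contain a third
    neighbour of W, and this one is a good end. *)
Lemma two_in F e X Y W c1 c2 : same_card F -> Y \in fam_out F e -> unbridged F e X Y ->
  W \in fam_in F e -> good (fam_in F e) X W -> c1 \notin W -> c2 \notin W -> c1 != c2 ->
  exch W e c1 \in F -> exch W e c2 \in F -> False.
Proof.
move=> sc YB bd WA gW c1W c2W ne Z1F Z2F.
have eW : e \in W by move: WA; rewrite inE => /andP[].
have out c : c \notin W -> e \notin exch W e c.
  by move=> cW; rewrite !inE eqxx orbF; apply: contraNneq cW => <-.
have Z1B : exch W e c1 \in fam_out F e by rewrite inE Z1F out.
have Z2B : exch W e c2 \in fam_out F e by rewrite inE Z2F out.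
have scB := @same_fam_out F e sc.
have c1in : c1 \notin exch W e c2 by rewrite !inE (negPf ne) (negPf c1W) andbF.
have c2in : c2 \notin exch W e c1 by rewrite !inE eq_sym (negPf ne) (negPf c2W) andbF.
have Zne : exch W e c1 != exch W e c2.
  by apply: contraNneq c1in => <-; rewrite setU11.
have n1 : ~~ good (fam_out F e) Y (exch W e c1).
  by apply/negP=> g; apply: (bd _ _ WA Z1B) => //; apply: exch_adj_exch.
have n2 : ~~ good (fam_out F e) Y (exch W e c2).
  by apply/negP=> g; apply: (bd _ _ WA Z2B) => //; apply: exch_adj_exch.
(* Y and its mate are the two neighbours, so their intersection is W :\ e and a
   third member of the exceptional family extends it. *)
have key_step d1 d2 : d1 \notin W -> d2 \notin W -> d1 != d2 ->
    exch W e d2 \in fam_out F e -> Y = exch W e d1 ->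
    exceptional (fam_out F e) Y (exch W e d2) -> False.
  move=> d1W d2W dne Z2B' YE ex.
  have [b [c [[bY cY E] [_ [S1 [S1B T1 U1]] _]]]] := exceptionalP ex.
  have cd : c = d2.
    have : c \in exch W e d2 by rewrite E setU11.
    rewrite inE in_set1 => /orP[/eqP//|cW].
    by move: cY; rewrite YE inE cW orbT.
  have bd1 : b = d1.
    have : d1 \notin exch Y b c.
      by rewrite -E !inE (negPf dne) (negPf d1W) andbF.
    rewrite !inE YE setU11 andbT negb_or negbK => /andP[_ /eqP//].
  have S1F : S1 \in F by move: S1B; rewrite inE => /andP[].
  have sub : W :\ e \subset S1.
    by apply: subset_trans T1; rewrite bd1 YE (exch_triangle eW d1W d2W dne).1.
  have eS1 : e \notin S1 by move: S1B; rewrite inE => /andP[].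
  have WF : W \in F by move: WA; rewrite inE => /andP[].
  have WS : W :\: S1 = [set e].
    apply/setP=> x; rewrite !inE; have [->|xe] := eqVneq x e; first by rewrite eS1.
    by apply/andP=> -[xS xW]; case/negP: xS; apply: (subsetP sub); rewrite !inE xe.
  have adj1 : exch_adj W S1 by apply: (exch_adj_setD sc WF S1F WS).
  apply: (bd _ _ WA S1B) => //; apply: (exceptional_goodU scB YB Z2B' ex) => //.
  by rewrite E exchU.
have Zne' : exch W e c2 != exch W e c1 by rewrite eq_sym.
case: (not_good Z1B Z2B Zne n1) => [Y1|ex1]; case: (not_good Z2B Z1B Zne' n2) => [Y2|ex2].
- by case/eqP: Zne; rewrite Y1 Y2.
- exact: (key_step c1 c2).
- by apply: (key_step c2 c1) => //; rewrite eq_sym.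
- by case/eqP: Zne; apply: (exceptional_mate scB YB Z1B ex1 ex2).
Qed.

(** Dual to two_in: the two sets are X and its mate, their union is e |: Z,
    and a third member below it is a neighbour of Z. *)
Lemma two_out F e X Y Z g1 g2 : same_card F -> X \in fam_in F e -> unbridged F e X Y ->
  Z \in fam_out F e -> good (fam_out F e) Y Z -> g1 \in Z -> g2 \in Z -> g1 != g2 ->
  exch Z g1 e \in F -> exch Z g2 e \in F -> False.
Proof.
move=> sc XA bd ZB gZ g1Z g2Z ne W1F W2F.
have eZ : e \notin Z by move: ZB; rewrite inE => /andP[].
have ein g : e \in exch Z g e by rewrite setU11.
have W1A : exch Z g1 e \in fam_in F e by rewrite inE W1F ein.
have W2A : exch Z g2 e \in fam_in F e by rewrite inE W2F ein.
have scA := @same_fam_in F e sc.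
have adjW g : g \in Z -> exch_adj (exch Z g e) Z by move=> gZ'; rewrite exch_adj_sym exch_adj_exch.
have nin g : g \in Z -> g \notin exch Z g e.
  by move=> gZ'; rewrite !inE eqxx orbF; apply: contraNneq eZ => <-.
have inn g g' : g' \in Z -> g' != g -> g' \in exch Z g e.
  by move=> gZ' ne'; rewrite !inE ne' gZ' orbT.
have Wne : exch Z g1 e != exch Z g2 e.
  by apply: contraTneq (inn g2 g1 g1Z ne) => <-; apply: nin.
have n1 : ~~ good (fam_in F e) X (exch Z g1 e).
  by apply/negP=> g; apply: (bd _ _ W1A ZB) => //; apply: adjW.
have n2 : ~~ good (fam_in F e) X (exch Z g2 e).
  by apply/negP=> g; apply: (bd _ _ W2A ZB) => //; apply: adjW.
have key_step d1 d2 : d1 \in Z -> d2 \in Z -> d1 != d2 ->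
    exch Z d2 e \in fam_in F e -> X = exch Z d1 e ->
    exceptional (fam_in F e) X (exch Z d2 e) -> False.
  move=> d1Z d2Z dne W2A' XE ex.
  have [b [c [[bX cX E] [_ _ [S2 [S2A T2 U2]]]]]] := exceptionalP ex.
  have cd : c = d1.
    have : d1 \in exch X b c by rewrite -E inn.
    rewrite inE in_set1 => /orP[/eqP->//|]; rewrite inE => /andP[_].
    by rewrite XE (negPf (nin _ d1Z)).
  have bd2 : b = d2.
    have : d2 \notin exch X b c by rewrite -E nin.
    rewrite !inE XE inn // 1?eq_sym // andbT negb_or negbK.
    by move=> /andP[_ /eqP//].
  have S2F : S2 \in F by move: S2A; rewrite inE => /andP[].
  have ZF : Z \in F by move: ZB; rewrite inE => /andP[].
  have eS2 : e \in S2 by move: S2A; rewrite inE => /andP[].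
  have SZ : S2 :\: Z = [set e].
    apply/setP=> x; rewrite !inE; have [->|xe] := eqVneq x e; first by rewrite eS2 eZ.
    apply/andP=> -[xZ xS]; have := subsetP U2 x xS.
    rewrite XE cd !inE (negPf xe) (negPf xZ) andbF /= orbF => /eqP xd.
    by rewrite xd d1Z in xZ.
  have adj1 : exch_adj S2 Z by apply: (exch_adj_setD sc S2F ZF SZ).
  apply: (bd _ _ S2A ZB) => //; apply: (exceptional_goodI scA XA W2A' ex) => //.
  by rewrite E exchI.
have Wne' : exch Z g2 e != exch Z g1 e by rewrite eq_sym.
case: (not_good W1A W2A Wne n1) => [X1|ex1]; case: (not_good W2A W1A Wne' n2) => [X2|ex2].
- by case/eqP: Wne; rewrite X1 X2.
- exact: (key_step g1 g2).
- by apply: (key_step g2 g1) => //; rewrite eq_sym.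
- by case/eqP: Wne; apply: (exceptional_mate scA XA W1A ex1 ex2).
Qed.

Definition better D e := [set c in D | key c < key e].

(** Each element better than e that is missing from W can replace e in W, and
    two_in allows one such replacement. *)
Lemma good_in D k F e X Y W : shifted D k F -> e \in D -> Y \in fam_out F e ->
  unbridged F e X Y -> W \in fam_in F e -> good (fam_in F e) X W -> #|better D e :\: W| <= 1.
Proof.
move=> sh eD YB bd WA gW; rewrite leqNgt; apply/negP=> /card_gt1P[c1 [c2 []]].
move: (WA); rewrite !inE => /andP[WF eW] /andP[c1W /andP[c1D l1]].
move=> /andP[c2W /andP[c2D l2]] ne.
apply: (two_in (sh_same sh) YB bd WA gW c1W c2W ne).
  exact: (sh_up sh).
exact: (sh_up sh).
Qed.

(** Each free element of Z worse than e can be replaced by e, and two_out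
    allows one such replacement. *)
Lemma good_out D k F e X Y Z : shifted D k F -> e \in D -> X \in fam_in F e ->
  unbridged F e X Y -> Z \in fam_out F e -> good (fam_out F e) Y Z -> #|(Z :&: D) :\: better D e| <= 1.
Proof.
move=> sh eD XA bd ZB gZ; rewrite leqNgt; apply/negP=> /card_gt1P[c1 [c2 []]].
move: (ZB); rewrite !inE => /andP[ZF eZ] /andP[+ /andP[c1Z c1D]].
move=> + /andP[+ /andP[c2Z c2D]] ne; rewrite c1D c2D /= -!leqNgt => l1 l2.
have lt c : c \in Z -> key e <= key c -> key e < key c.
  move=> cZ; rewrite leq_eqVlt => /orP[/eqP/keyI ec|//].
  by rewrite ec cZ in eZ.
apply: (two_out (sh_same sh) XA bd ZB gZ c1Z c2Z ne).
  by apply: (sh_up sh) => //; apply: lt.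
by apply: (sh_up sh) => //; apply: lt.
Qed.

(** Count the elements better than e in a good end W containing e and in a
    good end Z not containing e. Only two ranks remain for e, so at most two
    elements separate X from Y when no separating pivot has a bridge. *)
Lemma pivot_rank D k F e X Y : shifted D k F -> e \in D -> X \in fam_in F e ->
  Y \in fam_out F e -> unbridged F e X Y -> k.-1 <= #|better D e| <= k /\ 0 < k.
Proof.
move=> sh eD XA YB bd; have sc := sh_same sh.
have [W WA gW] := good_exists (@same_fam_in F e sc) XA.
have [Z ZB gZ] := good_exists (@same_fam_out F e sc) YB.
have h1 := good_in sh eD YB bd WA gW.
have h2 := good_out sh eD XA bd ZB gZ.
move: (WA) (ZB); rewrite !inE => /andP[WF eW] /andP[ZF eZ].
have kW := sh_card sh WF; have kZ := sh_card sh ZF.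
have k0 : 0 < k by rewrite -kW; apply/card_gt0P; exists e; rewrite inE eW.
have eW' : e \in W :&: D by rewrite inE eW.
have s1 : better D e :&: W \subset (W :&: D) :\ e.
  apply/subsetP=> x; rewrite !inE => /andP[/andP[-> lt] ->]; rewrite !andbT.
  by apply: contraTneq lt => ->; rewrite ltnn.
have e1 : #|(W :&: D) :\ e| = k.-1 by rewrite -kW (cardsD1 e (W :&: D)) eW'.
have a1 : #|better D e| <= k.-1 + 1.
  by rewrite -(cardsID W) leq_add // -e1 subset_leq_card.
have a2 : k <= #|better D e| + 1.
  by rewrite -kZ -(cardsID (better D e) (Z :&: D)) leq_add // subset_leq_card // subsetIr.
by clear -a1 a2 k0; move: #|_| a1 a2 => p; lia.
Qed.

Lemma better_lt D e e' : e \in D -> key e < key e' -> #|better D e| < #|better D e'|.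
Proof.
move=> eD lt; apply: proper_card; apply/properP; split.
  by apply/subsetP=> x; rewrite !inE => /andP[-> /ltn_trans->].
by exists e; rewrite !inE ?eD ?lt // ltnn.
Qed.

Lemma better_inj D e e' : e \in D -> e' \in D -> #|better D e| = #|better D e'| -> e = e'.
Proof.
move=> eD e'D E; case: (ltngtP (key e) (key e')) => [lt|lt|/keyI//].
  by have := better_lt eD lt; rewrite E ltnn.
by have := better_lt e'D lt; rewrite E ltnn.
Qed.

(** M is reached by single exchanges, each of which brings in an element of M.
    *)
Lemma topshift D k F S (M : {set V}) : shifted D k F -> S \in F -> M \subset D -> #|M| = k ->
  (forall m a, m \in M -> m \notin S -> a \in S -> a \in D -> a \notin M ->
     key m < key a) -> (S :\: D) :|: M \in F.
Proof.
move=> sh; move: {2}#|_| (leqnn #|M :\: S|) => n.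
elim: n S => [|n IH] S le SF MD Mk lt.
  have MS : M \subset S by rewrite -setD_eq0 -cards_eq0 -leqn0.
  have ME : M = S :&: D.
    apply/eqP; rewrite eqEcard subsetI MS MD (sh_card sh SF) Mk leqnn //.
  by rewrite ME setUC setID.
have [MS0|[m]] := set_0Vmem (M :\: S); first by apply: IH; rewrite // MS0 cards0.
rewrite inE => /andP[mS mM].
have [a] : exists a, a \in (S :&: D) :\: M.
  apply/set0Pn; apply: contraL mM => /eqP E; have : S :&: D \subset M by rewrite -setD_eq0 E.
  move=> sub; have /eqP <- : S :&: D == M by rewrite eqEcard sub Mk (sh_card sh SF) leqnn.
  by rewrite inE (negPf mS).
rewrite !inE => /andP[aM /andP[aS aD]].
have mD := subsetP MD m mM.
have S'F : exch S a m \in F by apply: (sh_up sh) => //; apply: lt.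
rewrite (sh_fix sh SF S'F); apply: IH => //.
  have : M :\: exch S a m \proper M :\: S.
    apply/properP; split.
      apply/subsetP=> x; rewrite !inE => /andP[h xM]; rewrite xM andbT.
      move: h; rewrite negb_or negb_and negbK => /andP[_ /orP[/eqP xa|//]].
      by rewrite -xa xM in aM.
    by exists m; rewrite !inE ?mS ?mM ?eqxx.
  by move/proper_card => h; rewrite -ltnS (leq_trans h).
move=> m' a' m'M m'S a'S a'D a'M; move: m'S a'S; rewrite !inE.
rewrite negb_or negb_and negbK => /andP[mm /orP[/eqP m'a|m'S]].
  by rewrite -m'a m'M in aM.
move=> /orP[/eqP a'm|/andP[_ a'S]]; first by rewrite a'm mM in a'M.
exact: lt.
Qed.

End Shifted.

(** * Hamilton paths in shifted families *)

Section ShiftedHamilton.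
Variables (V : finType) (key : V -> nat).
Hypothesis keyI : injective key.
Implicit Types (S W Z X Y D C : {set V}) (F : {set {set V}}).

Local Notation shifted := (shifted key).
Local Notation better := (better key).

(** The configuration that is left when no pivot separating X from Y has a
    bridge: X and Y consist of a common set C and one further element each, b
    of rank k - 1 and b' of rank k among the free elements. Then C is the best
    possible set (middle_C), the members of F without b contain C (middle_B),
    those with b' lie in X :|: Y (middle_A), and X is the only other member
    (middle_X). Hence X and Y are exceptional. *)
Section Middle.
Variables (D : {set V}) (k : nat) (F : {set {set V}}) (X Y C : {set V}) (b b' : V).
Hypothesis sh : shifted D k F.
Hypotheses (XF : X \in F) (YF : Y \in F).
Hypotheses (bD : b \in D) (b'D : b' \in D) (bC : b \notin C) (b'C : b' \notin C).
Hypotheses (bb : b != b') (XE : X = b |: C) (YE : Y = b' |: C).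
Hypotheses (k0 : 0 < k) (upb : #|better D b| = k.-1) (upb' : better D b' = b |: better D b).
Hypotheses (unbridged1 : unbridged F b X Y) (unbridged2 : unbridged F b' Y X).

Let P := better D b.
Let sc : same_card F := sh_same sh.
Let bb' : b' != b. Proof. by rewrite eq_sym. Qed.

Let bX : b \in X. Proof. by rewrite XE setU11. Qed.
Let b'Y : b' \in Y. Proof. by rewrite YE setU11. Qed.
Let bY : b \notin Y. Proof. by rewrite YE !inE negb_or bb. Qed.
Let b'X : b' \notin X. Proof. by rewrite XE !inE negb_or bb'. Qed.
Let XA : X \in fam_in F b. Proof. by rewrite inE XF. Qed.
Let YB : Y \in fam_out F b. Proof. by rewrite inE YF. Qed.
Let YA' : Y \in fam_in F b'. Proof. by rewrite inE YF. Qed.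
Let XB' : X \in fam_out F b'. Proof. by rewrite inE XF. Qed.

Let PD : P \subset D. Proof. by apply/subsetP=> x; rewrite inE => /andP[]. Qed.
Let bP : b \notin P. Proof. by rewrite inE ltnn andbF. Qed.
Let b'P : b' \notin P.
Proof.
have : b \in better D b' by rewrite upb' setU11.
by rewrite !inE b'D bD /= -leqNgt => /ltnW.
Qed.
Let key_bb' : key b < key b'.
Proof.
have : b \in better D b' by rewrite upb' setU11.
by rewrite !inE bD.
Qed.

Let worse z : z \in D -> z \notin P -> z != b -> z != b' -> key b' < key z.
Proof.
move=> zD zP zb zb'.
have : z \notin better D b' by rewrite upb' !inE negb_or zb; move: zP; rewrite !inE.
rewrite inE zD /= -leqNgt leq_eqVlt => /orP[/eqP/keyI e|//].
by rewrite e eqxx in zb'.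
Qed.

Let XD : X :\: D = C :\: D.
Proof.
apply/setP=> x; rewrite XE !inE; have [->|//] := eqVneq x b; by rewrite bD.
Qed.

Let fixD S : S \in F -> S :\: D = C :\: D.
Proof. by move=> SF; rewrite (sh_fix sh SF XF). Qed.

Let memD S x : S \in F -> x \notin D -> (x \in S) = (x \in C).
Proof.
by move=> /fixD/setP/(_ x) + xD; rewrite !inE xD.
Qed.

Let T := (C :\: D) :|: P.
Let bT : b \notin T. Proof. by rewrite in_setU inE bD (negPf bP). Qed.
Let b'T : b' \notin T. Proof. by rewrite in_setU inE b'D (negPf b'P). Qed.

Let KF : b |: T \in F.
Proof.
rewrite /T setUCA -XD; apply: (topshift sh) => //.
- by rewrite subUset sub1set bD.
- by rewrite cardsU1 bP upb add1n prednK.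
- move=> m a; rewrite !inE => /orP[/eqP->|]; first by rewrite bX.
  move=> /andP[mD lt] mX aX aD; rewrite negb_or aD /= -leqNgt => /andP[_ le].
  exact: leq_trans le.
Qed.

Let K'F : b' |: T \in F.
Proof.
rewrite /T setUCA -(fixD YF); apply: (topshift sh) => //.
- by rewrite subUset sub1set b'D.
- by rewrite cardsU1 b'P upb add1n prednK.
- move=> m a; rewrite !inE => /orP[/eqP->|]; first by rewrite b'Y.
  move=> /andP[mD lt] mX aX aD; rewrite negb_or aD /= -leqNgt => /andP[_ le].
  exact: leq_trans le.
Qed.

(** Let T consist of the frozen elements and of those better than b. If C were
    different, b |: T and b' |: T would be a bridge unless one of them is the
    mate of X or of Y. In that case, exchanging an element of a third member
    for a better one would lead to a set on neither side of the corresponding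
    cut. *)
Lemma middle_C : C = T.
Proof.
apply/eqP; apply/negPn/negP => CT.
have KA : b |: T \in fam_in F b by rewrite inE KF setU11.
have K'B : b' |: T \in fam_out F b by rewrite inE K'F in_setU1 negb_or bb bT.
have XK : b |: T != X.
  apply: contraNneq CT => E; apply/eqP/setP=> x.
  move/setP/(_ x): E; rewrite XE !in_setU1; have [->|//] := eqVneq x b.
  by rewrite (negPf bC) (negPf bT).
have YK : b' |: T != Y.
  apply: contraNneq CT => E; apply/eqP/setP=> x.
  move/setP/(_ x): E; rewrite YE !in_setU1; have [->|//] := eqVneq x b'.
  by rewrite (negPf b'C) (negPf b'T).
have adjK : exch_adj (b |: T) (b' |: T).
  apply: (exch_adj_setD (x := b) sc KF K'F); apply/setP=> x; rewrite !in_setD !in_setU1.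
  rewrite in_set1; have [->|xb] := eqVneq x b; first by rewrite negb_or bb bT.
  by case: (x \in T); rewrite ?orbT ?andbF.
have [g1|n1] := boolP (good (fam_in F b) X (b |: T)).
  have [g2|n2] := boolP (good (fam_out F b) Y (b' |: T)); first exact: (unbridged1 KA K'B).
  case: (not_good K'B YB YK n2) => [E|]; first by rewrite E eqxx in YK.
  case/exceptionalP=> z [y [[zY yY KE] [al [S1 [S1B T1 U1]] _]]].
  have yb' : y != b' by apply: contraNneq yY => ->.
  have yP : y \in P.
    have : y \in b' |: T by rewrite KE setU11.
    rewrite in_setU1 (negPf yb') in_setU in_setD /= => /orP[/andP[yD yC]|//].
    by rewrite (memD YF yD) yC in yY.
  have zb' : z != b'.
    apply: contraTneq (setU11 b' T) => zE; rewrite KE !inE zE eqxx orbF.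
    by rewrite eq_sym.
  have b'S1 : b' \in S1 by apply: (subsetP T1); rewrite !inE eq_sym zb'.
  have [S1F bS1] : S1 \in F /\ b \notin S1 by move: S1B; rewrite inE => /andP[].
  have yS1 : y \notin S1.
    apply: contra U1 => yS1; suff <- : b' |: T = S1.
      by rewrite KE /exch setUS // subsetDl.
    by apply: (sub_same sc) => //; rewrite KE subUset sub1set yS1 T1.
  have yD := subsetP PD y yP.
  have lt : key y < key b'.
    by apply: ltn_trans key_bb'; move: yP; rewrite inE => /andP[].
  have S'B : exch S1 b' y \in fam_out F b.
    rewrite inE (sh_up sh) // !inE negb_or negb_and bS1 orbT andbT.
    by apply: contraNneq bP => ->.
  case: (al _ S'B) => sub.
    have : b' \in exch S1 b' y by apply: (subsetP sub); rewrite !inE eq_sym zb'.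
    by rewrite !inE eqxx eq_sym (negPf yb').
  case/negP: U1; apply/subsetP=> x xS1; have [->|xb'] := eqVneq x b'.
    by rewrite in_setU1 b'Y orbT.
  by apply: (subsetP sub); rewrite !inE xb' xS1 orbT.
case: (not_good KA XA XK n1) => [E|]; first by rewrite E eqxx in XK.
case/exceptionalP=> z [y [[zX yX KE] [al _ [S2 [S2A T2 U2]]]]].
have zK : z \notin b |: T.
  by rewrite KE !inE eqxx orbF; apply: contraNneq yX => <-.
have zb : z != b by apply: contraNneq zK => ->; apply: setU11.
have zb' : z != b' by apply: contraNneq b'X => <-.
have zD : z \in D.
  apply: contraR zK => zD; rewrite in_setU1 in_setU in_setD zD /=.
  by rewrite -(memD XF zD) zX orbT.
have zP : z \notin P by apply: contra zK => zP; rewrite in_setU1 in_setU zP !orbT.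
have lt := worse zD zP zb zb'.
have yb' : y != b'.
  have : y \in b |: T by rewrite KE setU11.
  apply: contraTneq => ->; rewrite in_setU1 negb_or bb' //.
have [S2F bS2] : S2 \in F /\ b \in S2 by move: S2A; rewrite inE => /andP[].
have zS2 : z \in S2.
  apply: contraR T2 => zS2; suff -> : S2 = b |: T by rewrite KE /exch subsetUr.
  apply: (sub_same sc) => //; rewrite KE; apply/subsetP=> x xS.
  have := subsetP U2 x xS; rewrite !inE; have [//|_ /= ->] := eqVneq x y.
  by rewrite andbT; apply: contraNneq zS2 => <-.
have b'S2 : b' \notin S2.
  by apply/negP=> /(subsetP U2); rewrite in_setU1 (negPf b'X) orbF eq_sym (negPf yb').
have S'A : exch S2 z b' \in fam_in F b.
  by rewrite inE (sh_up sh) // !inE bS2 (eq_sym b z) zb orbT.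
case: (al _ S'A) => sub.
  case/negP: T2; apply/subsetP=> x xX; have := subsetP sub x xX.
  rewrite !inE => /orP[/eqP xb'|/andP[]//].
  by move: xX; rewrite xb' inE (negPf b'X) andbF.
have : b' \in y |: X by apply: (subsetP sub); rewrite setU11.
by rewrite in_setU1 (negPf b'X) orbF eq_sym (negPf yb').
Qed.

Let PC : P \subset C. Proof. by rewrite middle_C subsetUr. Qed.

Let CS S : S \in F -> P \subset S -> C \subset S.
Proof.
move=> SF PS; apply/subsetP=> x xC; have [xD|xD] := boolP (x \in D).
  apply: (subsetP PS); move: xC; rewrite middle_C in_setU in_setD xD //.
by rewrite (memD SF).
Qed.

Let XIY : X :&: Y = C.
Proof.
apply/setP=> x; rewrite XE YE !inE; have [->|xb] := eqVneq x b.
  by rewrite (negPf bb) (negPf bC).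
by case: (x \in C); rewrite ?orbT ?andbF.
Qed.

Let XUY : X :|: Y = b |: (b' |: C).
Proof. by rewrite XE YE setUACA setUid setUA. Qed.

Let goodB Z : Z \in fam_out F b -> good (fam_out F b) Y Z -> C \subset Z.
Proof.
move=> ZB gZ; have [ZF bZ] : Z \in F /\ b \notin Z by move: ZB; rewrite inE => /andP[].
apply: CS => //; have le := good_out keyI sh bD XA unbridged1 ZB gZ.
have h := cardsID P (Z :&: D); rewrite (sh_card sh ZF) in h.
have : P == Z :&: D :&: P.
  rewrite eq_sym eqEcard subsetIr upb -subn1 leq_subLR addnC.
  by rewrite -{1}h leq_add2l.
by move/eqP->; rewrite -setIA subsetIl.
Qed.

Let not_exceptionalB Z : Z \in fam_out F b -> ~~ exceptional (fam_out F b) Y Z.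
Proof.
move=> ZB; apply/negP=> ex; have scB := same_fam_out (e := b) sc.
have /exceptionalP[b1 [e1 [[b1Y e1Y ZE] [_ [S1 [S1B T1 U1]] [S2 [S2B T2 U2]]]]]] := ex.
have C1 : C \subset S1.
  by apply: goodB => //; apply: (exceptional_goodU scB YB ZB ex) => //; rewrite ZE exchU.
have C2 : C \subset S2.
  by apply: goodB => //; apply: (exceptional_goodI scB YB ZB ex) => //; rewrite ZE exchI.
have [E|nbhd] := eqVneq b1 b'.
  case/negP: T2; apply: subset_trans C2; rewrite E YE; apply/subsetP=> x.
  by rewrite !inE => /andP[/negPf->].
case/negP: U1; suff <- : Y = S1 by rewrite subsetUr.
apply: (sub_same scB) => //; rewrite YE subUset sub1set C1 andbT.
by apply: (subsetP T1); rewrite !inE eq_sym nbhd b'Y.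
Qed.

Let all_goodB Z : Z \in fam_out F b -> Z != Y -> good (fam_out F b) Y Z.
Proof.
move=> ZB ZY; rewrite /good ifN; first by rewrite ZY not_exceptionalB.
by apply: contraNneq ZY => E; move: ZB; rewrite E inE.
Qed.

Lemma middle_B Z : Z \in fam_out F b -> C \subset Z.
Proof.
move=> ZB; have [->|ne] := eqVneq Z Y; first by rewrite YE subsetUr.
exact: goodB (all_goodB ZB ne).
Qed.

Let goodA W : W \in fam_in F b' -> good (fam_in F b') Y W -> W \subset X :|: Y.
Proof.
move=> WA gW; have [WF b'W] : W \in F /\ b' \in W by move: WA; rewrite inE => /andP[].
have le := good_in sh b'D XB' unbridged2 WA gW.
have h := cardsID W (better D b').
have upk : #|better D b'| = k by rewrite upb' cardsU1 bP upb add1n prednK.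
rewrite upk in h.
have WD : W :&: D == b' |: (better D b' :&: W).
  rewrite eq_sym eqEcard subUset sub1set inE b'W b'D /=; apply/andP; split.
    by apply/subsetP=> x; rewrite !inE => /andP[/andP[-> _] ->].
  rewrite (sh_card sh WF) cardsU1 !inE ltnn andbF /= add1n -addn1 -h.
  by rewrite leq_add2l.
apply/subsetP=> x xW; rewrite XUY !in_setU1; have [xD|xD] := boolP (x \in D).
  have : x \in W :&: D by rewrite inE xW.
  rewrite (eqP WD) in_setU1 inE upb' in_setU1 => /orP[->|]; first by rewrite orbT.
  by move=> /andP[/orP[->//|xP] _]; rewrite (subsetP PC x xP) !orbT.
by rewrite -(memD WF xD) xW !orbT.
Qed.

Lemma middle_A W : W \in fam_in F b' -> W \subset X :|: Y.
Proof.
move=> WA; have [->|ne] := eqVneq W Y; first by rewrite subsetUr.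
have [g|n] := boolP (good (fam_in F b') Y W); first exact: goodA.
have scA := same_fam_in (e := b') sc.
case: (not_good WA YA' ne n) => [//|ex]; first by move=> ->; rewrite subsetUr.
have /exceptionalP[b1 [e1 [[b1Y e1Y WE] [_ [S1 [S1B T1 U1]] [S2 [S2B T2 U2]]]]]] := ex.
have C1 : S1 \subset X :|: Y.
  by apply: goodA => //; apply: (exceptional_goodU scA YA' WA ex) => //; rewrite WE exchU.
have C2 : S2 \subset X :|: Y.
  by apply: goodA => //; apply: (exceptional_goodI scA YA' WA ex) => //; rewrite WE exchI.
have [e1U|e1U] := boolP (e1 \in X :|: Y).
  have e1b : e1 = b.
    move: e1U; rewrite XUY in_setU1 => /orP[/eqP//|].
    by rewrite -YE (negPf e1Y).
  by case/negP: U1; rewrite e1b YE -XUY.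
case/negP: T2; suff -> : S2 = Y by rewrite subsetDl.
apply: (sub_same scA) => //; apply/subsetP=> x xS.
have := subsetP U2 x xS; rewrite in_setU1 => /orP[/eqP xe|//].
by have := subsetP C2 x xS; rewrite xe (negPf e1U).
Qed.

(** A further set S with b and without b' misses some c better than b.
    Exchanging b for c leads to a good end on the other side, so S can only be
    the mate of X; an exchange for b' then leaves both sides of the cut of X
    and S. *)
Lemma middle_X S : S \in F -> b \in S -> b' \notin S -> S = X.
Proof.
move=> SF bS b'S; apply/eqP/negPn/negP=> SX.
have SA : S \in fam_in F b by rewrite inE SF.
have [c] : exists c, c \in P :\: S.
  apply/set0Pn; rewrite setD_eq0; apply: contra SX => PS.
  apply/eqP/esym/(sub_same sc) => //; rewrite XE subUset sub1set bS.
  exact: CS.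
rewrite inE => /andP[cS cP]; have cD := subsetP PD c cP.
have cb : c != b by apply: contraNneq bP => <-.
have cb' : c != b' by apply: contraNneq b'P => <-.
have ZB : exch S b c \in fam_out F b.
  rewrite inE (sh_up sh) //; last by move: cP; rewrite inE => /andP[].
  by rewrite !inE eqxx orbF eq_sym.
have ZY : exch S b c != Y.
  apply: contraTneq b'Y => <-; rewrite !inE negb_or eq_sym cb' negb_and b'S.
  by rewrite orbT.
have CZ := middle_B ZB.
have nS : ~~ good (fam_in F b) X S.
  by apply/negP=> g; apply: (unbridged1 SA ZB) => //; [apply: exch_adj_exch|apply: all_goodB].
case: (not_good SA XA SX nS) => [E|]; first by rewrite E eqxx in SX.
case/exceptionalP=> b1 [e1 [[b1X e1X SE] [al _ [S2 [S2A T2 U2]]]]].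
have e1S : e1 \in S by rewrite SE setU11.
have b1S : b1 \notin S by rewrite SE !inE eqxx orbF; apply: contraNneq e1X => <-.
have b1c : b1 = c.
  have b1b : b1 != b by apply: contraNneq b1S => ->.
  have : b1 \in exch S b c.
    by apply: (subsetP CZ); move: b1X; rewrite XE in_setU1 (negPf b1b).
  by rewrite !inE (negPf b1S) andbF orbF => /eqP.
have e1b : e1 != b by apply: contraNneq e1X => ->.
have e1b' : e1 != b' by apply: contraNneq b'S => <-.
have e1D : e1 \in D.
  by apply: contraR e1X => e1D; rewrite (memD XF e1D) -(memD SF e1D).
have e1P : e1 \notin P.
  by apply: contra e1X => /(subsetP PC) h; rewrite XE in_setU1 h orbT.
have lt := worse e1D e1P e1b e1b'.
have [S2F bS2] : S2 \in F /\ b \in S2 by move: S2A; rewrite inE => /andP[].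
have e1S2 : e1 \in S2.
  apply: contraR T2 => e1S2; suff -> : S2 = X by apply: subsetDl.
  apply: (sub_same sc) => //; apply/subsetP=> x xS.
  have := subsetP U2 x xS; rewrite in_setU1 => /orP[/eqP xe|//].
  by rewrite xe (negPf e1S2) in xS.
have b'S2 : b' \notin S2.
  by apply/negP=> /(subsetP U2); rewrite in_setU1 (negPf b'X) orbF eq_sym (negPf e1b').
have S'A : exch S2 e1 b' \in fam_in F b.
  by rewrite inE (sh_up sh) // !inE bS2 (eq_sym b e1) e1b orbT.
case: (al _ S'A) => sub.
  case/negP: T2; apply/subsetP=> x xX; have := subsetP sub x xX.
  rewrite !inE => /orP[/eqP xb'|/andP[]//].
  by move: xX; rewrite xb' inE (negPf b'X) andbF.
have : b' \in e1 |: X by apply: (subsetP sub); rewrite setU11.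
by rewrite in_setU1 (negPf b'X) orbF eq_sym (negPf e1b').
Qed.

Lemma middle_exceptional : exceptional F X Y.
Proof.
have scA := same_fam_in (e := b) sc; have scB := same_fam_out (e := b) sc.
have XYb : X :\: Y = [set b].
  apply/setP=> x; rewrite XE YE !inE; have [->|xb] := eqVneq x b.
    by rewrite (negPf bb) (negPf bC).
  by case: (x \in C); rewrite ?orbT ?andbF.
have adjXY : exch_adj X Y by apply: (exch_adj_setD sc XF YF XYb).
apply/and4P; split=> //.
- apply/forall_inP=> S SF; rewrite XIY; have [bS|bS] := boolP (b \in S); last first.
    by rewrite middle_B // inE SF.
  have [b'S|b'S] := boolP (b' \in S); first by rewrite middle_A ?orbT // inE SF.
  by rewrite (middle_X SF bS b'S) subsetUl orbT.
- apply: contraT => /exists_inPn h.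
  have FB : fam_out F b = [set Y].
    apply/eqP; rewrite eqEsubset sub1set YB andbT; apply/subsetP=> S SB.
    have [SF bS] : S \in F /\ b \notin S by move: SB; rewrite inE => /andP[].
    rewrite inE; apply/eqP/(sub_same sc) => //; apply/subsetP=> x xS.
    move: (h S SF); rewrite negbK => /subsetP/(_ x xS); rewrite XUY -YE.
    rewrite in_setU1 => /orP[/eqP xb|//]; by rewrite -xb xS in bS.
  have [W WA gW] := good_exists scA XA.
  have [WF bW] : W \in F /\ b \in W by move: WA; rewrite inE => /andP[].
  have gY : good (fam_out F b) Y Y by rewrite /good FB !eqxx.
  suff WY : exch_adj W Y by case: (unbridged1 WA YB WY gW gY).
  apply: (exch_adj_setD (x := b) sc WF YF); apply/setP=> x; rewrite in_setD in_set1.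
  have [->|xb] := eqVneq x b; first by rewrite bY.
  apply/andP=> -[xY xW]; move: (h W WF); rewrite negbK => /subsetP/(_ x xW).
  by rewrite XUY -YE in_setU1 (negPf xb) (negPf xY).
- apply: contraT => /exists_inPn h.
  have FA : fam_in F b = [set X].
    apply/eqP; rewrite eqEsubset sub1set XA andbT; apply/subsetP=> S SA.
    have [SF bS] : S \in F /\ b \in S by move: SA; rewrite inE => /andP[].
    rewrite inE; apply/eqP/esym/(sub_same sc) => //; rewrite XE subUset sub1set bS.
    by move: (h S SF); rewrite negbK XIY.
  have [Z ZB gZ] := good_exists scB YB.
  have [ZF bZ] : Z \in F /\ b \notin Z by move: ZB; rewrite inE => /andP[].
  have gX : good (fam_in F b) X X by rewrite /good FA !eqxx.
  suff XZ : exch_adj X Z by case: (unbridged1 XA ZB XZ gX gZ).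
  apply: (exch_adj_setD (x := b) sc XF ZF); apply/setP=> x; rewrite in_setD in_set1.
  have [->|xb] := eqVneq x b; first by rewrite bX bZ.
  apply/andP=> -[xZ]; rewrite XE in_setU1 (negPf xb) /= => xC.
  move: (h Z ZF); rewrite negbK XIY => /subsetP/(_ x xC).
  by rewrite (negPf xZ).
Qed.

End Middle.

(** The elements separating X from Y have pairwise different ranks in {k - 1,
    k} by pivot_rank, so there is one in X and one in Y. *)
Lemma unbridged_exceptional D k F X Y : shifted D k F -> X \in F -> Y \in F -> X != Y ->
  (forall e, e \in X -> e \notin Y -> unbridged F e X Y) ->
  (forall e, e \in Y -> e \notin X -> unbridged F e Y X) -> exceptional F X Y.
Proof.
move=> sh XF YF XY bdX bdY; have sc := sh_same sh.
have inD e : (e \in X) != (e \in Y) -> e \in D.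
  move=> ne; have /setP/(_ e) := sh_fix sh XF YF; rewrite !inE.
  by case: (e \in D) => //= h; rewrite h eqxx in ne.
have rkX e : e \in X -> e \notin Y -> e \in D /\ (k.-1 <= #|better D e| <= k /\ 0 < k).
  move=> eX eY; have eD : e \in D by rewrite inD // eX (negPf eY).
  by split=> //; apply: (pivot_rank keyI sh eD (X := X) (Y := Y));
     rewrite ?inE ?XF ?YF //; apply: bdX.
have rkY e : e \in Y -> e \notin X -> e \in D /\ (k.-1 <= #|better D e| <= k /\ 0 < k).
  move=> eY eX; have eD : e \in D by rewrite inD // eY (negPf eX).
  by split=> //; apply: (pivot_rank keyI sh eD (X := Y) (Y := X));
     rewrite ?inE ?XF ?YF //; apply: bdY.
have [e eXY] : exists e, e \in X :\: Y.
  apply/set0Pn; rewrite setD_eq0; apply: contra XY => s; apply/eqP; exact: (sub_same sc).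
have [f fYX] : exists f, f \in Y :\: X.
  apply/set0Pn; rewrite setD_eq0; apply: contra XY => s; apply/eqP/esym; exact: (sub_same sc).
move: (eXY) (fYX); rewrite !inE => /andP[eY eX] /andP[fX fY].
have [eD [pe k0]] := rkX e eX eY; have [fD [pf _]] := rkY f fY fX.
have ef : e != f by apply: contraNneq eY => ->.
have npef : #|better D e| != #|better D f|.
  by apply: contraNneq ef => h; apply/eqP/(better_inj keyI eD fD h).
have XYe : X :\: Y = [set e].
  apply/eqP; rewrite eqEsubset sub1set eXY andbT; apply/subsetP=> g.
  rewrite !inE => /andP[gY gX]; have [gD [pg _]] := rkX g gX gY.
  apply: contraT => ge; have gf : g != f by apply: contraNneq gY => ->.
  have n1 : #|better D g| != #|better D e|.
    by apply: contraNneq ge => h; apply/eqP/(better_inj keyI gD eD h).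
  have n2 : #|better D g| != #|better D f|.
    by apply: contraNneq gf => h; apply/eqP/(better_inj keyI gD fD h).
  by clear -pe pf pg npef n1 n2 k0; move: #|_| #|_| #|_| pe pf pg npef n1 n2 => a b c; lia.
have YXf : Y :\: X = [set f].
  have := exch_adj_setD sc XF YF XYe; rewrite /exch_adj XYe cards1 => /cards1P[g E].
  by move: fYX; rewrite E inE => /eqP ->.
have XE : X = e |: (X :&: Y) by rewrite -XYe setUC setID.
have YE : Y = f |: (X :&: Y) by rewrite -YXf setUC [X :&: Y]setIC setID.
have eC : e \notin X :&: Y by rewrite inE (negPf eY) andbF.
have fC : f \notin X :&: Y by rewrite inE (negPf fX).
have upE a b : a \in D -> b \in D -> key a < key b -> k.-1 <= #|better D a| <= k ->
    k.-1 <= #|better D b| <= k -> #|better D a| = k.-1 /\ better D b = a |: better D a.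
  move=> aD bD lt pa pb; have lt' := better_lt aD lt.
  have Ea : #|better D a| = k.-1.
    by clear -pa pb k0 lt'; move: #|_| #|_| pa pb lt' => x y; lia.
  have Eb : #|better D b| = k.
    by clear -pa pb k0 lt'; move: #|_| #|_| pa pb lt' => x y; lia.
  split=> //; apply/eqP; rewrite eq_sym eqEcard cardsU1 Ea Eb !inE ltnn andbF add1n.
  rewrite prednK // leqnn andbT; apply/subsetP=> x; rewrite !inE.
  by move=> /orP[/eqP->|/andP[-> /ltn_trans->//]]; rewrite aD.
case: (ltngtP (key e) (key f)) => [lt|lt|/keyI efe]; last by rewrite efe eqxx in ef.
  have [h1 h2] := upE e f eD fD lt pe pf.
  by apply: (middle_exceptional sh XF YF eD fD eC fC ef XE YE k0 h1 h2); [apply: bdX|apply: bdY].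
have [h1 h2] := upE f e fD eD lt pf pe.
rewrite exceptional_sym; rewrite eq_sym in ef.
by apply: (middle_exceptional sh YF XF fD eD fC eC ef YE XE k0 h1 h2); [apply: bdY|apply: bdX].
Qed.

(** Induction on the number of free elements. At a pivot separating X from Y
    these lie in different parts, and Hamilton paths of the two parts are
    joined by a bridge. *)
Theorem shifted_ham_path D k F X Y : shifted D k F -> X \in F -> Y \in F -> X != Y ->
  ham_path (@exch_adj V) F X Y \/ exceptional F X Y.
Proof.
move: {2}#|D| (leqnn #|D|) => n; elim: n => [|n IH] in D k F X Y *.
  rewrite leqn0 cards_eq0 => /eqP D0 sh XF YF.
  by have := sh_fix sh XF YF; rewrite D0 !setD0 => ->; rewrite eqxx.
move=> le sh XF YF XY; have [|nex] := boolP (exceptional F X Y); [by right|left].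
have sc := sh_same sh.
(* There is a bridge at the pivot e. *)
pose gp e X Y := [exists W in fam_in F e, exists Z in fam_out F e,
  [&& exch_adj W Z, good (fam_in F e) X W & good (fam_out F e) Y Z]].
have step e X' Y' : X' \in F -> Y' \in F -> e \in X' -> e \notin Y' -> gp e X' Y' ->
    ham_path (@exch_adj V) F X' Y'.
  move=> X'F Y'F eX eY /exists_inP[W WA /exists_inP[Z ZB /and3P[WZ gW gZ]]].
  have eD : e \in D.
    have /setP/(_ e) := sh_fix sh X'F Y'F; rewrite !inE eX (negPf eY) andbT andbF.
    by move/negbFE.
  have leD : #|D :\ e| <= n by move: le; rewrite (cardsD1 e D) eD.
  have XA : X' \in fam_in F e by rewrite inE X'F.
  have YB : Y' \in fam_out F e by rewrite inE Y'F.
  have h1 : ham_path (@exch_adj V) (fam_in F e) X' W.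
    move: gW; rewrite /good; case: eqP => [-> /eqP->|_ /andP[ne nx]]; first exact: ham_path1.
    have ne' : X' != W by rewrite eq_sym.
    by case: (IH _ _ _ _ _ leD (shifted_in eD sh) XA WA ne') => // ex; rewrite ex in nx.
  have h2 : ham_path (@exch_adj V) (fam_out F e) Y' Z.
    move: gZ; rewrite /good; case: eqP => [-> /eqP->|_ /andP[ne nx]]; first exact: ham_path1.
    have ne' : Y' != Z by rewrite eq_sym.
    by case: (IH _ _ _ _ _ leD (shifted_out eD sh) YB ZB ne') => // ex; rewrite ex in nx.
  have -> : F = fam_in F e :|: fam_out F e.
    by apply/setP=> S; rewrite !inE -andb_orr orbN andbT.
  apply: ham_path_cat h1 (ham_path_sym (@exch_adj_sym V) h2) WZ _.
  by apply/pred0P=> S /=; rewrite !inE; case: (e \in S); rewrite ?andbF ?andbT.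
have ngp e X' Y' : ~~ gp e X' Y' -> unbridged F e X' Y'.
  move=> n0 W Z WA ZB WZ gW gZ; case/negP: n0; apply/exists_inP; exists W => //.
  by apply/exists_inP; exists Z; rewrite // WZ gW.
have [/exists_inP[e eX /andP[eY g]]|n1] := boolP [exists e in X, (e \notin Y) && gp e X Y].
  exact: (step e).
have [/exists_inP[e eY /andP[eX g]]|n2] := boolP [exists e in Y, (e \notin X) && gp e Y X].
  by apply: (ham_path_sym (@exch_adj_sym V)); apply: (step e).
case/negP: nex; apply: (unbridged_exceptional sh) => // e eX eY; apply: ngp.
  by move/exists_inPn/(_ e eX): n1; rewrite eY.
by move/exists_inPn/(_ e eX): n2; rewrite eY.
Qed.

End ShiftedHamilton.

(** * Graphs as edge sets, switches and renamings *)

Section Switches.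
Variable V : finType.
Implicit Types (E : {set {set V}}) (f : V -> nat) (u v w a b c x y z : V).

Definition adj E x y := [set x; y] \in E.
Definition nbhd E x := [set y | adj E x y].
Definition switch_adj E E' := #|symdiff E E'| == 4.
Definition graphs f := [set E | simple_edges E && [forall u, #|nbhd E u| == f u]].

Lemma eq_set2 x y a b :
  ([set x; y] == [set a; b]) = (x == a) && (y == b) || (x == b) && (y == a).
Proof.
apply/eqP/orP => [E|[/andP[/eqP-> /eqP->]|/andP[/eqP-> /eqP->]]] //; last exact: setUC.
have xin : x \in [set a; b] by rewrite -E set21.
have yin : y \in [set a; b] by rewrite -E set22.
have ain : a \in [set x; y] by rewrite E set21.
have bin : b \in [set x; y] by rewrite E set22.
move: xin yin ain bin; rewrite !inE !(eq_sym a) !(eq_sym b).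
by case: (x == a); case: (x == b); case: (y == a); case: (y == b); auto.
Qed.

Lemma adj_sym E x y : adj E x y = adj E y x.
Proof. by rewrite /adj setUC. Qed.

Lemma simple_card2 E e : simple_edges E -> e \in E -> #|e| = 2.
Proof. by move=> /forall_inP s /s /eqP. Qed.

Lemma adj_neq E x y : simple_edges E -> adj E x y -> x != y.
Proof.
move=> s xy; have := simple_card2 s xy; rewrite cards2; by case: eqP.
Qed.

Lemma adj_irr E x : simple_edges E -> adj E x x = false.
Proof. by move=> s; apply/negP=> /(adj_neq s); rewrite eqxx. Qed.

Lemma in_nbhd E x y : (y \in nbhd E x) = adj E x y.
Proof. by rewrite inE. Qed.

Lemma graph_ext E E' : simple_edges E -> simple_edges E' ->
  (forall x y, x != y -> adj E x y = adj E' x y) -> E = E'.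
Proof.
move=> s s' h; apply/setP=> e; have [/cards2P[x [y [xy ->]]]|n2] := boolP (#|e| == 2).
  exact: h.
have out F : simple_edges F -> (e \in F) = false.
  by move=> sF; apply: contraNF n2 => /(simple_card2 sF)/eqP.
by rewrite !out.
Qed.

Lemma nbhd_ext E E' : simple_edges E -> simple_edges E' ->
  (forall x, nbhd E x = nbhd E' x) -> E = E'.
Proof.
move=> s s' h; apply: graph_ext => // x y _.
by have /setP/(_ y) := h x; rewrite !in_nbhd.
Qed.

Lemma graphsP f E : reflect (simple_edges E /\ forall u, #|nbhd E u| = f u) (E \in graphs f).
Proof.
rewrite inE; apply: (iffP andP) => [[s /forallP d]|[s d]]; split=> //.
  by move=> u; apply/eqP.
by apply/forallP=> u; rewrite d.
Qed.

Lemma graphs_simple f E : E \in graphs f -> simple_edges E.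
Proof. by case/graphsP. Qed.

Lemma graphs_deg f E u : E \in graphs f -> #|nbhd E u| = f u.
Proof. by case/graphsP. Qed.

Lemma switch_adj_sym : symmetric switch_adj.
Proof. by move=> E E'; rewrite /switch_adj /symdiff setUC. Qed.

Lemma switch_adj_irr : irreflexive switch_adj.
Proof. by move=> E; rewrite /switch_adj /symdiff setDv setU0 cards0. Qed.

(** The edges va and bc are replaced by vb and ac; the neighbourhood of v
    changes by the exchange of a for b, and c moves from b to a. *)
Definition switch E v a b c :=
  (E :\: [set [set v; a]; [set b; c]]) :|: [set [set v; b]; [set a; c]].

Definition switchable E v a b c :=
  [&& adj E v a, adj E b c, ~~ adj E v b & ~~ adj E a c] && ((v != b) && (a != c)).

Lemma switchableP E v a b c :
  reflect ([/\ adj E v a, adj E b c, ~~ adj E v b & ~~ adj E a c] /\ (v != b /\ a != c))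
          (switchable E v a b c).
Proof.
by apply: (iffP andP) => -[/and4P h /andP h'].
Qed.

Lemma switch_neq E v a b c : simple_edges E -> switchable E v a b c ->
  [/\ v != a, v != b & v != c] /\ [/\ a != b, a != c & b != c].
Proof.
move=> s /switchableP[[va bc nvb nac] [vb ac]]; split; split=> //.
- exact: adj_neq s va.
- by apply: contraNneq nvb => ->; rewrite adj_sym.
- by apply: contraNneq nvb => <-.
- exact: adj_neq s bc.
Qed.

Lemma adj_switch E v a b c x y : adj (switch E v a b c) x y =
  adj E x y && ~~ ([set x; y] == [set v; a]) && ~~ ([set x; y] == [set b; c])
  || ([set x; y] == [set v; b]) || ([set x; y] == [set a; c]).
Proof.
rewrite /adj !inE; case: (_ == [set v; a]); case: (_ == [set b; c]) => /=;
  by case: (_ \in E); rewrite ?orbA.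
Qed.

Section Switch.
Variables (E : {set {set V}}) (v a b c : V).
Hypothesis sE : simple_edges E.
Hypothesis swE : switchable E v a b c.

Lemma simple_switch : simple_edges (switch E v a b c).
Proof.
have [[va vb vc] [ab ac bc]] := switch_neq sE swE.
apply/forall_inP=> e; rewrite !inE => /orP[/andP[_ /(simple_card2 sE)->//]|].
by move=> /orP[]/eqP->; rewrite cards2 ?vb ?ac.
Qed.

Lemma nbhd_switch_v : nbhd (switch E v a b c) v = exch (nbhd E v) a b.
Proof.
have [[va vb vc] [ab ac bc]] := switch_neq sE swE.
apply/setP=> y; rewrite in_nbhd adj_switch !inE !eq_set2 eqxx.
rewrite (negPf va) (negPf vb) (negPf vc) /= !orbF andbT.
by case: (y == b); rewrite ?orbT // orbF andbC.
Qed.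

Lemma nbhd_switch_other x : x \notin [set v; a; b; c] -> nbhd (switch E v a b c) x = nbhd E x.
Proof.
rewrite !inE !negb_or => /andP[/andP[/andP[xv xa] xb] xc].
apply/setP=> y; rewrite !in_nbhd adj_switch !eq_set2.
by rewrite (negPf xv) (negPf xa) (negPf xb) (negPf xc) /= !andbT !orbF.
Qed.

End Switch.

Lemma switch_rot1 E v a b c : switch E v a b c = switch E a v c b.
Proof.
by rewrite /switch [[set a; v]]setUC [[set c; b]]setUC [[set [set v; b]; _]]setUC.
Qed.

Lemma switch_rot2 E v a b c : switch E v a b c = switch E b c v a.
Proof.
rewrite /switch [[set b; v]]setUC [[set c; a]]setUC; congr (_ :\: _ :|: _).
exact: setUC.
Qed.

Lemma switchable_rot1 E v a b c : switchable E v a b c = switchable E a v c b.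
Proof.
rewrite /switchable [adj E a v]adj_sym [adj E c b]adj_sym.
by case: (adj E v a); case: (adj E b c); case: (adj E v b); case: (adj E a c);
   case: (v != b); case: (a != c).
Qed.

Lemma switchable_rot2 E v a b c : switchable E v a b c = switchable E b c v a.
Proof.
rewrite /switchable [adj E b v]adj_sym [adj E c a]adj_sym [b == v]eq_sym [c == a]eq_sym.
by case: (adj E v a); case: (adj E b c).
Qed.

Section Switch2.
Variables (E : {set {set V}}) (v a b c : V).
Hypothesis sE : simple_edges E.
Hypothesis swE : switchable E v a b c.

Lemma nbhd_switch_a : nbhd (switch E v a b c) a = exch (nbhd E a) v c.
Proof. by rewrite switch_rot1 nbhd_switch_v // -switchable_rot1. Qed.

Lemma nbhd_switch_b : nbhd (switch E v a b c) b = exch (nbhd E b) c v.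
Proof. by rewrite switch_rot2 nbhd_switch_v // -switchable_rot2. Qed.

Lemma nbhd_switch_c : nbhd (switch E v a b c) c = exch (nbhd E c) b a.
Proof.
by rewrite switch_rot2 switch_rot1 nbhd_switch_v // -switchable_rot1 -switchable_rot2.
Qed.

Lemma card_nbhd_switch x : #|nbhd (switch E v a b c) x| = #|nbhd E x|.
Proof.
have [[va vb vc] [ab ac bc]] := switch_neq sE swE.
move: (swE) => /switchableP[[eva ebc nvb nac] [_ _]].
have [xin|xin] := boolP (x \in [set v; a; b; c]); last by rewrite nbhd_switch_other.
move: xin; rewrite !inE => /orP[/orP[/orP[]|]|] /eqP->.
- by rewrite nbhd_switch_v // card_exch // in_nbhd.
- by rewrite nbhd_switch_a card_exch // in_nbhd // adj_sym.
- by rewrite nbhd_switch_b card_exch // in_nbhd // adj_sym.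
- by rewrite nbhd_switch_c card_exch // in_nbhd // adj_sym.
Qed.

Lemma symdiff_switch : symdiff E (switch E v a b c) =
  [set [set v; a]; [set b; c]] :|: [set [set v; b]; [set a; c]].
Proof.
move: (swE) => /switchableP[[eva ebc nvb nac] [_ _]].
apply/setP=> e; rewrite !inE.
have [->|n1] := eqVneq e [set v; b].
  by rewrite -[_ \in E]/(adj E v b) (negPf nvb) /= !orbT.
have [->|n2] := eqVneq e [set a; c].
  by rewrite -[_ \in E]/(adj E a c) (negPf nac) /= !orbT.
have [->|n3] := eqVneq e [set v; a].
  by rewrite -[_ \in E]/(adj E v a) eva.
have [->|n4] := eqVneq e [set b; c].
  by rewrite -[_ \in E]/(adj E b c) ebc.
by case: (e \in E).
Qed.

Lemma switch_adj_switch : switch_adj E (switch E v a b c).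
Proof.
have [[va vb vc] [ab ac bc]] := switch_neq sE swE.
rewrite /switch_adj symdiff_switch cardsU !cards2 !eq_set2 (negPf vb) (negPf vc) (negPf ac).
rewrite (negPf va) /= (_ : _ :&: _ = set0) ?cards0 //.
apply/setP=> e; rewrite !inE; apply/negbTE/andP=> -[].
by case/orP=> /eqP-> /orP[]; rewrite eq_set2 ?(negPf va) ?(negPf vb) ?(negPf vc)
  ?(negPf ab) ?(negPf ac) ?(negPf bc) ?[b == v]eq_sym ?[b == a]eq_sym ?[c == v]eq_sym
  ?(negPf va) ?(negPf vb) ?(negPf vc) ?(negPf ab) ?andbF.
Qed.

End Switch2.

Lemma graphs_switch f E v a b c : E \in graphs f -> switchable E v a b c -> switch E v a b c \in graphs f.
Proof.
move=> /graphsP[s d] swE; apply/graphsP; split; first exact: simple_switch.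
by move=> u; rewrite card_nbhd_switch.
Qed.

(** The two results differ in which of c1 and c2 has been moved from b to a,
    that is, by a switch on a, b, c1, c2. *)
Lemma switch_triangle E v a b c1 c2 : simple_edges E -> switchable E v a b c1 ->
  switchable E v a b c2 -> c1 != c2 -> switch_adj (switch E v a b c1) (switch E v a b c2).
Proof.
move=> sE s1 s2 c12.
have [[va vb vc1] [ab ac1 bc1]] := switch_neq sE s1.
have [[_ _ vc2] [_ ac2 bc2]] := switch_neq sE s2.
move: (s1) (s2) => /switchableP[[eva ebc1 nvb nac1] [_ _]] /switchableP[[_ ebc2 _ nac2] [_ _]].
have sw1 : switchable (switch E v a b c1) c1 a b c2.
  apply/switchableP; rewrite -!in_nbhd nbhd_switch_c // nbhd_switch_b // nbhd_switch_a //; split; last first.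
    by rewrite eq_sym.
  by rewrite !inE !eqxx ebc2 (negPf nac2) (eq_sym c2 c1) (negPf c12)
    (eq_sym b a) (negPf ab) andbF /= orbT; split.
have -> : switch E v a b c2 = switch (switch E v a b c1) c1 a b c2.
  apply/setP=> e; rewrite !inE.
  have [->|n1] := eqVneq e [set v; a].
    by rewrite !eq_set2 (negPf va) (negPf vb) (negPf vc1) (negPf vc2) ?andbF ?orbF /=
      ?(negPf ab) ?(negPf ac1) ?(negPf ac2).
  have [->|n2] := eqVneq e [set v; b].
    by rewrite !eq_set2 ?eqxx (negPf va) (negPf vb) (negPf vc1) (negPf vc2) ?orbT //=
     ?andbF ?orbF [b == a]eq_sym (negPf ab) (negPf bc1) (negPf bc2).
  have [->|n3] := eqVneq e [set a; c2]; first by rewrite !orbT.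
  rewrite (setUC [set c1]) (setUC [set c1]).
  have [ee|n4] := eqVneq e [set a; c1].
    rewrite ee -[_ \in E]/(adj E a c1) (negPf nac1).
    by rewrite !eq_set2 (negPf ab) (negPf ac1) ?andbF ?orbF.
  have [ee|n5] := eqVneq e [set b; c1].
    rewrite ee -[_ \in E]/(adj E b c1) ebc1.
    by rewrite !eq_set2 eqxx (negPf c12) (eq_sym c1 b) (negPf bc1) ?andbF ?orbT.
  by case: (e == [set b; c2]); case: (e \in E).
by apply: switch_adj_switch => //; apply: simple_switch.
Qed.

(** The vertices that b can hand over to a. A switch at v exchanging a for b
    amounts to a handing v over to b and b handing some c over to a. *)
Definition private E a b := nbhd E b :\: (a |: nbhd E a).

Lemma switchable_private E v a b c :
  switchable E v a b c = (v \in private E b a) && (c \in private E a b).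
Proof.
rewrite !in_setD !in_setU1 !in_nbhd !negb_or /switchable (adj_sym E v a) (adj_sym E v b).
rewrite (eq_sym c a).
by case: (adj E a v); case: (adj E b c); case: (adj E b v); case: (adj E a c);
   case: (v != b); case: (a != c).
Qed.

Lemma card_private E a b : simple_edges E ->
  #|private E a b| + #|nbhd E a| = #|private E b a| + #|nbhd E b|.
Proof.
move=> s; have h x y : #|nbhd E y| = adj E x y + #|nbhd E x :&: nbhd E y| + #|private E x y|.
  rewrite -(cardsID (x |: nbhd E x) (nbhd E y)) -/(private E x y); congr (_ + _).
  have xI : x \notin nbhd E x :&: nbhd E y by rewrite !inE adj_irr.
  have [xy|xy] := boolP (adj E x y).
    rewrite add1n -(add1n #|_|) -[1 + _]/((true : nat) + _) -xI -cardsU1.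
    apply: eq_card => z; rewrite !inE; have [->|_] := eqVneq z x.
      by rewrite adj_sym xy.
    by rewrite andbC.
  apply: eq_card => z; rewrite !inE; have [->|_] := eqVneq z x.
    by rewrite adj_sym (negPf xy) andbF.
  by rewrite andbC.
by rewrite (h b a) (h a b) (adj_sym E b a) [nbhd E b :&: _]setIC; lia.
Qed.

Lemma private_triangle E v a b c1 c2 : simple_edges E -> v \in private E b a ->
  c1 \in private E a b -> c2 \in private E a b -> c1 != c2 ->
  [/\ switch_adj E (switch E v a b c1), switch_adj E (switch E v a b c2) &
      switch_adj (switch E v a b c1) (switch E v a b c2)].
Proof.
move=> s vd d1 d2 ne; have s1 : switchable E v a b c1 by rewrite switchable_private vd.
have s2 : switchable E v a b c2 by rewrite switchable_private vd.
by split; [apply: switch_adj_switch|apply: switch_adj_switch|apply: switch_triangle].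
Qed.

Lemma card_nbhdD f E E' u : E \in graphs f -> E' \in graphs f ->
  #|nbhd E u :\: nbhd E' u| = #|nbhd E' u :\: nbhd E u|.
Proof.
move=> EF E'F; have h1 := cardsID (nbhd E' u) (nbhd E u); have h2 := cardsID (nbhd E u) (nbhd E' u).
move: h1; rewrite (graphs_deg u EF) -(graphs_deg u E'F) -h2 setIC.
by move/addnI.
Qed.

Lemma nbhdD_move f E E' u x : E \in graphs f -> E' \in graphs f -> x \in nbhd E u ->
  x \notin nbhd E' u -> exists2 y, y \in nbhd E' u & y \notin nbhd E u.
Proof.
move=> EF E'F xE xE'; have : 0 < #|nbhd E' u :\: nbhd E u|.
  by rewrite -(card_nbhdD u EF E'F); apply/card_gt0P; exists x; rewrite inE xE' xE.
by case/card_gt0P=> y; rewrite inE => /andP[]; exists y.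
Qed.

(** Every vertex gains as many neighbours as it loses, so the four edges of
    the difference form an alternating closed walk; it is followed from v. *)
Lemma switch_adj_at f E E' v : E \in graphs f -> E' \in graphs f -> switch_adj E E' ->
  nbhd E v != nbhd E' v -> exists a b c, switchable E v a b c /\ E' = switch E v a b c.
Proof.
move=> EF E'F adjE ne; have sE := graphs_simple EF; have sE' := graphs_simple E'F.
have [a aE aE'] : exists2 a, a \in nbhd E v & a \notin nbhd E' v.
  apply/subsetPn; apply: contra ne => sub.
  by rewrite eqEcard sub (graphs_deg v EF) (graphs_deg v E'F) /=.
have [b bE' bE] := nbhdD_move EF E'F aE aE'.
have sym F x y : (x \in nbhd F y) = (y \in nbhd F x) by rewrite !in_nbhd adj_sym.
have vaE : v \in nbhd E a by rewrite sym.
have vaE' : v \notin nbhd E' a by rewrite sym.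
have vbE' : v \in nbhd E' b by rewrite sym.
have vbE : v \notin nbhd E b by rewrite sym.
have [c cE' cE] := nbhdD_move EF E'F vaE vaE'.
have [c' c'E c'E'] := nbhdD_move E'F EF vbE' vbE.
have neq F x y : simple_edges F -> x \in nbhd F y -> y != x.
  by move=> sF; rewrite in_nbhd => /(adj_neq sF).
have va := neq _ _ _ sE aE. have vb := neq _ _ _ sE' bE'.
have ac := neq _ _ _ sE' cE'. have bc' := neq _ _ _ sE c'E.
have ab : a != b by apply: contraNneq bE => <-.
have vc : v != c by apply: contraNneq cE => <-.
have vc' : v != c' by apply: contraTneq c'E => <-.
pose L := [set [set v; a]; [set b; c']] :|: [set [set v; b]; [set a; c]].
have in1 x y : y \in nbhd E x -> y \notin nbhd E' x -> [set x; y] \in symdiff E E'.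
  by rewrite !in_nbhd /adj !inE => -> ->.
have in2 x y : y \in nbhd E' x -> y \notin nbhd E x -> [set x; y] \in symdiff E E'.
  by rewrite !in_nbhd /adj !inE => -> ->; rewrite orbT.
(* The four edges found so far are distinct, hence all of the difference. *)
have LE : L = symdiff E E'.
  apply/eqP; rewrite eqEcard (eqP adjE); apply/andP; split.
    by rewrite !subUset !sub1set in1 // in1 // in2 // in2.
  have nLE x y z t : [set x; y] \in E -> [set z; t] \notin E ->
      ([set x; y] == [set z; t]) = false.
    by move=> i o; apply: contraTF i => /eqP->.
  have E1 : [set v; a] \in E by rewrite in_nbhd in aE.
  have E2 : [set b; c'] \in E by rewrite in_nbhd in c'E.
  have E3 : [set v; b] \notin E by rewrite in_nbhd in bE.
  have E4 : [set a; c] \notin E by rewrite in_nbhd in cE.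
  rewrite cardsU !cards2 !eq_set2 (negPf vb) (negPf vc) (negPf vc') (negPf va) /=.
  rewrite (_ : _ :&: _ = set0) ?cards0 //; apply/setP=> e; rewrite !inE.
  apply/negbTE/andP=> -[].
  by case/orP=> /eqP-> /orP[]; rewrite nLE.
(* The walk closes: c must lose a neighbour, and the only edge left for this
   is the one from b to c'. *)
have cc : c = c'.
  have acE' : a \in nbhd E' c by rewrite sym.
  have acE : a \notin nbhd E c by rewrite sym.
  have [w wE wE'] := nbhdD_move E'F EF acE' acE.
  have : [set c; w] \in symdiff E E' by apply: in1.
  rewrite -LE !inE => /orP[/orP[]|/orP[]].
  - rewrite eq_set2 (eq_sym c) (negPf vc) /= (eq_sym c) (negPf ac) //.
  - rewrite eq_set2 => /orP[/andP[/eqP cb /eqP wc]|/andP[/eqP //]].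
    have abE' : a \in nbhd E' b by rewrite -cb.
    have abE : a \notin nbhd E b by rewrite -cb.
    have : 1 < #|nbhd E b :\: nbhd E' b|.
      rewrite (card_nbhdD b EF E'F); apply/card_gt1P; exists v, a.
      by rewrite !in_setD vbE' vbE abE' abE; split.
    case/card_gt1P=> x [y []]; rewrite !in_setD => /andP[xE' xE] /andP[yE' yE].
    have key z : z \in nbhd E b -> z \notin nbhd E' b -> z = c'.
      move=> zE zE'; have : [set b; z] \in symdiff E E' by apply: in1.
      have bz := neq _ _ _ sE zE.
      rewrite -LE !inE => /orP[/orP[]|/orP[]].
      + by rewrite eq_set2 (eq_sym b) (negPf vb) (eq_sym b) (negPf ab).
      + rewrite eq_set2 => /orP[/andP[_ /eqP]//|/andP[/eqP bcE /eqP zb]].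
        by rewrite bcE eqxx in bc'.
      + move=> /eqP e1; move: (zE); rewrite in_nbhd /adj e1 => vbE0.
        by move: bE; rewrite in_nbhd /adj vbE0.
      + move=> /eqP e1; move: (zE); rewrite in_nbhd /adj e1 => vbE0.
        by move: cE; rewrite in_nbhd /adj vbE0.
    by rewrite (key x) // (key y) // eqxx.
  - move=> /eqP e1; move: (wE); rewrite in_nbhd /adj e1 => h.
    by move: bE; rewrite in_nbhd /adj h.
  - move=> /eqP e1; move: (wE); rewrite in_nbhd /adj e1 => h.
    by move: cE; rewrite in_nbhd /adj h.
exists a, b, c; split.
  apply/switchableP; split; last by [].
  by split; rewrite -in_nbhd // cc.
apply/setP=> e; have /setP/(_ e) := LE; rewrite /L -cc /switch !inE.
have h1 : (e == [set v; a]) ==> (e \in E).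
  by apply/implyP=> /eqP->; rewrite in_nbhd in aE.
have h2 : (e == [set b; c]) ==> (e \in E).
  by apply/implyP=> /eqP->; rewrite cc; rewrite in_nbhd in c'E.
have h3 : (e == [set v; b]) ==> (e \notin E).
  by apply/implyP=> /eqP->; rewrite in_nbhd in bE.
have h4 : (e == [set a; c]) ==> (e \notin E).
  by apply/implyP=> /eqP->; rewrite in_nbhd in cE.
move: h1 h2 h3 h4; case: (e \in E); case: (e \in E'); case: (e == [set v; a]);
  by case: (e == [set b; c]); case: (e == [set v; b]); case: (e == [set a; c]).
Qed.

End Switches.

Section Relabelling.
Variable V : finType.
Implicit Types (E : {set {set V}}) (f : V -> nat) (s t : {perm V}).

Definition relabel s E := [set s @: (e : {set V}) | e in E].

Lemma imset_perm_inj s : injective (fun e : {set V} => s @: e).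
Proof. by apply: imset_inj; apply: perm_inj. Qed.

Lemma adj_relabel s E x y : adj (relabel s E) (s x) (s y) = adj E x y.
Proof.
rewrite /adj -(mem_imset E [set x; y] (@imset_perm_inj s)) /relabel.
by rewrite imsetU !imset_set1.
Qed.

Lemma nbhd_relabel s E x : nbhd (relabel s E) (s x) = s @: nbhd E x.
Proof.
apply/setP=> y; rewrite -[y](permKV s) in_nbhd adj_relabel mem_imset ?in_nbhd //.
exact: perm_inj.
Qed.

Lemma relabelM s t E : relabel (s * t)%g E = relabel t (relabel s E).
Proof.
apply/setP=> e; apply/imsetP/imsetP => [[x xE ->]|[_ /imsetP[x xE ->] ->]].
  exists (s @: x); first exact: imset_f.
  by rewrite -imset_comp; apply: eq_imset => z /=; rewrite permM.
by exists x => //; rewrite -imset_comp; apply: eq_imset => z /=; rewrite permM.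
Qed.

Lemma relabel1 E : relabel 1%g E = E.
Proof.
rewrite -[RHS]imset_id; apply: eq_imset => e /=; rewrite -[RHS]imset_id.
by apply: eq_imset => x; rewrite perm1.
Qed.

Lemma relabelK s : cancel (relabel s) (relabel s^-1%g).
Proof. by move=> E; rewrite -relabelM mulgV relabel1. Qed.

Lemma relabel_inj s : injective (relabel s).
Proof. exact: can_inj (relabelK s). Qed.

Lemma relabel_tpermK a b : involutive (relabel (tperm a b)).
Proof. by move=> E; rewrite -relabelM tperm2 relabel1. Qed.

Lemma switch_adj_relabel s : {mono relabel s : E E' / switch_adj E E'}.
Proof.
move=> E E'; rewrite /switch_adj /symdiff /relabel.
have D A B : relabel s A :\: relabel s B = relabel s (A :\: B).
  apply/setP=> e; apply/idP/imsetP => [|[x]].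
    rewrite inE => /andP[eB /imsetP[x xA ex]]; exists x; rewrite // inE xA andbT.
    by apply: contra eB => xB; rewrite ex imset_f.
  rewrite inE => /andP[xB xA] ->; rewrite inE; apply/andP; split; last exact: imset_f.
  by rewrite (mem_imset _ _ (@imset_perm_inj s)).
by rewrite !D -imsetU card_imset //; apply: imset_perm_inj.
Qed.

Lemma simple_relabel s E : simple_edges E -> simple_edges (relabel s E).
Proof.
move=> sE; apply/forall_inP=> _ /imsetP[e eE ->].
by rewrite card_imset ?(simple_card2 sE eE) //; apply: perm_inj.
Qed.

Lemma graphs_relabel s f E : (forall u, f (s u) = f u) -> E \in graphs f -> relabel s E \in graphs f.
Proof.
move=> fs /graphsP[sE d]; apply/graphsP; split; first exact: simple_relabel.
move=> u; rewrite -[u](permKV s) nbhd_relabel card_imset ?d ?fs //; exact: perm_inj.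
Qed.

Lemma tperm_invariant f a b : f a = f b -> forall u, f (tperm a b u) = f u.
Proof. by move=> fab u; case: tpermP => [->|->|]. Qed.

Lemma nbhd_relabel_fix s E v : s v = v -> nbhd (relabel s E) v = s @: nbhd E v.
Proof. by move=> sv; rewrite -{1}sv nbhd_relabel. Qed.

Lemma imset_tperm (S : {set V}) a b : a \in S -> b \notin S ->
  tperm a b @: S = exch S a b.
Proof.
move=> aS bS; apply/setP=> x; rewrite -[x in LHS](tpermK a b) mem_imset; last exact: perm_inj.
rewrite !inE; case: tpermP => [->|->|/eqP xa /eqP xb].
- by rewrite eqxx /= orbF (negPf bS); apply/esym/negbTE; apply: contraNneq bS => <-.
- by rewrite eqxx aS.
- by rewrite (negPf xb) xa.
Qed.

(** When a and b have one private neighbour each, swapping the names a and b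
    hands over exactly these two. *)
Lemma relabel_tperm_switch E v a b c : simple_edges E -> private E b a = [set v] ->
  private E a b = [set c] -> relabel (tperm a b) E = switch E v a b c.
Proof.
move=> sE dv dc.
have swE : switchable E v a b c by rewrite switchable_private dv dc !set11.
have [[va vb vc] [ab ac bc]] := switch_neq sE swE.
have hb y : y != a -> y != b -> adj E b y = (y == c) || (y != v) && adj E a y.
  move=> ya yb; have /setP/(_ y) := dc; have /setP/(_ y) := dv; rewrite !inE.
  rewrite (negPf ya) (negPf yb) /=; have [->|yv] := eqVneq y v.
    by move=> /andP[/negPf-> _] _; rewrite (negPf vc).
  by case: (y == c); case: (adj E a y); case: (adj E b y).
have ha y : y != a -> y != b -> adj E a y = (y == v) || (y != c) && adj E b y.
  move=> ya yb; have /setP/(_ y) := dc; have /setP/(_ y) := dv; rewrite !inE.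
  rewrite (negPf ya) (negPf yb) /=; have [->|yc] := eqVneq y c.
    by rewrite eq_sym (negPf vc) => _ /andP[/negPf-> _].
  by case: (y == v); case: (adj E a y); case: (adj E b y).
apply: graph_ext; [exact: simple_relabel|exact: simple_switch|].
have tD y : y != a -> y != b -> tperm a b y = y by move=> *; rewrite tpermD // eq_sym.
have onea y : y != a -> y != b ->
    adj (relabel (tperm a b) E) a y = adj (switch E v a b c) a y.
  move=> ya yb; rewrite -[RHS]in_nbhd nbhd_switch_a // !inE -hb //.
  by rewrite -(adj_relabel (tperm a b) E b y) tpermR tD.
have oneb y : y != a -> y != b ->
    adj (relabel (tperm a b) E) b y = adj (switch E v a b c) b y.
  move=> ya yb; rewrite -[RHS]in_nbhd nbhd_switch_b // !inE -ha //.
  by rewrite -(adj_relabel (tperm a b) E a y) tpermL tD.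
have ab1 : adj (relabel (tperm a b) E) a b = adj (switch E v a b c) a b.
  rewrite -[RHS]in_nbhd nbhd_switch_a // !inE (eq_sym b v) vb (negPf bc) /= -/(adj E a b).
  by rewrite -(adj_relabel (tperm a b) E a b) tpermL tpermR adj_sym.
move=> x y; have [->|xa] := eqVneq x a => xy.
  by have [->//|yb] := eqVneq y b; apply: onea; rewrite // eq_sym.
have [xb|xb] := eqVneq x b.
  rewrite xb in xy *; have [->|ya] := eqVneq y a; first by rewrite adj_sym ab1 adj_sym.
  by apply: oneb; rewrite // eq_sym.
have [->|ya] := eqVneq y a; first by rewrite adj_sym onea // adj_sym.
have [->|yb] := eqVneq y b; first by rewrite adj_sym oneb // adj_sym.
rewrite adj_switch !eq_set2 (negPf xa) (negPf xb) (negPf ya) (negPf yb) !andbF !orbF.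
by rewrite /= andbT -(adj_relabel (tperm a b) E x y) !tD //= andbT.
Qed.

End Relabelling.

(** * Deleting a vertex *)

Section Removal.
Variable V : finType.
Implicit Types (E : {set {set V}}) (f : V -> nat) (u v w a b c x y z : V) (S : {set V}).

Definition nbhd_class f v S := [set E in graphs f | nbhd E v == S].

(** The degrees that remain when v has neighbourhood S and its star is
    removed. The vertex v is kept, with degree 0, so that the vertex set does
    not change. *)
Definition resid f v S u := if u == v then 0 else f u - (u \in S).

Definition star v S : {set {set V}} := [set [set v; u] | u in S].

Lemma in_star v S x y :
  ([set x; y] \in star v S) = (x == v) && (y \in S) || (y == v) && (x \in S).
Proof.
apply/imsetP/orP => [[u uS /eqP]|[/andP[/eqP-> yS]|/andP[/eqP-> xS]]].
- rewrite eq_set2 => /orP[]/andP[/eqP-> /eqP->]; rewrite uS eqxx.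
    by left.
  by right.
- by exists y.
- by exists x => //; exact: setUC.
Qed.

Lemma adj_star E v S x y : adj (E :|: star v S) x y =
  adj E x y || ((x == v) && (y \in S) || (y == v) && (x \in S)).
Proof. by rewrite /adj in_setU in_star. Qed.

Lemma nbhd_memC E x y : (x \in nbhd E y) = (y \in nbhd E x).
Proof. by rewrite !in_nbhd adj_sym. Qed.

Lemma nbhd0_star E v S : nbhd E v = set0 -> [disjoint E & star v S].
Proof.
move=> E0; apply/pred0P=> e /=; apply/negbTE/andP=> -[eE /imsetP[u uS ee]].
have : u \in nbhd E v by rewrite in_nbhd /adj -ee.
by rewrite E0 inE.
Qed.

Lemma nbhd_class_image f v S E0 : E0 \in nbhd_class f v S ->
  [set E :|: star v S | E in graphs (resid f v S)] = nbhd_class f v S.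
Proof.
rewrite inE => /andP[E0F /eqP E0S]; have s0 := graphs_simple E0F.
have vS : v \notin S by rewrite -E0S in_nbhd adj_irr.
have fS u : u \in S -> 0 < f u.
  move=> uS; rewrite -(graphs_deg u E0F); apply/card_gt0P; exists v.
  by rewrite nbhd_memC E0S.
apply/setP=> E; apply/imsetP/idP => [[E' E'F ->]|].
  have s' := graphs_simple E'F.
  have E'v : nbhd E' v = set0.
    by apply/eqP; rewrite -cards_eq0 (graphs_deg v E'F) /resid eqxx.
  have nbv : nbhd (E' :|: star v S) v = S.
    apply/setP=> y; rewrite in_nbhd adj_star eqxx (negPf vS) andbF orbF -in_nbhd E'v inE.
    by [].
  rewrite inE nbv eqxx andbT; apply/graphsP; split.
    apply/forall_inP=> e; rewrite inE => /orP[/(simple_card2 s')->//|].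
    case/imsetP=> u uS ->; rewrite cards2.
    by suff -> : v != u by []; apply: contraNneq vS => ->.
  move=> u; have [->|uv] := eqVneq u v; first by rewrite nbv -E0S (graphs_deg v E0F).
  have [uS|uS] := boolP (u \in S).
    have -> : nbhd (E' :|: star v S) u = v |: nbhd E' u.
      apply/setP=> y; rewrite in_nbhd adj_star (negPf uv) uS andbT in_setU1 in_nbhd orbC.
      by [].
    rewrite cardsU1 nbhd_memC E'v inE (graphs_deg u E'F) /resid (negPf uv) uS.
    by rewrite subnKC // fS.
  have -> : nbhd (E' :|: star v S) u = nbhd E' u.
    apply/setP=> y; rewrite in_nbhd adj_star (negPf uv) (negPf uS) andbF orbF in_nbhd.
    by rewrite /= orbF.
  by rewrite (graphs_deg u E'F) /resid (negPf uv) (negPf uS) subn0.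
rewrite inE => /andP[EF /eqP ES]; have s := graphs_simple EF.
have sub : star v S \subset E.
  by apply/subsetP=> _ /imsetP[u uS ->]; rewrite -[_ \in E]/(adj E v u) -in_nbhd ES.
exists (E :\: star v S); last first.
  by rewrite setDE setUIl [~: _ :|: _]setUC setUCr setIT; apply/esym/setUidPl.
have adjD x y : adj (E :\: star v S) x y =
    ~~ ((x == v) && (y \in S) || (y == v) && (x \in S)) && adj E x y.
  by rewrite /adj in_setD in_star.
apply/graphsP; split.
  by apply/forall_inP=> e; rewrite inE => /andP[_ /(simple_card2 s)->].
move=> u; rewrite /resid; have [->|uv] := eqVneq u v.
  apply/eqP; rewrite cards_eq0; apply/eqP/setP=> y; rewrite in_nbhd adjD eqxx -in_nbhd ES.
  by rewrite inE; case: (y \in S); rewrite ?andbF.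
rewrite -(graphs_deg u EF); have [uS|uS] := boolP (u \in S).
  rewrite (cardsD1 v (nbhd E u)) nbhd_memC ES uS addKn; apply: eq_card => y.
  by rewrite in_nbhd adjD (negPf uv) uS /= andbT !inE.
rewrite subn0; apply: eq_card => y.
by rewrite in_nbhd adjD (negPf uv) (negPf uS) /= andbF in_nbhd.
Qed.

(** Adding a fixed star at v to graphs in which v is isolated does not change
    their symmetric differences. *)
Lemma max_ham_class f v S :
  max_ham (@switch_adj V) (graphs (resid f v S)) -> max_ham (@switch_adj V) (nbhd_class f v S).
Proof.
move=> mh; have [->|[E0 E0C]] := set_0Vmem (nbhd_class f v S).
  split; first by move=> c _ x y; rewrite inE.
    by move=> _ x y; rewrite inE.
  by rewrite cards0.
rewrite -(nbhd_class_image E0C).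
have dis E : E \in graphs (resid f v S) -> [disjoint E & star v S].
  move=> EF; apply: nbhd0_star; apply/eqP.
  by rewrite -cards_eq0 (graphs_deg v EF) /resid eqxx.
apply: max_ham_map mh.
  move=> E E' EF E'F h; apply/setP=> e.
  have := congr1 (fun A : {set {set V}} => e \in A) h; rewrite /= !inE.
  have [es|es] := boolP (e \in star v S); last by rewrite !orbF.
  have out F : F \in graphs (resid f v S) -> (e \in F) = false.
    move=> FF; apply: contraTF es => eF; move/pred0P/(_ e): (dis _ FF) => /=.
    by rewrite eF /= => ->.
  by rewrite !out.
move=> E E' EF E'F; rewrite /switch_adj.
suff -> : symdiff (E :|: star v S) (E' :|: star v S) = symdiff E E' by [].
apply/setP=> e; rewrite !inE.
have [es|es] := boolP (e \in star v S); last by rewrite !orbF.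
have out F : F \in graphs (resid f v S) -> (e \in F) = false.
  move=> FF; apply: contraTF es => eF; move/pred0P/(_ e): (dis _ FF) => /=.
  by rewrite eF /= => ->.
by rewrite !out // orbT.
Qed.

Lemma resid_lt f v S : 0 < f v -> \sum_u resid f v S u < \sum_u f u.
Proof.
move=> fv; rewrite (bigD1 v) //= [X in _ < X](bigD1 v) //= /resid eqxx add0n.
rewrite -add1n leq_add // leq_sum // => u /negPf->; exact: leq_subr.
Qed.

End Removal.

(** * Passing from one neighbourhood class to the next *)

Section Crossing.
Variables (V : finType) (f : V -> nat) (v : V).
Implicit Types (E : {set {set V}}) (u w a b c : V) (S R : {set V}).

Local Notation nbhd_class := (nbhd_class f v).
Local Notation switch_path := (ham_path (@switch_adj V)).

Definition nbhds := [set nbhd E v | E in graphs f].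

Lemma nbhd_classP S E : reflect (E \in graphs f /\ nbhd E v = S) (E \in nbhd_class S).
Proof. by rewrite [E \in nbhd_class S]inE; apply: (iffP andP) => -[h /eqP]. Qed.

Lemma nbhd_class_nbhds S E : E \in nbhd_class S -> S \in nbhds.
Proof. by case/nbhd_classP=> EF <-; apply: imset_f. Qed.

Lemma nbhds_class S : S \in nbhds -> exists E, E \in nbhd_class S.
Proof. by case/imsetP=> E EF ->; exists E; apply/nbhd_classP. Qed.

Lemma nbhds_v S : S \in nbhds -> v \notin S.
Proof. by case/imsetP=> E /graphs_simple s ->; rewrite in_nbhd adj_irr. Qed.

Lemma nbhds_card S : S \in nbhds -> #|S| = f v.
Proof. by case/imsetP=> E EF ->; apply: graphs_deg. Qed.

(** The vertex v itself can be handed over from a to b; comparing degrees then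
    tells how many vertices b can hand over to a. *)
Lemma v_in_private E a b : E \in graphs f -> a \in nbhd E v -> b \notin nbhd E v -> b != v ->
  v \in private E b a.
Proof.
move=> EF aE bE bv; rewrite in_setD in_setU1 negb_or eq_sym bv /=.
by rewrite !(nbhd_memC _ v) bE aE.
Qed.

Lemma switch_class S a b c E : E \in nbhd_class S -> a \in S -> b \notin S -> b != v ->
  c \in private E a b -> switch_adj E (switch E v a b c) /\ switch E v a b c \in nbhd_class (exch S a b).
Proof.
move=> /nbhd_classP[EF ES] aS bS bv cd; have s := graphs_simple EF.
have swE : switchable E v a b c.
  by rewrite switchable_private cd andbT; apply: v_in_private; rewrite ?ES.
split; first exact: switch_adj_switch.
by apply/nbhd_classP; split; [apply: graphs_switch|rewrite nbhd_switch_v // ES].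
Qed.

Lemma graphs_card_private E a b : E \in graphs f -> #|private E a b| + f a = #|private E b a| + f b.
Proof.
by move=> EF; rewrite -(graphs_deg a EF) -(graphs_deg b EF); apply: card_private; apply: graphs_simple EF.
Qed.

Lemma private_gt E a b : E \in graphs f -> a \in nbhd E v -> b \notin nbhd E v -> b != v ->
  f b < #|private E a b| + f a.
Proof.
move=> EF aE bE bv; rewrite graphs_card_private // -add1n leq_add2r.
by apply/card_gt0P; exists v; apply: v_in_private.
Qed.

(** a can hand v over to b, and since a has at most the degree of b, b can
    hand some vertex over to a. *)
Lemma cross_ex S a b E : E \in nbhd_class S -> a \in S -> b \notin S -> b != v ->
  f a <= f b -> exists2 E', E' \in nbhd_class (exch S a b) & switch_adj E E'.
Proof.
move=> EC aS bS bv le; have [EF ES] := nbhd_classP _ _ EC.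
have gt : f b < #|private E a b| + f a by apply: private_gt => //; rewrite ES.
have : 0 < #|private E a b| by clear -gt le; move: #|_| gt => n; lia.
case/card_gt0P=> c cd; have [h1 h2] := switch_class EC aS bS bv cd.
by exists (switch E v a b c).
Qed.

(** Such a pair of neighbours of E in C gives a way into C without a parity
    condition, by mh_hit. *)
Definition twin_nbrs E (C : {set {set {set V}}}) := exists E1 E2,
  [/\ E1 \in C, E2 \in C & [/\ switch_adj E E1, switch_adj E E2 & switch_adj E1 E2]].

Lemma cross_twin S a b E : E \in nbhd_class S -> a \in S -> b \notin S -> b != v ->
  1 < #|private E a b| -> twin_nbrs E (nbhd_class (exch S a b)).
Proof.
move=> EC aS bS bv /card_gt1P[c1 [c2 [d1 d2 ne]]]; have [EF ES] := nbhd_classP _ _ EC.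
have vd : v \in private E b a by apply: v_in_private; rewrite ?ES.
have [h1 h2 h3] := private_triangle (graphs_simple EF) vd d1 d2 ne.
exists (switch E v a b c1), (switch E v a b c2).
by split=> //; [case: (switch_class EC aS bS bv d1)|case: (switch_class EC aS bS bv d2)].
Qed.

(** If the degree of b is larger, b has two vertices to hand over, and the two
    results are adjacent. *)
Lemma cross_lt S a b E : E \in nbhd_class S -> a \in S -> b \notin S -> b != v ->
  f a < f b -> twin_nbrs E (nbhd_class (exch S a b)).
Proof.
move=> EC aS bS bv lt; have [EF ES] := nbhd_classP _ _ EC.
apply: cross_twin => //.
have gt : f b < #|private E a b| + f a by apply: private_gt => //; rewrite ES.
by clear -gt lt; move: #|_| gt => n; lia.
Qed.

(** If b has only one vertex to hand over, then so has a, namely v, and the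
    switch is a swap of names. *)
Lemma cross_eq S a b E : E \in nbhd_class S -> a \in S -> b \notin S -> b != v ->
  f a = f b -> twin_nbrs E (nbhd_class (exch S a b)) \/ switch_adj E (relabel (tperm a b) E).
Proof.
move=> EC aS bS bv e; have [EF ES] := nbhd_classP _ _ EC.
have [gt1|le1] := boolP (1 < #|private E a b|); [by left; apply: cross_twin|right].
have vd : v \in private E b a by apply: v_in_private; rewrite ?ES.
have cE : #|private E a b| = #|private E b a| by have := graphs_card_private a b EF; rewrite e => /addIn.
have [c dc] : exists c, private E a b = [set c].
  apply/cards1P; rewrite eqn_leq leqNgt le1 cE /=.
  by apply/card_gt0P; exists v.
have dv : private E b a = [set v].
  have /cards1P[w dw] : #|private E b a| == 1 by rewrite -cE dc cards1.
  by move: vd; rewrite dw inE => /eqP ->.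
rewrite (relabel_tperm_switch (graphs_simple EF) dv dc); apply: switch_adj_switch; first exact: graphs_simple EF.
by rewrite switchable_private dv dc !set11.
Qed.

Lemma swap_class S a b E : E \in nbhd_class S -> a \in S -> b \notin S -> b != v ->
  f a = f b -> relabel (tperm a b) E \in nbhd_class (exch S a b).
Proof.
move=> EC aS bS bv e; have [EF ES] := nbhd_classP _ _ EC; apply/nbhd_classP; split.
  by apply: graphs_relabel => //; apply: tperm_invariant.
have av : a != v by apply: contraNneq (nbhds_v (nbhd_class_nbhds EC)) => <-.
by rewrite nbhd_relabel_fix ?ES ?imset_tperm // tpermD.
Qed.

Lemma exchK S a b : a \in S -> b \notin S -> exch (exch S a b) b a = S.
Proof.
move=> aS bS; apply/setP=> x; rewrite !inE; have [->|xa] //= := eqVneq x a.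
have [->|xb] //= := eqVneq x b; by rewrite (negPf bS).
Qed.

Lemma exch_in S a b : b \in exch S a b. Proof. exact: setU11. Qed.

Lemma exch_out S a b : a \in S -> b \notin S -> a \notin exch S a b.
Proof. by move=> aS bS; rewrite !inE eqxx orbF; apply: contraNneq bS => <-. Qed.

Lemma swap_class_image S a b : a \in S -> b \notin S -> a != v -> b != v -> f a = f b ->
  nbhd_class (exch S a b) = relabel (tperm a b) @: nbhd_class S.
Proof.
move=> aS bS av bv e; apply/setP=> E; apply/idP/imsetP => [EC|[E' E'C ->]].
  exists (relabel (tperm a b) E); last by rewrite relabel_tpermK.
  rewrite -(exchK aS bS) tpermC; apply: swap_class => //; first exact: exch_in.
  exact: exch_out.
exact: swap_class.
Qed.

Lemma hit_twin C E x : max_ham (@switch_adj V) C -> x \in C -> twin_nbrs E C ->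
  exists E', [/\ E' \in C, switch_adj E E' & switch_path C x E'].
Proof.
move=> mh xC [E1 [E2 [h1 h2 [n1 n2 n12]]]].
by case: (mh_hit (@switch_adj_irr V) mh xC h1 h2 n12) => h; [exists E1|exists E2].
Qed.

Hypothesis mh : forall S, max_ham (@switch_adj V) (nbhd_class S).

(** Here C is the class to be entered and D the class to be left, isomorphic
    by t. If C is not bipartite, take two elements of C other than h: at one
    of them D can be left by a pair of adjacent graphs, or both are matched by
    t, and one of their partners is not x. *)
Lemma hit_or_rigid C D (t : {set {set V}} -> {set {set V}}) h :
  max_ham (@switch_adj V) C -> max_ham (@switch_adj V) D -> injective t -> {mono t : E E' / switch_adj E E'} ->
  C = t @: D -> D = t @: C ->
  (forall E, E \in D -> exists2 E', E' \in C & switch_adj E E') ->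
  (forall E, E \in C -> twin_nbrs E D \/ switch_adj E (t E)) -> h \in C ->
  (forall x, x \in D -> exists e q, [/\ switch_path D x e, switch_adj e q & switch_path C q h]) \/
  [/\ bipartite_on (@switch_adj V) D, bipartite_on (@switch_adj V) C, 1 < #|D| & 1 < #|C|].
Proof.
move=> mhC mhD tI tm CD DC ex tw hC; have sym := @switch_adj_sym V.
have cardC : #|C| = #|D| by rewrite CD card_imset.
have bipC : bipartite_on (@switch_adj V) C = bipartite_on (@switch_adj V) D.
  apply/idP/idP.
    by rewrite CD; apply: bipartite_on_map => E E' _ _; rewrite tm.
  by rewrite DC; apply: bipartite_on_map => E E' _ _; rewrite tm.
have [gt1|le1] := ltnP 1 #|C|; last first.
  left=> x xD; have [E' E'C nE'] := ex _ xD.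
  have C1 : C = [set h] by apply/eqP; rewrite eq_sym eqEcard sub1set hC cards1.
  have D1 : D = [set x].
    by apply/eqP; rewrite eq_sym eqEcard sub1set xD cards1 -cardC.
  exists x, E'; split=> //; first by rewrite D1; apply: ham_path1.
  by move: E'C; rewrite C1 inE => /eqP->; apply: ham_path1.
have [bi|nbi] := boolP (bipartite_on (@switch_adj V) C); first by right; rewrite -bipC -cardC.
left=> x xD; have c3 := nonbipartite_card (@switch_adj_irr V) nbi.
have : 1 < #|C :\ h| by rewrite (cardsD1 h) hC in c3; apply: c3.
case/card_gt1P=> q1 [q2 []]; rewrite !in_setD1 => /andP[q1h q1C] /andP[q2h q2C] q12.
have h1 : switch_path C q1 h by apply: (mh_conn mhC).
have h2 : switch_path C q2 h by apply: (mh_conn mhC).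
(* A way through q, valid when q can be entered from two adjacent graphs of D.
   *)
have via q : q \in C -> twin_nbrs q D -> switch_path C q h ->
    exists e q', [/\ switch_path D x e, switch_adj e q' & switch_path C q' h].
  move=> qC /(hit_twin mhD xD)[e' [e'D qe xe]] hq.
  by exists e', q; split=> //; rewrite switch_adj_sym.
case: (tw q1 q1C) (tw q2 q2C) => [t1|n1] [t2|n2]; [exact: (via q1)..|exact: (via q2)|].
have nbD : ~~ bipartite_on (@switch_adj V) D by rewrite -bipC.
have inD q : q \in C -> t q \in D by move=> qC; rewrite DC imset_f.
have [xe|xe] := eqVneq x (t q1).
  exists (t q2), q2; split=> //; last by rewrite switch_adj_sym.
  by apply: (mh_conn mhD) => //; [exact: inD|rewrite xe (inj_eq tI)].
exists (t q1), q1; split=> //; last by rewrite switch_adj_sym.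
by apply: (mh_conn mhD) => //; apply: inD.
Qed.

(** The aim is to leave the class of S and to enter the next one at a graph
    from which this class can be traversed up to the prescribed h. For
    different degrees of a and b, the end of the crossing in the class that
    offers two adjacent graphs is chosen last. *)
Lemma pair_hit S a b h : a \in S -> b \notin S -> a != v -> b != v ->
  h \in nbhd_class (exch S a b) ->
  (forall x, x \in nbhd_class S -> exists e q,
     [/\ switch_path (nbhd_class S) x e, switch_adj e q & switch_path (nbhd_class (exch S a b)) q h]) \/
  f a = f b /\
  [/\ bipartite_on (@switch_adj V) (nbhd_class S), bipartite_on (@switch_adj V) (nbhd_class (exch S a b)),
      1 < #|nbhd_class S| & 1 < #|nbhd_class (exch S a b)|].
Proof.
move=> aS bS av bv hR; have sym := @switch_adj_sym V.
have bR := exch_in S a b; have aR := exch_out aS bS; have RS := exchK aS bS.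
case: (ltngtP (f a) (f b)) => [lt|lt|e].
- left=> x xC; have [e eC xe] := mh_reach (@switch_adj_irr V) (mh S) xC.
  have [q [qC eq hq]] := hit_twin (mh _) hR (cross_lt eC aS bS bv lt).
  by exists e, q; split; [exact: xe|exact: eq|exact: ham_path_sym].
- left=> x xC; have [q qC hq] := mh_reach (@switch_adj_irr V) (mh _) hR.
  have := cross_lt qC bR aR av lt; rewrite RS => /(hit_twin (mh S) xC)[e [eC qe xe]].
  by exists e, q; split; [exact: xe|rewrite switch_adj_sym|exact: ham_path_sym].
case: (hit_or_rigid (t := relabel (tperm a b)) (mh (exch S a b)) (mh S) _ _ _ _ _ _ hR).
- exact: relabel_inj.
- exact: switch_adj_relabel.
- exact: swap_class_image.
- by rewrite -[in LHS]RS tpermC; apply: swap_class_image.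
- by move=> E EC; apply: cross_ex; rewrite ?e.
- by move=> E EC; have := cross_eq EC bR aR av (esym e); rewrite RS tpermC.
- by left.
- by right; split.
Qed.

Definition class_union (l : seq {set V}) := [set E in graphs f | nbhd E v \in l].

Lemma class_union_cons S l : class_union (S :: l) = nbhd_class S :|: class_union l.
Proof. by apply/setP=> E; rewrite in_setU !in_set in_cons andb_orr. Qed.

Lemma class_union1 S : class_union [:: S] = nbhd_class S.
Proof. by apply/setP=> E; rewrite !in_set mem_seq1. Qed.

Lemma class_union_disjoint S l : S \notin l -> [disjoint nbhd_class S & class_union l].
Proof.
move=> Sl; apply/pred0P=> E /=; rewrite [E \in nbhd_class _]inE [E \in class_union _]inE; apply: contraNF Sl.
by move=> /andP[/andP[_ /eqP<-] /andP[]].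
Qed.

Lemma class_union_full l : l =i nbhds -> class_union l = graphs f.
Proof.
move=> lE; apply/setP=> E; rewrite [E \in class_union l]inE lE.
by case EF: (E \in graphs f) => //; rewrite andTb; apply/imsetP; exists E.
Qed.

Lemma sum_exch S a b : a \in S -> b \notin S ->
  \sum_(u in exch S a b) f u + f a = \sum_(u in S) f u + f b.
Proof.
move=> aS bS; rewrite (big_setD1 a aS) /= big_setU1 /=; last first.
  by rewrite !inE (negPf bS) andbF.
by move: (\sum_(i in S :\ a) f i) => n; lia.
Qed.

(** Equality of the sums says that elements exchanged between members of l
    have equal degree, whatever the exchange. *)
Definition uniform_on (l : seq {set V}) := forall R : {set V}, R \in l ->
  [/\ bipartite_on (@switch_adj V) (nbhd_class R), 1 < #|nbhd_class R| &
      \sum_(u in R) f u = \sum_(u in (head R l : {set V})) f u].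

(** Built from the last class backwards. Either the first class may be entered
    anywhere, or it is only known how to continue from one graph h in it, and
    then all classes are bipartite and only vertices of equal degree have been
    exchanged. A single crossing without these restrictions makes all earlier
    classes free. *)
Lemma chain S p y : path (@exch_adj V) S p -> uniq (S :: p) ->
  {subset S :: p <= nbhds} -> y \in nbhd_class (last S p) ->
  (forall x, x \in nbhd_class S -> switch_path (class_union (S :: p)) x y) \/
  (exists2 h, h \in nbhd_class S & forall x, switch_path (nbhd_class S) x h -> switch_path (class_union (S :: p)) x y) /\
  (p = [::] \/ uniform_on (S :: p)).
Proof.
have sym := @switch_adj_sym V.
elim: p S => [|R p IH] S.
  move=> _ _ _ yC; right; split; last by left.
  by exists y => // x; rewrite class_union1.
move=> /= /andP[/exch_adjP[a [b [aS bS RE]]] pp] /andP[Sn un] sub yC.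
have subR : {subset R :: p <= nbhds} by move=> W Wp; apply: sub; rewrite inE Wp orbT.
have SSS : S \in nbhds by apply: sub; rewrite mem_head.
have RSS : R \in nbhds by apply: subR; rewrite mem_head.
have av : a != v by apply: contraNneq (nbhds_v SSS) => <-.
have bv : b != v by apply: contraNneq (nbhds_v RSS) => <-; rewrite RE exch_in.
have glue x e q : switch_path (nbhd_class S) x e -> switch_adj e q -> switch_path (class_union (R :: p)) q y ->
    switch_path (class_union (S :: R :: p)) x y.
  move=> xe eq qy; rewrite class_union_cons; apply: ham_path_cat xe qy eq _.
  exact: class_union_disjoint.
have next e : f a = f b -> e \in nbhd_class S -> exists2 q, q \in nbhd_class R & switch_adj e q.
  by move=> fab eC; rewrite RE; apply: cross_ex; rewrite ?fab.
case: (IH R pp un subR yC) => [full|[[h hC hq] info]].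
  left=> x xC; have [h hC] := nbhds_class RSS; have hC' := hC.
  rewrite RE in hC'; case: (pair_hit aS bS av bv hC') => [hit|[fab _]].
    have [e [q [xe eq qh]]] := hit x xC; apply: glue xe eq _.
    by apply: full; rewrite RE; apply: ham_path_memL qh.
  have [e eC xe] := mh_reach (@switch_adj_irr V) (mh S) xC.
  have [q qC eq] := next e fab eC.
  exact: glue xe eq (full q qC).
have hC' := hC; rewrite RE in hC'; case: (pair_hit aS bS av bv hC') => [hit|].
  left=> x xC; have [e [q [xe eq qh]]] := hit x xC; apply: glue xe eq _.
  by apply: hq; rewrite RE.
rewrite -RE => -[fab [bS' bR' cS cR]]; right; split.
  have [q qC hqh] := mh_reach (@switch_adj_irr V) (mh R) hC.
  have [h0 h0C nq] : exists2 h0, h0 \in nbhd_class S & switch_adj q h0.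
    rewrite -(exchK aS bS) -RE; apply: cross_ex; rewrite // ?RE ?exch_in ?fab //.
    exact: exch_out.
  exists h0 => // x xh; apply: glue xh _ (hq _ _); first by rewrite switch_adj_sym; apply: nq.
  exact: ham_path_sym.
right=> W; have sumRS : \sum_(u in R) f u = \sum_(u in S) f u.
  by have := sum_exch aS bS; rewrite -RE fab => /addIn.
rewrite inE => /orP[/eqP->//|]; case: info => [->|un']; last first.
  by move=> /un'[h1 h2 h3]; split; rewrite //= -sumRS h3.
by rewrite inE => /eqP->; split.
Qed.

(** What is left by chain. The classes are bipartite, so parity restricts
    where they can be left, and equal degrees mean that a crossing may be
    forced to be the swap of two names. *)
Definition rigid := forall R, R \in nbhds -> [/\ bipartite_on (@switch_adj V) (nbhd_class R), 1 < #|nbhd_class R| &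
  forall a b, a \in R -> b \notin R -> exch R a b \in nbhds -> f a = f b].

Lemma chain_ham_path x y : x \in graphs f -> y \in graphs f -> nbhd x v != nbhd y v ->
  ham_path (@exch_adj V) nbhds (nbhd x v) (nbhd y v) -> switch_path (graphs f) x y \/ rigid.
Proof.
move=> xF yF ne [p [pp lp up mp]].
have CCE := class_union_full mp.
have yC : y \in nbhd_class (last (nbhd x v) p) by apply/nbhd_classP; rewrite lp.
have sub : {subset nbhd x v :: p <= nbhds} by move=> S; rewrite mp.
case: (chain pp up sub yC) => [h|[_ [p0|un]]].
- by left; rewrite -CCE; apply: h; apply/nbhd_classP.
- by move: lp ne; rewrite p0 /= => ->; rewrite eqxx.
right=> R RS; have Rp : R \in nbhd x v :: p by rewrite mp.
have [h1 h2 h3] := un R Rp; split=> // a b aR bR; rewrite -mp => /un[_ _ h4].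
have := sum_exch aR bR; rewrite [in RHS]h3 h4 /=.
by move/addnI.
Qed.

(** Each class is left at a graph with the colour opposite to that of its
    entry. The crossing changes the colour once more, so all classes are
    entered in the colour of x, and in the last one y has the opposite colour.
    *)
Lemma parity_ham_path (c : {set {set V}} -> bool) x y : proper_col (@switch_adj V) c (graphs f) -> rigid ->
  x \in graphs f -> y \in graphs f -> c x != c y ->
  ham_path (@exch_adj V) nbhds (nbhd x v) (nbhd y v) -> switch_path (graphs f) x y.
Proof.
move=> cP rg xF yF cxy [p [pp lp up mp]].
have CCE := class_union_full mp.
have subC S E : E \in nbhd_class S -> E \in graphs f by case/nbhd_classP.
have cPS S : proper_col (@switch_adj V) c (nbhd_class S).
  by move=> E E' /subC EF /subC E'F; apply: cP.
have : {subset nbhd x v :: p <= nbhds} by move=> S; rewrite mp.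
have : x \in nbhd_class (nbhd x v) by apply/nbhd_classP.
rewrite -CCE; move: pp lp up cxy; move: (nbhd x v); clear mp CCE.
elim: p x xF => [|R p IH] x xF S /=.
  move=> _ Sy _ cxy xC _; rewrite class_union1; apply: (mh_lace (mh S) (cPS S)) => //.
  by apply/nbhd_classP; rewrite Sy.
move=> /andP[/exch_adjP[a [b [aS bS RE]]] pp] lp /andP[Sn un] cxy xC sub.
have SSS : S \in nbhds by apply: sub; rewrite mem_head.
have RSS : R \in nbhds by apply: sub; rewrite !inE eqxx orbT.
have [_ gt1 eqf] := rg S SSS.
have bv : b != v by apply: contraNneq (nbhds_v RSS) => <-; rewrite RE exch_in.
have fab : f a = f b by apply: eqf => //; rewrite -RE.
have [e1 [e2 [e1C e2C e12]]] := mh_edge (mh S) gt1.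
have [e eC ce] : exists2 e, e \in nbhd_class S & c x != c e.
  have [c1|c1] := eqVneq (c x) (c e1); last by exists e1.
  by exists e2; rewrite // c1; apply: (cPS S).
have xe : switch_path (nbhd_class S) x e by apply: (mh_lace (mh S) (cPS S)).
have [q qC eq] : exists2 q, q \in nbhd_class R & switch_adj e q.
  by rewrite RE; apply: cross_ex; rewrite ?fab.
have qF := subC _ _ qC; have eF := subC _ _ eC.
have cq := cP _ _ eF qF eq.
rewrite class_union_cons; apply: (ham_path_cat xe _ eq (class_union_disjoint Sn)).
apply: IH => //; last by move=> W Wp; apply: sub; rewrite inE Wp orbT.
by move: cxy ce cq; case: (c x); case: (c y); case: (c e); case: (c q).
Qed.

End Crossing.

(** * Exceptional vertices *)

Section DegreeOrder.
Variables (V : finType) (f : V -> nat).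
Implicit Types (u v w a b c : V) (S R T : {set V}).

(** Orders by decreasing degree; the enumeration breaks ties, because shifted
    families need an injective key. *)
Definition degree_rank u := (\sum_w f w - f u) * #|V| + enum_rank u.

Lemma f_le_sum u : f u <= \sum_w f w.
Proof. by rewrite (bigD1 u) //= leq_addr. Qed.

Lemma degree_rank_inj : injective degree_rank.
Proof.
move=> u w; rewrite /degree_rank => E; have V0 : 0 < #|V| by apply/card_gt0P; exists u.
have := congr1 (modn^~ #|V|) E; rewrite /= !modnMDl !modn_small //.
by move/val_inj/enum_rank_inj.
Qed.

Lemma degree_rank_le a b : degree_rank b < degree_rank a -> f a <= f b.
Proof.
rewrite /degree_rank; have := ltn_ord (enum_rank a); have := f_le_sum a; have := f_le_sum b.
move: (\sum_w f w) (f a) (f b) #|V| (nat_of_ord _) (nat_of_ord _).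
move=> s x y n i j ys xs jn; apply: contraTT; rewrite -ltnNge -leqNgt => lt.
have : (s - x).+1 * n <= (s - y) * n by rewrite leq_mul2r; lia.
rewrite mulSn; lia.
Qed.

Lemma nbhds_up v S a b : S \in nbhds f v -> a \in S -> b \notin S -> b != v ->
  f a <= f b -> exch S a b \in nbhds f v.
Proof.
move=> /nbhds_class[E EC] aS bS bv le; have [E' E'C _] := cross_ex EC aS bS bv le.
exact: nbhd_class_nbhds E'C.
Qed.

Lemma nbhds_shifted v : shifted degree_rank [set~ v] (f v) (nbhds f v).
Proof.
split.
- move=> S SF; rewrite -(nbhds_card SF); apply: eq_card => x; rewrite !inE.
  have [->|] := eqVneq x v; rewrite ?andbT // (negPf (nbhds_v SF)) //.
- have h S : S \in nbhds f v -> S :\: [set~ v] = set0.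
    move=> SF; apply/setP=> x; rewrite !inE negbK; apply/negbTE/andP=> -[/eqP-> vS].
    by case/negP: (nbhds_v SF).
  by move=> S S' /h-> /h->.
- move=> S a b SF aS _; rewrite !inE => bv bS /degree_rank_le le.
  exact: nbhds_up.
Qed.

Lemma nbhds_ham_path v x y : x \in graphs f -> y \in graphs f -> nbhd x v != nbhd y v ->
  ~~ exceptional (nbhds f v) (nbhd x v) (nbhd y v) -> ham_path (@exch_adj V) (nbhds f v) (nbhd x v) (nbhd y v).
Proof.
move=> xF yF ne nex; have xS : nbhd x v \in nbhds f v by apply: imset_f.
have yS : nbhd y v \in nbhds f v by apply: imset_f.
case: (shifted_ham_path degree_rank_inj (nbhds_shifted v) xS yS ne) => // ex.
by rewrite ex in nex.
Qed.

Section Exceptional.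
Variables (v g y : V) (T : {set V}) (q p : {set {set V}}).
Hypotheses (qF : q \in graphs f) (pF : p \in graphs f).

(** The graph q realises a member g |: T above the cut, p one below it, and
    noT, noU say that no exchange starting from these crosses the cut. By
    switch_class, every missing exchange is an inclusion of neighbourhoods.
    Therefore a neighbour that b loses from q to p is one that e gains, as
    long as it is not e; and if be is an edge of q only, then the inclusions
    bound the degree of b on both sides. *)
Lemma exceptional_half b e : b != e -> b \notin T -> e \notin T -> g \notin b |: (e |: T) ->
  nbhd q v = g |: T -> nbhd p v = (b |: (e |: T)) :\ y -> y \in T ->
  (forall t w, t \in T -> w \notin nbhd q v -> w != v -> exch (nbhd q v) t w \notin nbhds f v) ->
  (forall s w, s \in nbhd p v -> w \notin b |: (e |: T) -> w != v ->
     exch (nbhd p v) s w \notin nbhds f v) ->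
  (e \notin nbhd q b :\: nbhd p b -> #|nbhd q b :\: nbhd p b| < #|nbhd p e :\: nbhd q e|) /\
  (e \in nbhd q b :\: nbhd p b -> f b = f v).
Proof.
move=> be bT eT gU qv pv yT noT noU; have sq := graphs_simple qF; have sp := graphs_simple pF.
have [gb ge gT] : [/\ g != b, g != e & g \notin T].
  by move: gU; rewrite !inE !negb_or => /and3P[].
have bq : b \notin nbhd q v by rewrite qv !inE negb_or eq_sym gb.
have eq : e \notin nbhd q v by rewrite qv !inE negb_or eq_sym ge.
have ey : e != y by apply: contraNneq eT => ->.
have by' : b != y by apply: contraNneq bT => ->.
have bp : b \in nbhd p v by rewrite pv !inE by' eqxx.
have ep : e \in nbhd p v by rewrite pv !inE ey eqxx orbT.
have irr (x : V) (E : {set {set V}}) : simple_edges E -> x \notin nbhd E x by move=> s; rewrite in_nbhd adj_irr.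
have bv : b != v by apply: contraTneq bp => ->; apply: irr.
have ev : e != v by apply: contraTneq ep => ->; apply: irr.
(* noT as an inclusion of neighbourhoods in q, and noU as one in p. *)
have tool1 t w z : t \in T -> w \notin nbhd q v -> w != v -> z \in nbhd q w -> z != t ->
    z \in nbhd q t.
  move=> tT wq wv zw zt; apply: contraT => zn.
  have tq : t \in nbhd q v by rewrite qv inE tT orbT.
  have zd : z \in private q t w by rewrite in_setD in_setU1 negb_or zt zn.
  have qC : q \in nbhd_class f v (nbhd q v) by apply/nbhd_classP.
  have [_ h] := switch_class qC tq wq wv zd.
  by case/negP: (noT _ _ tT wq wv); apply: nbhd_class_nbhds h.
have tool2 s w z : s \in nbhd p v -> w \notin b |: (e |: T) -> w != v -> z \in nbhd p w ->
    z != s -> z \in nbhd p s.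
  move=> sp' wU wv zw zs; apply: contraT => zn.
  have wp : w \notin nbhd p v by rewrite pv in_setD1 (negPf wU) andbF.
  have zd : z \in private p s w by rewrite in_setD in_setU1 negb_or zs zn.
  have pC : p \in nbhd_class f v (nbhd p v) by apply/nbhd_classP.
  have [_ h] := switch_class pC sp' wp wv zd.
  by case/negP: (noU _ _ sp' wU wv); apply: nbhd_class_nbhds h.
have mC (E : {set {set V}}) (x z : V) : (x \in nbhd E z) = (z \in nbhd E x) := nbhd_memC E x z.
split=> [eW|].
  apply: proper_card; apply/properP; split; last first.
    by exists v; rewrite in_setD ![v \in _]mC ?eq ?ep ?(negPf bq) ?andbF.
  apply/subsetP=> w wW; have we : w != e by apply: contraNneq eW => <-.
  move: wW; rewrite in_setD => /andP[wp wq].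
  have wb : w != b by apply: contraTneq wq => ->; apply: irr.
  have sub z : z \in nbhd p w -> z \notin nbhd q w -> z = e.
    move=> zp zq; apply/eqP; apply: contraT => ze.
    have zw : z != w by apply: contraTneq zp => ->; apply: irr.
    have zb : z != b by apply: contraNneq zq => ->; rewrite mC.
    have zv : z != v.
      apply: contraTneq zp => zE; have zq' : w \notin nbhd q v by rewrite mC -zE.
      rewrite zE mC; apply: contra zq'; rewrite pv qv !inE (negPf wb) (negPf we) /= => /andP[_ ->].
      by rewrite orbT.
    have [zT|zT] := boolP (z \in T).
      by case/negP: zq; rewrite mC; apply: tool1 zT bq bv wq _; rewrite eq_sym.
    have zU : z \notin b |: (e |: T) by rewrite !inE !negb_or zb ze.
    by case/negP: wp; apply: tool2 bp zU zv _ wb; rewrite mC.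
  have bqw : b \in nbhd q w by rewrite mC.
  have bpw : b \notin nbhd p w by rewrite mC.
  have [z zp zq] := nbhdD_move qF pF bqw bpw.
  have ze := sub z zp zq; rewrite ze in zp zq.
  by rewrite in_setD ![w \in _]mC zp zq.
rewrite in_setD => /andP[ebp ebq].
have cT : f v = #|T|.+1 by rewrite -(graphs_deg v qF) qv cardsU1 gT.
apply/eqP; rewrite eqn_leq; apply/andP; split.
  rewrite -(graphs_deg b pF) cT.
  have vT : v \notin T.
    by have := irr v q sq; rewrite qv in_setU1 negb_or => /andP[].
  have <- : #|v |: T| = #|T|.+1 by rewrite cardsU1 vT.
  apply: subset_leq_card; apply/subsetP=> w wp; rewrite in_setU1.
  have [//|wv] := eqVneq w v; apply: contraT => /= wT.
  have wb : w != b by apply: contraTneq wp => ->; apply: irr.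
  have we : w != e by apply: contraTneq wp => ->.
  have wU : w \notin b |: (e |: T) by rewrite !inE !negb_or wb we.
  case/negP: ebp; rewrite mC; apply: tool2 ep wU wv _ be; by rewrite mC.
rewrite -(graphs_deg b qF) cT.
have <- : #|e |: T| = #|T|.+1 by rewrite cardsU1 eT.
apply: subset_leq_card; apply/subsetP=> w; rewrite in_setU1 => /orP[/eqP->//|wT].
have bw : b != w by apply: contraNneq bT => ->.
by rewrite mC; apply: tool1 wT eq ev _ bw; rewrite mC.
Qed.

End Exceptional.

(** By exceptional_half applied to (b, e) and to (e, b), the two strict
    inequalities would contradict each other, so be is an edge of q only and
    b, e have the degree of v. A further vertex of this degree could be
    exchanged with b or e across the cut. *)
Lemma exceptional_level v X Y : exceptional (nbhds f v) X Y -> X \in nbhds f v -> exists b e,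
  [/\ b \in X, e \notin X & Y = exch X b e] /\
  [/\ f b = f v, f e = f v & forall w, f w = f v -> [|| w == v, w == b | w == e]].
Proof.
case/exceptionalP=> b [e [[bX eX ->] [al [S1 [S1F T1 U1]] [S2 [S2F T2 U2]]]]] XF.
exists b, e; split=> //; set T := X :\ b in al T1 T2.
have bT : b \notin T by rewrite !inE eqxx.
have eT : e \notin T by rewrite inE (negPf eX) andbF.
have XT : X = b |: T by rewrite setD1K.
clearbody T.
have be : b != e by apply: contraNneq eX => <-.
have UE : e |: X = b |: (e |: T) by rewrite XT setUCA.
rewrite UE in al U1 U2.
have cT : f v = #|T|.+1 by rewrite -(nbhds_card XF) XT cardsU1 bT.
have [g gS gU] := subsetPn U1.
have [y yT yS] := subsetPn T2.
have [gb [ge gT]] : g != b /\ g != e /\ g \notin T.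
  by move: gU; rewrite !inE !negb_or => /and3P[].
have S1E : S1 = g |: T.
  apply/eqP; rewrite eq_sym eqEcard subUset sub1set gS T1 cardsU1 gT.
  by rewrite (nbhds_card S1F) cT add1n leqnn.
have S2E : S2 = (b |: (e |: T)) :\ y.
  apply/eqP; rewrite eqEcard; apply/andP; split.
    apply/subsetP=> z zS; rewrite in_setD1 (subsetP U2 z zS) andbT.
    by apply: contraNneq yS => <-.
  have yU : y \in b |: (e |: T) by rewrite !inE yT !orbT.
  have cU : #|b |: (e |: T)| = #|T|.+2 by rewrite !cardsU1 in_setU1 negb_or be bT eT.
  have := cardsD1 y (b |: (e |: T)); rewrite yU cU add1n (nbhds_card S2F) cT => -[->].
  exact: leqnn.
have [q qC] := nbhds_class S1F; have [p pC] := nbhds_class S2F.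
have [qF qv] := nbhd_classP _ _ _ _ qC; have [pF pv] := nbhd_classP _ _ _ _ pC.
have noT t w : t \in T -> w \notin S1 -> w != v -> exch S1 t w \notin nbhds f v.
  move=> tT wS wv; apply/negP=> /al[/subsetP/(_ t tT)|/subsetP/(_ g)].
    rewrite !inE eqxx orbF => /eqP tw; case/negP: wS.
    by rewrite -tw S1E !inE tT orbT.
  have gt : g != t by apply: contraNneq gT => ->.
  by rewrite (negPf gU) !inE gt gS orbT => /(_ isT).
have noU s w : s \in S2 -> w \notin b |: (e |: T) -> w != v -> exch S2 s w \notin nbhds f v.
  move=> sS wU wv; apply/negP=> /al[/subsetP/(_ y yT)|/subsetP/(_ w)].
    rewrite !inE (negPf yS) andbF orbF => /eqP yw; case/negP: wU.
    by rewrite -yw !inE yT !orbT.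
  by rewrite (negPf wU) exch_in => /(_ isT).
rewrite -qv in noT S1E; rewrite -pv in noU S2E.
have [h1 l1] := exceptional_half qF pF be bT eT gU S1E S2E yT noT noU.
have eb : e != b by rewrite eq_sym.
have UC : b |: (e |: T) = e |: (b |: T) by rewrite setUCA.
have gU' := gU; have S2E' := S2E; have noU' := noU; rewrite UC in gU' S2E' noU'.
have [h2 l2] := exceptional_half qF pF eb eT bT gU' S1E S2E' yT noT noU'.
have ebW : e \in nbhd q b :\: nbhd p b.
  apply: contraT => n1; have n2 : b \notin nbhd q e :\: nbhd p e.
    by move: n1; rewrite !in_setD ![e \in _]nbhd_memC.
  have := h1 n1; have := h2 n2; rewrite (card_nbhdD b qF pF) (card_nbhdD e qF pF).
  by move=> lt1 lt2; have := ltn_trans lt1 lt2; rewrite ltnn.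
have fb := l1 ebW; have fe : f e = f v.
  by apply: l2; move: ebW; rewrite !in_setD ![e \in _]nbhd_memC.
split=> // w fw; apply: contraT; rewrite !negb_or => /and3P[wv wb we].
have [wT|wT] := boolP (w \in T).
  have bS1 : b \notin nbhd q v by rewrite S1E !inE negb_or eq_sym gb.
  have bv : b != v by apply: contraTneq bX => ->; apply: (nbhds_v XF).
  case/negP: (noT w b wT bS1 bv); rewrite qv; apply: nbhds_up => //; rewrite -?qv //.
    by rewrite S1E inE wT orbT.
  by rewrite fw fb.
have wU : w \notin b |: (e |: T) by rewrite !inE !negb_or wb we.
have eS : e \in nbhd p v.
  rewrite S2E !inE eqxx orbT andbT; apply: contraNneq eT => ->; exact: yT.
case/negP: (noU e w eS wU wv); rewrite pv; apply: nbhds_up => //; rewrite -?pv //.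
  by rewrite S2E in_setD1 (negPf wU) andbF.
by rewrite fw fe.
Qed.

Lemma exceptional_level_graphs v x y : x \in graphs f -> exceptional (nbhds f v) (nbhd x v) (nbhd y v) ->
  exists b e, [/\ adj x v b, ~~ adj x v e & nbhd y v = exch (nbhd x v) b e] /\
  [/\ f b = f v, f e = f v & forall w, f w = f v -> [|| w == v, w == b | w == e]].
Proof.
move=> xF ex; have xS : nbhd x v \in nbhds f v by apply: imset_f.
have [b [e [[h1 h2 h3] h4]]] := exceptional_level ex xS.
by exists b, e; split=> //; split; rewrite -?in_nbhd.
Qed.

(** If v is exceptional, exchanging b for e, the vertices of its degree are v,
    b and e. If b and e were exceptional too, the differences of x and y at v,
    b and e would stay within the triangle v, b, e: at b the neighbour v is
    replaced by e, while at e the neighbour v is the only one gained, and so b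
    is not. *)
Lemma good_vertex x y : x \in graphs f -> y \in graphs f -> x != y -> exists v,
  nbhd x v != nbhd y v /\ ~~ exceptional (nbhds f v) (nbhd x v) (nbhd y v).
Proof.
move=> xF yF xy; have sx := graphs_simple xF; have sy := graphs_simple yF.
have [v nv] : exists v, nbhd x v != nbhd y v.
  apply/existsP; apply: contraR xy => /existsPn h; apply/eqP/nbhd_ext => // v.
  by have := h v; rewrite negbK => /eqP.
have [exv|] := boolP (exceptional (nbhds f v) (nbhd x v) (nbhd y v)); last by exists v.
have [b [e [[xvb xve yE] [fb fe lev]]]] := exceptional_level_graphs xF exv.
have be : b != e by apply: contraTneq xvb => ->.
have yvb : ~~ adj y v b by rewrite -in_nbhd yE !inE eqxx orbF.
have yve : adj y v e by rewrite -in_nbhd yE !inE eqxx.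
have neb : nbhd x b != nbhd y b.
  by apply: contraNneq yvb => E; rewrite adj_sym -in_nbhd -E in_nbhd adj_sym.
have nee : nbhd x e != nbhd y e.
  by apply: contraNneq xve => E; rewrite adj_sym -in_nbhd E in_nbhd adj_sym.
have [exb|] := boolP (exceptional (nbhds f b) (nbhd x b) (nbhd y b)); last by exists b.
have [exe|] := boolP (exceptional (nbhds f e) (nbhd x e) (nbhd y e)); last by exists e.
have [b1 [w1 [[xb1 xw1 yE1] [fb1 fw1 lev1]]]] := exceptional_level_graphs xF exb.
have [b2 [w2 [[xb2 xw2 yE2] [fb2 fw2 lev2]]]] := exceptional_level_graphs xF exe.
have yw1 : adj y b w1 by rewrite -in_nbhd yE1 !inE eqxx.
have w1e : w1 = e.
  have := lev w1; rewrite fw1 fb => /(_ erefl) /or3P[/eqP h|/eqP h|/eqP//].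
    by move: xw1; rewrite h adj_sym xvb.
  by move: yw1; rewrite h adj_irr.
have w2v : w2 = v.
  have : v \in nbhd y e by rewrite in_nbhd adj_sym.
  rewrite yE2 inE in_set1 => /orP[/eqP->//|]; rewrite in_setD1 => /andP[_].
  by rewrite in_nbhd adj_sym (negPf xve).
have : b \in nbhd y e by rewrite in_nbhd adj_sym -w1e.
rewrite yE2 w2v inE in_set1 => /orP[/eqP bv|].
  by move: xvb; rewrite bv adj_irr.
by rewrite in_setD1 in_nbhd adj_sym -w1e (negPf xw1) andbF.
Qed.

End DegreeOrder.

(** * Private neighbours *)

Section PrivateNeighbours.
Variable V : finType.
Implicit Types (r : rel V) (a b c e s u v w : V) (A B : {set V}).

Definition privateb r a b w := [&& r b w, w != a & ~~ r a w].

(** Complementation exchanges the neighbours of v with its non-neighbours, so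
    that only swaps among the latter have to be discussed. *)
Definition coadj r x y := (x != y) && ~~ r x y.

Lemma privateb_coadj r a b w : irreflexive r -> privateb (coadj r) b a w = privateb r a b w.
Proof.
move=> irr; rewrite /privateb /coadj !negb_and !negbK (eq_sym a w) (eq_sym b w).
have [->|wb] := eqVneq w b; rewrite ?andbF ?irr //=.
by case: (r b w); case: (w == a); case: (r a w).
Qed.

(** u can exchange s for c in two ways, as c can hand over w1 or w2 to s. *)
Definition fork r u s c w1 w2 :=
  [/\ r u s, u != c, ~~ r u c & [/\ w1 != w2, privateb r s c w1 & privateb r s c w2]].

Lemma fork_coadj r u s c w1 w2 : symmetric r -> irreflexive r ->
  fork (coadj r) u c s w1 w2 -> fork r u s c w1 w2.
Proof.
move=> sym irr [/andP[uc nuc] us nus [ne p1 p2]].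
have us' : r u s by move: nus; rewrite /coadj us negbK.
by split=> //; split=> //; rewrite -privateb_coadj.
Qed.

(** A and B are the sides of the level of a rigid vertex v, and H1, H2 say
    that each exchange of a in A for b in B is possible in one way only. In
    the first case swapping b and b' is a switch. In the third one the edges
    ec and bb' are alone on their four vertices and can be switched in two
    ways without touching v; in the fourth one b and b' are interchangeable
    twins and nothing else is in the level. If b and b' have the same vertex
    to hand over to a, there is a fork at a; otherwise the private neighbours
    of b and b' against each other are determined up to a, and counting leaves
    one or none. *)
Lemma twin_cases r A B v a b b' : symmetric r -> irreflexive r ->
  v \notin A -> v \notin B -> [disjoint A & B] ->
  (forall a b, a \in A -> b \in B -> privateb r b a =1 pred1 v) ->
  (forall a b, a \in A -> b \in B -> exists c, privateb r a b =1 pred1 c) ->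
  #|privateb r b' b| = #|privateb r b b'| -> a \in A -> b \in B -> b' \in B -> b != b' ->
  [\/ #|privateb r b' b| = 1,
      exists u s c w1 w2, u \in A :|: B /\ fork r u s c w1 w2,
      exists e c, [/\ r e c, r b b', e != v, c != v & (b != v) && (b' != v)] /\
                  [/\ ~~ r e b, ~~ r e b', ~~ r c b & ~~ r c b'] |
      [/\ privateb r b' b =1 pred0, privateb r b b' =1 pred0, A = [set a] & B = [set b; b']]].
Proof.
move=> sym irr vA vB dAB H1 H2 cD aA bB b'B bb.
have AB x y : x \in A -> y \in B -> x != y.
  move=> xA; apply: contraTneq => <-; move/pred0P/(_ x): dAB; rewrite /= xA /=.
  by move->.
have [c Hc] := H2 a b aA bB; have [c' Hc'] := H2 a b' aA b'B.
have av x : x \in A -> r x v.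
  by move=> xA; have := H1 x b xA bB v; rewrite /= eqxx => /and3P[].
have bv x : x \in B -> ~~ r x v.
  by move=> xB; have := H1 a x aA xB v; rewrite /= eqxx => /and3P[].
have Bv x : x \in B -> x != v by move=> xB; apply: contraNneq vB => <-.
have Av x : x \in A -> x != v by move=> xA; apply: contraNneq vA => <-.
have pnc : privateb r a b c by rewrite Hc /= eqxx.
have pnc' : privateb r a b' c' by rewrite Hc' /= eqxx.
rewrite /privateb in pnc pnc'.
have /and3P[rbc ca nac] := pnc.
have /and3P[rb'c' c'a nac'] := pnc'.
have [cc|cc] := eqVneq c c'.
  apply: Or42; exists a, v, c, b, b'; split; first by rewrite inE aA.
  split; [exact: av|by rewrite eq_sym|by []|].
  split; [exact: bb|rewrite /privateb; apply/and3P; split..].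
  - by rewrite sym.
  - exact: Bv.
  - by rewrite sym bv.
  - by rewrite cc sym.
  - exact: Bv.
  - by rewrite sym bv.
have sub x y d : x \in B -> y \in B -> privateb r a x =1 pred1 d ->
    forall w, privateb r y x w -> w = d \/ w = a.
  move=> xB yB Hd w /and3P[rxw wy nyw]; have [->|wa] := eqVneq w a; [by right|left].
  have [raw|naw] := boolP (r a w).
    have : privateb r y a w by rewrite /privateb raw wy.
    by rewrite H1 //= => /eqP wv; move: (bv x xB); rewrite -wv rxw.
  by apply/eqP; rewrite -[_ == _]/(pred1 d w) -Hd /privateb rxw wa.
have subD := sub b b' c bB b'B Hc; have subD' := sub b' b c' b'B bB Hc'.
have inD : c != b' -> privateb r b' b c.
  move=> cb'; rewrite /privateb rbc cb' /=; apply: contra cc => rb'c.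
  by rewrite -[_ == _]/(pred1 c' c) -Hc' /privateb rb'c ca.
have inD' : c' != b -> privateb r b b' c'.
  move=> cb; rewrite /privateb rb'c' cb /=; apply: contra cc => rbc'.
  by rewrite eq_sym -[_ == _]/(pred1 c c') -Hc /privateb rbc' c'a.
have notboth : ~~ (privateb r b' b a && privateb r b b' a).
  by apply/negP=> /andP[/and3P[_ _ /negP h] /and3P[h' _ _]].
have [D1|D1] := eqVneq #|privateb r b' b| 1; first exact: Or41.
have D0 : #|privateb r b' b| = 0.
  apply/eqP; rewrite -leqn0 -ltnS; rewrite ltn_neqAle D1 /= leqNgt.
  apply/negP=> gt1; have full x y d : (forall w, privateb r y x w -> w = d \/ w = a) ->
      1 < #|privateb r y x| -> privateb r y x a.
    move=> s /card_gt1P[w1 [w2 [p1 p2 ne]]]; case: (s _ p1) => [e1|<-] //.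
    case: (s _ p2) => [e2|<-] //; by rewrite e1 e2 eqxx in ne.
  case/negP: notboth; rewrite (full _ _ _ subD gt1).
  by rewrite cD in gt1; rewrite (full _ _ _ subD' gt1).
have De : privateb r b' b =1 pred0 by move=> w; apply: (card0_eq D0).
have De' : privateb r b b' =1 pred0 by rewrite cD in D0; move=> w; apply: (card0_eq D0).
have cb : c = b' by apply/eqP; apply: contraT => /inD; rewrite De.
have c'b : c' = b by apply/eqP; apply: contraT => /inD'; rewrite De'.
rewrite cb in rbc nac Hc; rewrite c'b in nac' Hc'.
have bTb' w : w != b' -> r b w -> r b' w.
  by move=> wb' rbw; apply: contraFT (De w) => n; rewrite /privateb rbw wb'.
have b'Tb w : w != b -> r b' w -> r b w.
  by move=> wb rbw; apply: contraFT (De' w) => n; rewrite /privateb rbw wb.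
have [/exists_inP[e eB /andP[eb eb']]|nB] :=
    boolP [exists e in B, (e != b) && (e != b')].
  have [ce Hce] := H2 a e aA eB.
  have [rece cea nace] : [/\ r e ce, ce != a & ~~ r a ce].
    by apply/and3P; rewrite -/(privateb r a e ce) Hce /= eqxx.
  have ea : e != a by rewrite eq_sym AB.
  have neb : ~~ r e b.
    apply/negP=> reb; have [rae|nae] := boolP (r a e); last first.
      by case/eqP: eb'; apply/eqP; rewrite -[_ == _]/(pred1 b' e) -Hc /privateb sym reb ea.
    have reb' : r e b' by rewrite sym bTb' // sym.
    have e1 : pred1 ce b by rewrite -Hce /privateb reb nac' eq_sym AB.
    have e2 : pred1 ce b' by rewrite -Hce /privateb reb' nac eq_sym AB.
    by case/eqP: bb; rewrite (eqP e1) (eqP e2).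
  have neb' : ~~ r e b'.
    by apply: contra neb => reb'; rewrite sym b'Tb // sym.
  have ceb : ce != b by apply: contraNneq neb => <-.
  have ceb' : ce != b' by apply: contraNneq neb' => <-.
  have nceb : ~~ r ce b.
    apply: contra ceb' => h; rewrite -[_ == _]/(pred1 b' ce) -Hc /privateb sym h cea //.
  apply: Or43; exists e, ce; split; split=> //.
  - exact: Bv.
  - by apply: contraTneq rece => ->; apply: bv.
  - by rewrite !Bv.
  - by apply: contra nceb => h; rewrite sym b'Tb // sym.
have [/exists_inP[a' a'A a'a]|nA] := boolP [exists a' in A, a' != a].
  have [ra'b|na'b] := boolP (r a' b).
    have raa' : r a a'.
      apply: contraT => naa'; have : pred1 b' a'.
        by rewrite -Hc /privateb sym ra'b a'a.
      by rewrite /= (negPf (AB _ _ a'A b'B)).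
    have : pred1 v a by rewrite -(H1 a' b) // /privateb sym raa' AB // sym nac'.
    by rewrite /= (negPf (Av _ aA)).
  have na'b' : ~~ r a' b'.
    by apply: contra na'b => h; rewrite sym b'Tb // 1?sym // AB.
  apply: Or42; exists b, b', v, a, a'; split; first by rewrite inE bB orbT.
  split; [by []|exact: Bv|exact: bv|split; first by rewrite eq_sym].
    by rewrite /privateb sym av // AB //= sym nac.
  by rewrite /privateb sym av // AB //= sym na'b'.
apply: Or44; split=> //; apply/eqP; rewrite eqEsubset.
  rewrite sub1set aA andbT; apply/subsetP=> x xA; rewrite inE.
  by apply: contraT => xa; case/exists_inP: nA; exists x.
rewrite subUset !sub1set bB b'B !andbT; apply/subsetP=> x xB; rewrite !inE.
apply: contraT; rewrite negb_or => xbb; case/exists_inP: nB; exists x => //.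
Qed.

End PrivateNeighbours.

(** * Colourings from signs of permutations *)

Section PermFacts.
Variable V : finType.
Implicit Types (S L : {set V}) (s t : {perm V}).

Lemma tperm_inL L a b : a \in L -> b \in L -> perm_on L (tperm a b).
Proof.
move=> aL bL; apply: subset_trans (tperm_on a b) _.
by rewrite subUset !sub1set aL.
Qed.

(** The two sets are matched by transpositions of their differences. *)
Lemma perm_to S S0 L : S :\: L = S0 :\: L -> #|S| = #|S0| ->
  exists s, perm_on L s /\ s @: S = S0.
Proof.
move: {2}#|_| (leqnn #|S :\: S0|) => n; elim: n S => [|n IH] S le SL cS.
  exists 1%g; split; first exact: perm_on1.
  rewrite (eq_imset (g := id)) ?imset_id; last by move=> x; rewrite perm1.
  apply/eqP; rewrite eqEcard cS leqnn andbT -setD_eq0 -cards_eq0.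
  by move: le; rewrite leqn0.
have [SS0|[a]] := set_0Vmem (S :\: S0); first by apply: IH; rewrite // SS0 cards0.
rewrite inE => /andP[aS0 aS].
have [b] : exists b, b \in S0 :\: S.
  apply/set0Pn; rewrite setD_eq0; apply/negP=> sub; case/negP: aS0.
  suff -> : S0 = S by []. by apply/eqP; rewrite eqEcard sub cS leqnn.
rewrite inE => /andP[bS bS0].
have aL : a \in L.
  apply: contraR aS0 => aL; have /setP/(_ a) := SL; rewrite !inE aL aS /=.
  by move=> <-.
have bL : b \in L.
  apply: contraR bS => bL; have /setP/(_ b) := SL; rewrite !inE bL bS0 /=.
  by move->.
have [||| s [sL sS]] := IH (exch S a b).
- have : exch S a b :\: S0 \proper S :\: S0.
    apply/properP; split.
      apply/subsetP=> x; rewrite !inE => /andP[xS0 /orP[/eqP xb|/andP[_ ->]]].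
        by rewrite xb bS0 in xS0.
      by rewrite xS0.
    exists a; rewrite !inE ?aS ?aS0 ?eqxx //= orbF.
    by apply: contraNneq bS => <-.
  by move/proper_card => h; rewrite -ltnS (leq_trans h).
- rewrite -SL; apply/setP=> x; rewrite !inE; have [xL|xL] //= := boolP (x \in L).
  have [xb|xb] := eqVneq x b; first by rewrite xb bL in xL.
  by have [xa|//] := eqVneq x a; rewrite xa aL in xL.
- by rewrite card_exch.
exists (tperm a b * s)%g; split.
  by apply: perm_onM => //; apply: tperm_inL.
rewrite -sS -(imset_tperm aS bS) -imset_comp; apply: eq_imset => x /=.
by rewrite permM.
Qed.

End PermFacts.

Section SignColouring.
Variables (V : finType) (f : V -> nat) (v : V) (L S0 : {set V}) (lam : nat).
Hypothesis fL : forall u, u \in L -> f u = lam.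
Hypothesis vL : v \notin L.
Implicit Types (E : {set {set V}}) (s t : {perm V}) (S : {set V}).

Local Notation nbhd_class := (nbhd_class f v).

Lemma f_perm_on s u : perm_on L s -> f (s u) = f u.
Proof.
move=> sL; have [uL|uL] := boolP (u \in L); last by rewrite (out_perm sL uL).
by rewrite !fL // perm_closed.
Qed.

Lemma relabel_class s S E : perm_on L s -> E \in nbhd_class S -> relabel s E \in nbhd_class (s @: S).
Proof.
move=> sL /nbhd_classP[EF ES]; apply/nbhd_classP; split.
  by apply: graphs_relabel => // u; apply: f_perm_on.
by rewrite nbhd_relabel_fix ?ES // (out_perm sL vL).
Qed.

Variable chi : {set {set V}} -> bool.
Hypothesis chiP : proper_col (@switch_adj V) chi (nbhd_class S0).
Hypothesis flip : forall E b b', E \in nbhd_class S0 -> b \in L -> b' \in L -> b != b' ->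
  (b \in S0) = (b' \in S0) -> switch_adj E (relabel (tperm b b') E).

(** A permutation of L preserving S0 is a product of transpositions preserving
    S0, and each of these is a switch inside the class, by flip, and so
    changes the colour. *)
Lemma stab_sign s E : perm_on L s -> s @: S0 = S0 -> E \in nbhd_class S0 ->
  chi (relabel s E) = chi E (+) s.
Proof.
move: {2}#|_| (leqnn #|[set x | s x != x]|) => n; elim: n s => [|n IH] s.
  rewrite leqn0 cards_eq0 => /eqP sE _ _ _; suff -> : s = 1%g.
    by rewrite relabel1 odd_perm1 addbF.
  apply/permP=> x; rewrite perm1; have /setP/(_ x) := sE.
  by rewrite !inE => /negbFE/eqP.
move=> le sL sS EC; have [s0|[i]] := set_0Vmem [set x | s x != x].
  by apply: IH; rewrite // s0 cards0.
rewrite inE => si; have iL : i \in L by apply: contraR si => iL; rewrite (out_perm sL iL).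
have jL : s i \in L by rewrite perm_closed.
have ji : s i != i by [].
have sj : s (s i) != s i by rewrite (inj_eq perm_inj).
have side : (s i \in S0) = (i \in S0) by rewrite -{1}sS mem_imset //; apply: perm_inj.
pose t := tperm i (s i); pose s' := (s * t)%g.
have tL : perm_on L t by apply: tperm_inL.
have s's : s = (s' * t)%g by rewrite -mulgA tperm2 mulg1.
have tS : t @: S0 = S0.
  apply/setP=> x; rewrite -[x in LHS](tpermK i (s i)) mem_imset; last exact: perm_inj.
  by case: tpermP => [->|->|].
have s'L : perm_on L s' by apply: perm_onM.
have s'S : s' @: S0 = S0.
  rewrite -[RHS]tS -[in RHS]sS -imset_comp; apply: eq_imset => x /=.
  by rewrite permM.
have le' : #|[set x | s' x != x]| <= n.
  rewrite -ltnS; apply: leq_trans le; apply: proper_card; apply/properP; split.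
    apply/subsetP=> x; rewrite !inE permM; apply: contra => /eqP sx.
    have ix : i != x by apply: contraNneq si => ->; rewrite sx.
    have six : s i != x by apply: contraNneq sj => ->; rewrite sx.
    by rewrite sx tpermD.
  by exists i; rewrite !inE // permM tpermR eqxx.
have E'C : relabel s' E \in nbhd_class S0 by rewrite -s'S; apply: relabel_class.
have E''C : relabel t (relabel s' E) \in nbhd_class S0 by rewrite -tS; apply: relabel_class.
have isi : i != s i by rewrite eq_sym.
have := chiP E'C E''C (flip E'C iL jL isi (esym side)).
have -> : odd_perm s = ~~ odd_perm s' by rewrite s's odd_permM odd_tperm isi addbT.
have -> : relabel s E = relabel t (relabel s' E) by rewrite -relabelM -s's.
rewrite (IH s' le' s'L s'S EC).
by case: (chi E); case: (odd_perm s'); case: (chi _).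
Qed.

Definition norm_perm S := odflt 1%g [pick s : {perm V} | perm_on L s && (s @: S == S0)].
(** The colour of E is read in the class of S0 after renaming, and corrected
    by the sign of the renaming; norm_sign makes the choice of the renaming
    immaterial. *)
Definition sign_col E := chi (relabel (norm_perm (nbhd E v)) E) (+) norm_perm (nbhd E v).

Lemma norm_permP S : S :\: L = S0 :\: L -> #|S| = #|S0| ->
  perm_on L (norm_perm S) /\ norm_perm S @: S = S0.
Proof.
move=> SL cS; rewrite /norm_perm; case: pickP => [s /andP[h /eqP]|h] //.
by have [s [sL sS]] := perm_to SL cS; have := h s; rewrite sL sS eqxx.
Qed.

Lemma norm_sign S s t E : perm_on L s -> s @: S = S0 -> perm_on L t -> t @: S = S0 ->
  E \in nbhd_class S -> chi (relabel s E) (+) s = chi (relabel t E) (+) t.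
Proof.
move=> sL sS tL tS EC; have EsC : relabel s E \in nbhd_class S0 by rewrite -sS; apply: relabel_class.
have uL : perm_on L (s^-1 * t)%g by apply: perm_onM => //; apply: perm_onV.
have uS : (s^-1 * t)%g @: S0 = S0.
  rewrite -{1}sS -imset_comp -[RHS]tS; apply: eq_imset => x /=.
  by rewrite permM permK.
have := stab_sign uL uS EsC; rewrite -relabelM mulgA mulgV mul1g => ->.
by rewrite odd_permM odd_permV; case: (chi _); case: (s : bool); case: (t : bool).
Qed.

(** Inside a class the same renaming serves both graphs. Between classes a
    switch is the swap of two names, which changes the sign. *)
Lemma sign_col_proper :
  (forall S, S \in nbhds f v -> S :\: L = S0 :\: L) -> S0 \in nbhds f v ->
  (forall E a b c, E \in graphs f -> switchable E v a b c -> a \in L -> b \in L ->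
     switch E v a b c = relabel (tperm a b) E) ->
  (forall E a b c, E \in graphs f -> switchable E v a b c -> a \in L /\ b \in L) ->
  proper_col (@switch_adj V) sign_col (graphs f).
Proof.
move=> SL S0F swE swL E E' EF E'F adjE.
have nP E1 : E1 \in graphs f -> perm_on L (norm_perm (nbhd E1 v)) /\
    norm_perm (nbhd E1 v) @: nbhd E1 v = S0.
  move=> E1F; have h : nbhd E1 v \in nbhds f v by apply: imset_f.
  by apply: norm_permP; [apply: SL|rewrite (nbhds_card h) (nbhds_card S0F)].
have [sL sS] := nP E EF; have [s'L s'S] := nP E' E'F.
have [ES|ES] := eqVneq (nbhd E v) (nbhd E' v).
  rewrite /sign_col -ES; apply: contraTneq adjE => h.
  have EC : relabel (norm_perm (nbhd E v)) E \in nbhd_class S0.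
    by rewrite -sS; apply: relabel_class => //; apply/nbhd_classP.
  have E'C : relabel (norm_perm (nbhd E v)) E' \in nbhd_class S0.
    by rewrite -sS; apply: relabel_class => //; apply/nbhd_classP.
  apply/negP=> adjE; have := chiP EC E'C; rewrite switch_adj_relabel => /(_ adjE).
  by move/eqP: h; rewrite (inj_eq (can_inj (addbK _))) => ->.
have [a [b [c [swabc E'E]]]] := switch_adj_at EF E'F adjE ES.
have [aL bL] := swL _ _ _ _ EF swabc.
have E'R : E' = relabel (tperm a b) E by rewrite E'E swE.
have /switchableP[[va _ vb _] _] := swabc; rewrite -!in_nbhd in va vb.
have nb' : nbhd E' v = exch (nbhd E v) a b by rewrite E'E nbhd_switch_v // (graphs_simple EF).
set s := norm_perm (nbhd E v) in sL sS; set s' := norm_perm (nbhd E' v) in s'L s'S.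
have tsL : perm_on L (tperm a b * s)%g by apply: perm_onM => //; apply: tperm_inL.
have tsS : (tperm a b * s)%g @: nbhd E' v = S0.
  rewrite nb' -(imset_tperm va vb) -imset_comp -[RHS]sS; apply: eq_imset => x /=.
  by rewrite permM tpermK.
have E'C : E' \in nbhd_class (nbhd E' v) by apply/nbhd_classP.
have ab : a != b by apply: contraNneq vb => <-.
rewrite /sign_col (norm_sign s'L s'S tsL tsS E'C) E'R relabelM relabel_tpermK.
rewrite odd_mul_tperm ab -/s.
by case: (chi _); case: (s : bool).
Qed.

End SignColouring.

(** * Rigid vertices *)

Section Triangles.
Variable V : finType.
Implicit Types (E : {set {set V}}) (a b c e u v w x y : V).

Lemma bipartite_on_no_triangle (C : {set {set {set V}}}) E1 E2 E3 : bipartite_on (@switch_adj V) C ->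
  E1 \in C -> E2 \in C -> E3 \in C -> switch_adj E1 E2 -> switch_adj E1 E3 -> switch_adj E2 E3 -> False.
Proof.
move=> /bipartite_onP[c cP] h1 h2 h3 n12 n13 n23.
have := cP _ _ h1 h2 n12; have := cP _ _ h1 h3 n13; have := cP _ _ h2 h3 n23.
by case: (c E1); case: (c E2); case: (c E3).
Qed.

(** Two of the three perfect matchings on four vertices always differ by a
    switch. *)
Lemma matching_adj E e c b b' : simple_edges E ->
  switchable E e c b b' -> switchable E e c b' b ->
  switch_adj (switch E e c b b') (switch E e c b' b).
Proof.
move=> sE s1 s2; have [[ec eb eb'] [cb cb' bb']] := switch_neq sE s1.
move: (s1) (s2) => /switchableP[[aec abb neb ncb'] _] /switchableP[[_ _ neb' ncb] _].
have s3 : switchable (switch E e c b b') e b b' c.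
  apply/switchableP; split; last by rewrite [b == c]eq_sym.
  rewrite -!in_nbhd nbhd_switch_v // nbhd_switch_c // nbhd_switch_b // !exch_in.
  rewrite !inE (negPf neb') [b' == b]eq_sym (negPf bb') [c == e]eq_sym (negPf ec).
  by rewrite [adj E b c]adj_sym (negPf ncb) !andbF.
suff -> : switch E e c b' b = switch (switch E e c b b') e b b' c.
  by apply: switch_adj_switch => //; apply: simple_switch.
have d1 : ([set e; b] == [set c; b']) = false by rewrite eq_set2 (negPf ec) (negPf eb').
apply/setP=> z; rewrite !inE (setUC [set b'] [set b]) (setUC [set b'] [set c]).
rewrite (setUC [set b] [set c]).
have [->|n1] := eqVneq z [set e; b'].
  by rewrite !orbT.
have [->|n2] := eqVneq z [set c; b]; first by rewrite !orbT.
have [->|n3] := eqVneq z [set e; b].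
  by rewrite [_ \in E](negPf neb) !andbF.
have [->|n4] := eqVneq z [set c; b'].
  by rewrite [_ \in E](negPf ncb') !andbF.
by rewrite !orbF.
Qed.

(** Two of the three four-cycles on four vertices always differ by a switch.
    *)
Lemma cycle_adj E e c b b' : simple_edges E ->
  switchable E e b c b' -> switchable E e b' c b ->
  switch_adj (switch E e b c b') (switch E e b' c b).
Proof.
move=> sE s1 s2; have [[eb ec eb'] [bc bb' cb']] := switch_neq sE s1.
move: (s1) (s2) => /switchableP[[aeb acb' nec nbb'] _] /switchableP[[aeb' acb _ _] _].
have s3 : switchable (switch E e b c b') e b' b c.
  apply/switchableP; split; last by rewrite [b' == c]eq_sym.
  rewrite -!in_nbhd nbhd_switch_v // nbhd_switch_a // nbhd_switch_c //.
  rewrite !inE aeb' [b' == b]eq_sym bb' !eqxx [c == e]eq_sym ec [adj E b c]adj_sym acb.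
  by rewrite (negPf bc) [c == b]eq_sym (negPf bc) !orbT.
suff -> : switch E e b' c b = switch (switch E e b c b') e b' b c.
  by apply: switch_adj_switch => //; apply: simple_switch.
apply/setP=> z; rewrite !inE (setUC [set b'] [set b]) (setUC [set b'] [set c]).
rewrite (setUC [set b] [set c]).
have [->|n1] := eqVneq z [set e; b].
  have -> : [set e; b] \in E := aeb.
  by rewrite !eq_set2 eqxx (negPf bb') (negPf eb') (negPf ec) (negPf eb) /= ?andbF ?orbT.
have [->|n2] := eqVneq z [set c; b'].
  have -> : [set c; b'] \in E := acb'.
  rewrite !eq_set2 eqxx [c == e]eq_sym (negPf ec) [b' == b]eq_sym (negPf bb').
  rewrite (negPf cb') [c == b]eq_sym (negPf bc).
  by rewrite /= !andbF !orbT.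
have [->|n3] := eqVneq z [set e; c].
  by rewrite !eq_set2 eqxx (negPf cb') (negPf eb') (negPf ec) (negPf eb) /= ?andbF ?orbT.
have [->|n4] := eqVneq z [set b; b'].
  rewrite !eq_set2 [b == e]eq_sym (negPf eb) (negPf bb') (negPf bc).
  by rewrite [b' == c]eq_sym (negPf cb') /= ?andbF ?orbT.
by rewrite ?orbF; case: (_ == _); case: (_ == _); case: (z \in E).
Qed.

Lemma switch_class_other f v S E a b c d : E \in nbhd_class f v S -> switchable E a b c d ->
  a != v -> b != v -> c != v -> d != v -> switch E a b c d \in nbhd_class f v S.
Proof.
move=> /nbhd_classP[EF ES] s av bv cv dv; apply/nbhd_classP; split; first exact: graphs_switch.
rewrite nbhd_switch_other ?(graphs_simple EF) //.
by rewrite !inE !negb_or ![v == _]eq_sym av bv cv dv.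
Qed.

Lemma privateb_private E a b : privateb (adj E) a b =1 mem (private E a b).
Proof. by move=> w; rewrite /= in_setD in_setU1 !in_nbhd negb_or /privateb andbC. Qed.

Lemma card_privateb E a b : #|privateb (adj E) a b| = #|private E a b|.
Proof. by apply: eq_card => w; rewrite -topredE /= privateb_private. Qed.

Lemma privateb_pred1 E a b d : private E a b = [set d] -> privateb (adj E) a b =1 pred1 d.
Proof. by move=> h w; rewrite privateb_private /= h inE. Qed.

Lemma relabel_twin E a b : simple_edges E -> private E a b = set0 -> private E b a = set0 ->
  relabel (tperm a b) E = E.
Proof.
move=> sE d1 d2.
have h y : y != a -> y != b -> adj E a y = adj E b y.
  move=> ya yb; have /setP/(_ y) := d1; have /setP/(_ y) := d2.
  rewrite !inE (negPf ya) (negPf yb) /=.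
  by case: (adj E a y); case: (adj E b y).
have tD y : y != a -> y != b -> tperm a b y = y by move=> *; rewrite tpermD // eq_sym.
apply: graph_ext => //; first exact: simple_relabel.
move=> x y; rewrite -[x in LHS](tpermK a b) -[y in LHS](tpermK a b) adj_relabel.
case: tpermP => [->|->|/eqP xa /eqP xb].
- case: tpermP => [->|->|/eqP ya /eqP yb] xy; first by rewrite eqxx in xy.
    exact: adj_sym.
  by rewrite h.
- case: tpermP => [->|->|/eqP ya /eqP yb] xy; last by rewrite h.
    exact: adj_sym.
  by rewrite eqxx in xy.
case: tpermP => [->|->|//] xy; first by rewrite adj_sym -h // adj_sym.
by rewrite adj_sym h // adj_sym.
Qed.

End Triangles.

Section Rigid.
Variables (V : finType) (f : V -> nat).
Implicit Types (E : {set {set V}}) (a b c e u v w x y : V) (S R L : {set V}).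

(** A private neighbour w of a other than v would give, together with two
    vertices handed over by b, three pairwise adjacent graphs in one class,
    which is bipartite. *)
Lemma rigid_pair v E a b : rigid f v -> E \in graphs f -> a \in nbhd E v -> b \notin nbhd E v ->
  b != v -> f a <= f b ->
  [/\ f a = f b, private E b a = [set v] & exists c, private E a b = [set c]].
Proof.
move=> rg EF aE bE bv le; have sE := graphs_simple EF.
have ES : nbhd E v \in nbhds f v by apply: imset_f.
have [bi _ eqf] := rg _ ES.
have fab : f a = f b by apply: eqf => //; apply: nbhds_up.
have vd := v_in_private EF aE bE bv.
have cE : #|private E a b| = #|private E b a| by have := graphs_card_private a b EF; rewrite fab => /addIn.
have le1 : #|private E b a| <= 1.
  rewrite leqNgt; apply/negP=> gt1.
  have [w wd wv] : exists2 w, w \in private E b a & w != v.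
    move: gt1 => /card_gt1P[w1 [w2 [d1 d2 ne]]].
    by have [e1|] := eqVneq w1 v; [exists w2; rewrite // -e1 eq_sym|exists w1].
  rewrite -cE in gt1; have /card_gt1P[c1 [c2 [d1 d2 ne]]] := gt1.
  have [n1 n2 n3] := private_triangle sE wd d1 d2 ne.
  have EC : E \in nbhd_class f v (nbhd E v) by apply/nbhd_classP.
  have av : a != v by apply: contraTneq aE => ->; rewrite in_nbhd adj_irr.
  have dv c : c \in private E a b -> c != v.
    rewrite in_setD => /andP[_]; apply: contraTneq => ->.
    by rewrite nbhd_memC.
  have s1 : switchable E w a b c1 by rewrite switchable_private wd.
  have s2 : switchable E w a b c2 by rewrite switchable_private wd.
  by apply: (bipartite_on_no_triangle bi EC (switch_class_other EC s1 _ _ _ _)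
    (switch_class_other EC s2 _ _ _ _) n1 n2 n3) => //; apply: dv.
have dba : private E b a = [set v].
  by apply/eqP; rewrite eq_sym eqEcard sub1set vd cards1.
split=> //; apply/cards1P; by rewrite cE dba cards1.
Qed.

(** The two ways of exchanging s for c contradict rigid_pair. *)
Lemma rigid_fork u E s c w1 w2 : rigid f u -> E \in graphs f ->
  fork (adj E) u s c w1 w2 -> False.
Proof.
move=> rg EF [us uc nuc [ne p1 p2]].
have EC : E \in nbhd_class f u (nbhd E u) by apply/nbhd_classP.
have sE : s \in nbhd E u by rewrite in_nbhd.
have cE : c \notin nbhd E u by rewrite in_nbhd.
have cu : c != u by rewrite eq_sym.
have d1 : w1 \in private E s c by rewrite -[_ \in _]/(mem (private E s c) w1) -privateb_private.
have d2 : w2 \in private E s c by rewrite -[_ \in _]/(mem (private E s c) w2) -privateb_private.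
have [_ /nbhd_class_nbhds switch] := switch_class EC sE cE cu d1.
have [_ _ eqf] := rg _ (nbhd_class_nbhds EC).
have fsc := eqf _ _ sE cE switch.
have [_ _ [d dE]] := rigid_pair rg EF sE cE cu (eq_leq fsc).
by move: d1 d2 ne; rewrite dE !inE => /eqP-> /eqP->; rewrite eqxx.
Qed.

Section Level.
Variables (v : V) (S0 : {set V}) (a0 b0 : V).
Hypotheses (rg : rigid f v) (S0F : S0 \in nbhds f v).
Hypotheses (a0S : a0 \in S0) (b0S : b0 \notin S0) (b0v : b0 != v) (f0 : f a0 = f b0).

(** The vertices that can take part in an exchange at the rigid vertex v; all
    have the degree of a0 and b0 (level_swap). *)
Definition level := [set u | (u != v) && (f u == f a0)].

Lemma rigid_top S a b : S \in nbhds f v -> a \in S -> b \notin S -> b != v -> f b <= f a.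
Proof.
move=> SF aS bS bv; rewrite leqNgt; apply/negP=> lt.
have [_ _ eqf] := rg SF.
by have := eqf _ _ aS bS (nbhds_up SF aS bS bv (ltnW lt)) => e; rewrite e ltnn in lt.
Qed.

(** A vertex of higher degree is always a neighbour of v and a vertex of lower
    degree never, since otherwise an exchange of unequal degrees would be
    possible. *)
Lemma level_out S : S \in nbhds f v -> S :\: level = S0 :\: level.
Proof.
move=> SF; apply/setP=> u; rewrite !in_setD inE.
have [->|uv] := eqVneq u v; first by rewrite (negPf (nbhds_v SF)) (negPf (nbhds_v S0F)).
case: (ltngtP (f u) (f a0)) => //= lt.
  have uS0 : u \notin S0.
    by apply/negP=> uS0; have := rigid_top S0F uS0 b0S b0v; rewrite -f0 leqNgt lt.
  rewrite (negPf uS0); apply/negbTE/negP=> uS; case/negP: uS0.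
  suff -> : S0 = S by [].
  apply/eqP; rewrite eqEcard (nbhds_card SF) (nbhds_card S0F) leqnn andbT.
  apply/subsetP=> w wS0; apply: contraT => wS.
  have wv : w != v by apply: contraTneq wS0 => ->; apply: (nbhds_v S0F).
  have := leq_trans (rigid_top S0F wS0 b0S b0v) (rigid_top SF uS wS wv).
  by rewrite -f0 leqNgt lt.
have uS0 : u \in S0.
  by apply: contraT => uS0; have := rigid_top S0F a0S uS0 uv; rewrite leqNgt lt.
rewrite uS0; apply: contraT => uS; case/negP: (uS).
suff -> : S = S0 by [].
apply/eqP; rewrite eqEcard (nbhds_card SF) (nbhds_card S0F) leqnn andbT.
apply/subsetP=> w wS; apply: contraT => wS0.
have wv : w != v by apply: contraTneq wS => ->; apply: (nbhds_v SF).
have := leq_trans (rigid_top SF wS uS uv) (rigid_top S0F a0S wS0 wv).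
by rewrite leqNgt lt.
Qed.

Lemma levelP u : reflect (u != v /\ f u = f a0) (u \in level).
Proof. by rewrite inE; apply: (iffP andP) => -[h /eqP]. Qed.

Lemma level_swap S a b : S \in nbhds f v -> exch S a b \in nbhds f v -> a \in S -> b \notin S ->
  a \in level /\ b \in level.
Proof.
move=> SF S'F aS bS; have E : S :\: level = exch S a b :\: level.
  by rewrite !level_out.
split; apply: contraT => h.
  have /setP/(_ a) := E; rewrite !in_setD h aS /= => /esym.
  by rewrite (negPf (exch_out aS bS)).
have /setP/(_ b) := E; rewrite !in_setD h exch_in /= => bS'.
by rewrite bS' in bS.
Qed.

Lemma level_meet S : S \in nbhds f v -> exists a b,
  [/\ a \in level, a \in S, b \in level & b \notin S].
Proof.
move=> SF; have out := level_out SF.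
have cI : #|S :&: level| = #|S0 :&: level|.
  have h1 := cardsID level S; have h2 := cardsID level S0.
  by move: h1; rewrite out (nbhds_card SF) -(nbhds_card S0F) -h2 => /addIn.
have a0L : a0 \in level.
  by apply/levelP; split=> //; apply: contraTneq a0S => ->; apply: (nbhds_v S0F).
have b0L : b0 \in level by apply/levelP.
have cD : #|level :\: S| = #|level :\: S0|.
  have h1 := cardsID S level; have h2 := cardsID S0 level.
  by move: h1; rewrite -h2 setIC cI setIC => /addnI.
have /card_gt0P[a] : 0 < #|S :&: level|.
  by rewrite cI; apply/card_gt0P; exists a0; rewrite inE a0S.
have /card_gt0P[b] : 0 < #|level :\: S|.
  by rewrite cD; apply/card_gt0P; exists b0; rewrite inE b0S.
rewrite !inE => /andP[bS bL] /andP[aS aL]; exists a, b; split=> //; by rewrite inE.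
Qed.

(** twin_cases applied to the graph if b and b' are not neighbours of v, and
    to its complement if they are. Its third case would put three pairwise
    adjacent graphs in one class: the graph itself and two others from the
    matchings, respectively the four-cycles, on the same four vertices. *)
Lemma twins_flip E b b' : E \in graphs f -> b \in level -> b' \in level -> b != b' ->
  (b \in nbhd E v) = (b' \in nbhd E v) -> ~~ switch_adj E (relabel (tperm b b') E) ->
  (exists u s c w1 w2, u \in level /\ fork (adj E) u s c w1 w2) \/
  exists a, [/\ a != b, a != b', level = [set a; b; b'],
    relabel (tperm b b') E = E & (a \in nbhd E v) = (b \notin nbhd E v)].
Proof.
move=> EF bL b'L bb side nflip; have sE := graphs_simple EF.
set S := nbhd E v in side *; have SF : S \in nbhds f v by apply: imset_f.
have [bi _ _] := rg SF; have EC : E \in nbhd_class f v S by apply/nbhd_classP.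
have [a [b1 [aL aS b1L b1S]]] := level_meet SF.
have [[bv fb] [b'v fb']] := (levelP _ bL, levelP _ b'L).
have ffb : f b = f b' by rewrite fb fb'.
have cdn : #|private E b b'| = #|private E b' b| by have := graphs_card_private b b' EF; rewrite ffb => /addIn.
pose A := S :&: level; pose B := level :\: S.
have AB : A :|: B = level by rewrite /A /B setIC setID.
have dAB : [disjoint A & B].
  by apply/pred0P=> x; rewrite /= in_setI in_setD; case: (x \in S); rewrite ?andbF.
have vA : v \notin A by rewrite in_setI (negPf (nbhds_v SF)).
have vL : v \notin level by rewrite inE eqxx.
have vB : v \notin B by rewrite in_setD (negPf vL) andbF.
have H x y : x \in A -> y \in B -> private E y x = [set v] /\ exists c, private E x y = [set c].
  rewrite in_setI in_setD => /andP[xS /levelP[_ fx]] /andP[yS /levelP[yv fy]].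
  by have [|_ h1 h2] := rigid_pair rg EF xS yS yv; rewrite ?fx ?fy.
have H1 x y : x \in A -> y \in B -> privateb (adj E) y x =1 pred1 v.
  by move=> xA yB; apply: privateb_pred1; case: (H x y).
have H2 x y : x \in A -> y \in B -> exists c, privateb (adj E) x y =1 pred1 c.
  by move=> xA yB; have [_ [c /privateb_pred1]] := H x y xA yB; exists c.
have sym : symmetric (adj E) by move=> x y; apply: adj_sym.
have irr : irreflexive (adj E) by move=> x; apply: adj_irr.
have flip1 : #|private E b' b| = 1 -> False.
  move=> h; move/eqP: (h) => /cards1P[d1 h1].
  have /cards1P[d2 h2] : #|private E b b'| == 1 by rewrite cdn h.
  case/negP: nflip; rewrite (relabel_tperm_switch sE h1 h2); apply: switch_adj_switch => //.
  by rewrite switchable_private h1 h2 !set11.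
have twin0 : privateb (adj E) b' b =1 pred0 -> privateb (adj E) b b' =1 pred0 ->
    relabel (tperm b b') E = E.
  move=> h1 h2; apply: relabel_twin => //; apply/setP=> w.
    by have := h2 w; rewrite privateb_private /= => ->; rewrite in_set0.
  by have := h1 w; rewrite privateb_private /= => ->; rewrite in_set0.
have [bS|bS] := boolP (b \in S); last first.
  have b'S : b' \notin S by rewrite -side.
  have aA : a \in A by rewrite in_setI aS.
  have bB : b \in B by rewrite in_setD bS.
  have b'B : b' \in B by rewrite in_setD b'S.
  have cc : #|privateb (adj E) b' b| = #|privateb (adj E) b b'| by rewrite !card_privateb.
  case: (twin_cases sym irr vA vB dAB H1 H2 cc aA bB b'B bb).
  - by rewrite card_privateb => /flip1.
  - by rewrite AB; left.
  - move=> [e [c [[ec bb' ev cv /andP[bv' b'v']] [neb neb' ncb ncb']]]].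
    have eb : e != b by apply: contraNneq neb' => ->.
    have eb' : e != b' by apply: contraNneq neb => ->; rewrite adj_sym.
    have cb : c != b by apply: contraNneq ncb' => ->.
    have cb' : c != b' by apply: contraNneq ncb => ->; rewrite adj_sym.
    have s1 : switchable E e c b b' by apply/switchableP.
    have b'b : adj E b' b by rewrite adj_sym.
    have s2 : switchable E e c b' b by apply/switchableP.
    by case: (bipartite_on_no_triangle bi EC (switch_class_other EC s1 _ _ _ _)
      (switch_class_other EC s2 _ _ _ _) (switch_adj_switch sE s1) (switch_adj_switch sE s2) (matching_adj sE s1 s2)).
  - move=> [h1 h2 AE BE]; right; exists a; split.
    + by apply: contraTneq aS => ->.
    + by apply: contraTneq aS => ->.
    + by rewrite -AB AE BE setUA.
    + exact: twin0.
    + by rewrite aS.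
have b'S : b' \in S by rewrite -side.
have b1B : b1 \in B by rewrite in_setD b1S.
have bA : b \in A by rewrite in_setI bS.
have b'A : b' \in A by rewrite in_setI b'S.
have csym : symmetric (coadj (adj E)) by move=> x y; rewrite /coadj eq_sym sym.
have cirr : irreflexive (coadj (adj E)) by move=> x; rewrite /coadj eqxx.
have dBA : [disjoint B & A] by rewrite disjoint_sym.
have H1' x y : x \in B -> y \in A -> privateb (coadj (adj E)) y x =1 pred1 v.
  by move=> xB yA w; rewrite privateb_coadj // H1.
have H2' x y : x \in B -> y \in A -> exists c, privateb (coadj (adj E)) x y =1 pred1 c.
  by move=> xB yA; have [c h] := H2 y x yA xB; exists c => w; rewrite privateb_coadj.
have cpn x y : #|privateb (coadj (adj E)) x y| = #|private E y x|.
  by rewrite -card_privateb; apply: eq_card => w; rewrite -!topredE /= privateb_coadj.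
have cc : #|privateb (coadj (adj E)) b' b| = #|privateb (coadj (adj E)) b b'| by rewrite !cpn.
case: (twin_cases csym cirr vB vA dBA H1' H2' cc b1B bA b'A bb).
- by rewrite cpn cdn => /flip1.
- move=> [u [s [c [w1 [w2 [uL fk]]]]]]; left; exists u, c, s, w1, w2; split.
    by rewrite -AB setUC.
  exact: fork_coadj.
- move=> [e [c [[/andP[ec nec] /andP[_ nbb'] ev cv /andP[bv' b'v']]]]].
  rewrite /coadj !negb_and !negbK => -[eb eb' cb cb'].
  have ebN : e != b by apply: contraTneq eb' => ->; rewrite negb_or bb nbb'.
  have eb'N : e != b'.
    by apply: contraTneq eb => ->; rewrite negb_or eq_sym bb adj_sym nbb'.
  have cbN : c != b by apply: contraTneq cb' => ->; rewrite negb_or bb nbb'.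
  have cb'N : c != b'.
    by apply: contraTneq cb => ->; rewrite negb_or eq_sym bb adj_sym nbb'.
  rewrite (negPf ebN) in eb; rewrite (negPf eb'N) in eb'.
  rewrite (negPf cbN) in cb; rewrite (negPf cb'N) in cb'.
  have s1 : switchable E e b c b' by apply/switchableP.
  have s2 : switchable E e b' c b.
    by apply/switchableP; rewrite [b' == b]eq_sym [adj E b' b]adj_sym.
  by case: (bipartite_on_no_triangle bi EC (switch_class_other EC s1 _ _ _ _)
    (switch_class_other EC s2 _ _ _ _) (switch_adj_switch sE s1) (switch_adj_switch sE s2) (cycle_adj sE s1 s2)).
- move=> [h1 h2 BE AE]; right; exists b1; split.
  + by apply: contraNneq b1S => ->.
  + by apply: contraNneq b1S => ->.
  + by rewrite -AB AE BE setUC setUA.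
  + by apply: twin0 => w; rewrite -privateb_coadj.
  + by rewrite (negPf b1S).
Qed.

Lemma rigid_swap E a b : E \in graphs f -> a \in level -> b \in level ->
  (a \in nbhd E v) != (b \in nbhd E v) -> switch_adj E (relabel (tperm a b) E).
Proof.
move=> EF; wlog aS : a b / a \in nbhd E v.
  move=> H aL bL; have [aS|aS] := boolP (a \in nbhd E v).
    by move=> bS; apply: H => //; rewrite aS.
  by case bS: (b \in nbhd E v) => // _; rewrite tpermC; apply: H; rewrite ?bS // (negPf aS).
move=> /levelP[av fa] /levelP[bv fb]; rewrite aS => abS.
have bS : b \notin nbhd E v by move: abS; case: (b \in _).
have [|_ h1 [c h2]] := rigid_pair rg EF aS bS bv; first by rewrite fa fb.
rewrite (relabel_tperm_switch (graphs_simple EF) h1 h2); apply: switch_adj_switch; first exact: graphs_simple EF.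
by rewrite switchable_private h1 h2 !set11.
Qed.

(** All hypotheses of sign_col_proper hold: across classes, rigid_pair turns
    every switch into a swap of names. *)
Lemma level_bipartite :
  (forall E b b', E \in graphs f -> b \in level -> b' \in level -> b != b' ->
    (b \in nbhd E v) = (b' \in nbhd E v) -> switch_adj E (relabel (tperm b b') E)) ->
  bipartite_on (@switch_adj V) (graphs f).
Proof.
move=> flip; have [/bipartite_onP[chi chiP] _ _] := rg S0F; apply/bipartite_onP.
have fL u : u \in level -> f u = f a0 by case/levelP.
have vL : v \notin level by rewrite inE eqxx.
have flip0 E b b' : E \in nbhd_class f v S0 -> b \in level -> b' \in level -> b != b' ->
    (b \in S0) = (b' \in S0) -> switch_adj E (relabel (tperm b b') E).
  by move=> /nbhd_classP[EF ES] bL b'L bb side; apply: flip; rewrite ?ES.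
exists (sign_col v level S0 chi).
apply: (sign_col_proper fL vL chiP flip0 level_out S0F) => E a b c EF s.
  move=> aL bL; have [_ fa] := levelP _ aL; have [bv fb] := levelP _ bL.
  have /switchableP[[va _ vb _] _] := s; rewrite -!in_nbhd in va vb.
  have [|_ h1 [d h2]] := rigid_pair rg EF va vb bv; first by rewrite fa fb.
  have cd : c = d.
    by move: s; rewrite switchable_private h2 => /andP[_]; rewrite inE => /eqP.
  by rewrite (relabel_tperm_switch (graphs_simple EF) h1 h2) cd.
have /switchableP[[va _ vb _] [vb' _]] := s; rewrite -!in_nbhd in va vb.
have EC : E \in nbhd_class f v (nbhd E v) by apply/nbhd_classP.
have /andP[_ cd] : (v \in private E b a) && (c \in private E a b) by rewrite -switchable_private.
have bv : b != v by rewrite eq_sym.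
have [_ sC] := switch_class EC va vb bv cd.
exact: level_swap (nbhd_class_nbhds EC) (nbhd_class_nbhds sC) va vb.
Qed.

(** By level_bipartite some swap on one side of the level is not a switch. The
    bound on the level holds because both sides of it are nonempty. *)
Lemma rigid_nonbipartite : ~~ bipartite_on (@switch_adj V) (graphs f) -> 2 < #|level| /\ exists2 E, E \in graphs f &
  (exists u s c w1 w2, u \in level /\ fork (adj E) u s c w1 w2) \/
  exists a b b', b != b' /\ [/\ a != b, a != b', level = [set a; b; b'],
    relabel (tperm b b') E = E & (a \in nbhd E v) = (b \notin nbhd E v)] /\
    (b \in nbhd E v) = (b' \in nbhd E v).
Proof.
pose P E b b' := [&& b != b', (b \in nbhd E v) == (b' \in nbhd E v) &
  ~~ switch_adj E (relabel (tperm b b') E)].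
move=> nbi; have [/exists_inP[E EF]|no] := boolP [exists E in graphs f,
    [exists b in level, [exists b' in level, P E b b']]].
  case/exists_inP=> b bL /exists_inP[b' b'L /and3P[bb /eqP side nf]].
  split.
    have ES : nbhd E v \in nbhds f v by apply: imset_f.
    have [a [d [aL aS dL dS]]] := level_meet ES.
    have [w wL [wb wb']] : exists2 w, w \in level & w != b /\ w != b'.
      have [bS|bS] := boolP (b \in nbhd E v).
        by exists d => //; split; apply: contraNneq dS => ->; rewrite -?side.
      by exists a => //; split; apply: contraTneq aS => ->; rewrite -?side.
    have sub : [set w; b; b'] \subset level by rewrite !subUset !sub1set wL bL b'L.
    have := subset_leq_card sub; rewrite setUC cardsU1 !inE negb_or.
    by rewrite [b' == w]eq_sym wb' [b' == b]eq_sym bb cards2 wb.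
  exists E => //; case: (twins_flip EF bL b'L bb side nf) => [h|[a h]]; first by left.
  by right; exists a, b, b'.
case/negP: nbi; apply: level_bipartite => E b b' EF bL b'L bb side.
apply: contraT => nf; case/negP: no; apply/exists_inP; exists E => //.
apply/exists_inP; exists b => //; apply/exists_inP; exists b' => //.
by rewrite /P bb side eqxx nf.
Qed.

End Level.
End Rigid.

(** * Three interchangeable vertices, and the induction *)

Section ThreeClasses.
Variables (T : finType) (e : rel T) (C1 C2 C3 : {set T}) (t12 t13 t23 : T -> T).
Hypotheses (esym : symmetric e) (eirr : irreflexive e).
Hypotheses (m12 : {mono t12 : x y / e x y}) (m13 : {mono t13 : x y / e x y})
  (m23 : {mono t23 : x y / e x y}).
Hypotheses (K12 : involutive t12) (K13 : involutive t13).
Hypotheses (mh1 : max_ham e C1) (bip1 : bipartite_on e C1) (gt1 : 1 < #|C1|).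
Hypotheses (E2 : C2 = t12 @: C1) (E3 : C3 = t13 @: C1).
Hypotheses (d12 : [disjoint C1 & C2]) (d13 : [disjoint C1 & C3]) (d23 : [disjoint C2 & C3]).
Hypothesis s23 : forall x, x \in C1 -> t23 x \in C1.
Hypotheses (e12 : forall x, x \in C1 -> e x (t12 x))
  (e13 : forall x, x \in C1 -> e x (t13 x))
  (e32 : forall x, x \in C3 -> e x (t23 x)).
Hypothesis comp : forall x, t12 (t23 (t13 x)) = t23 x.
Hypothesis fix23 : exists2 q, q \in C1 & t23 q = q.

(** Let y be the copy in C2 of some y0 in C1. If x and y0 have the same
    colour, C1 and C3 are covered by a zigzag from x to a graph of the other
    colour, and C2 follows. If not, C1, C3 and C2 are traversed in turn. The
    colours fit in C2 because t23 preserves the colouring of C1: it is an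
    automorphism with a fixed point, and colourings are unique up to a global
    change of colour. *)
Lemma three_class x y : x \in C1 -> y \in C2 -> ham_path e (C1 :|: C3 :|: C2) x y.
Proof.
move=> xC yC; have [chi chiP] := bipartite_onP _ _ bip1.
have [y0 y0C yE] : exists2 y0, y0 \in C1 & y = t12 y0 by apply/imsetP; rewrite -E2.
have keep z : z \in C1 -> chi (t23 z) = chi z.
  have [q qC qf] := fix23; have [w wC qw] := mh_reach eirr mh1 qC.
  have chi2 : proper_col e (chi \o t23) C1.
    by move=> u u' uC u'C eu; apply: chiP; rewrite ?s23 ?m23.
  move=> zC; have := colour_rigid chiP chi2 qw zC; rewrite /= qf addbb.
  by case: (chi z); case: (chi (t23 z)).
have [r rC xr] : exists2 r, r \in C1 & chi x != chi r.
  have [r1 [r2 [h1 h2 h12]]] := mh_edge mh1 gt1.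
  have [c1|c1] := eqVneq (chi x) (chi r1); last by exists r1.
  by exists r2; rewrite // c1; apply: chiP.
have hr : ham_path e C1 x r by apply: (mh_lace mh1 chiP).
have map12 u w : ham_path e C1 u w -> ham_path e C2 (t12 u) (t12 w).
  rewrite E2; apply: ham_path_map; last by move=> *; apply: m12.
  by move=> *; apply: (can_inj K12).
have map13 u w : ham_path e C1 u w -> ham_path e C3 (t13 u) (t13 w).
  rewrite E3; apply: ham_path_map; last by move=> *; apply: m13.
  by move=> *; apply: (can_inj K13).
have d132 : [disjoint C1 :|: C3 & C2].
  apply/pred0P=> z /=; rewrite in_setU; apply/negbTE/andP=> -[/orP[z1|z3] z2].
    by move/pred0P/(_ z): d12; rewrite /= z1 z2.
  by move/pred0P/(_ z): d23; rewrite /= z3 z2.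
have [cy|cy] := eqVneq (chi y0) (chi x).
  have ry : ham_path e C1 r y0 by apply: (mh_lace mh1 chiP); rewrite // cy eq_sym.
  rewrite yE; apply: ham_path_cat _ (map12 _ _ ry) (e12 rC) d132.
  case: hr => p [pp lp up mp].
  have sub : {subset x :: p <= C1} by move=> z; rewrite mp.
  have op : odd (size p).
    move: xr; rewrite -lp (path_parity chiP sub pp).
    by case: (chi x); case: (odd _).
  have [||q [qq lq uq mq]] := zigzag K13 m13 _ pp up _ (x := x).
  - by move=> z /sub zC; apply: e13.
  - move=> z /sub zC; rewrite mp; apply: contraTN d13 => tz.
    by apply/pred0Pn; exists (t13 z); rewrite /= tz E3 imset_f.
  exists q; split=> //; first by rewrite lq op.
  move=> z; rewrite mq !mp in_setU E3; congr (_ || _).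
  by rewrite -{2}[z]K13 mem_imset //; apply: can_inj K13.
have xr' := map13 _ _ (ham_path_sym esym hr).
have tx : t13 x \in C3 by rewrite E3 imset_f.
have hy : ham_path e C2 (t23 (t13 x)) y.
  rewrite -[t23 _]K12 comp yE; apply: map12; apply: (mh_lace mh1 chiP) => //.
    exact: s23.
  by rewrite keep // eq_sym.
apply: ham_path_cat _ hy (e32 tx) d132.
exact: ham_path_cat hr xr' (e13 rC) d13.
Qed.

End ThreeClasses.

Section ThreeElementLevel.
Variables (V : finType) (f : V -> nat) (v : V) (S0 : {set V}) (a0 b0 : V).
Hypotheses (mh : forall S, max_ham (@switch_adj V) (nbhd_class f v S)).
Hypotheses (rg : rigid f v) (S0F : S0 \in nbhds f v).
Hypotheses (a0S : a0 \in S0) (b0S : b0 \notin S0) (b0v : b0 != v) (f0 : f a0 = f b0).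
Local Notation L := (level f v a0).
Variables (E0 : {set {set V}}) (a b b' : V).
Hypotheses (E0F : E0 \in graphs f) (bb : b != b') (ab : a != b) (ab' : a != b').
Hypotheses (LE : L = [set a; b; b']) (fixE0 : relabel (tperm b b') E0 = E0).
Hypotheses (sa : (a \in nbhd E0 v) = (b \notin nbhd E0 v))
  (sb : (b \in nbhd E0 v) = (b' \in nbhd E0 v)).
Implicit Types (E x y : {set {set V}}) (S : {set V}) (u w : V).

Let t := a \in nbhd E0 v.

(** Each neighbourhood of v splits the three-element level into one and two
    elements; this says that u is the single one. Neighbourhoods are
    determined by this element (odd_eq). *)
Let odd_at S u := [forall w in L, (w \in S) == (t == (w == u))].

Let out S : S \in nbhds f v -> S :\: L = S0 :\: L.
Proof. exact: level_out rg S0F a0S b0S b0v f0 S. Qed.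

Let odd_atP S u w : odd_at S u -> w \in L -> (w \in S) = (t == (w == u)).
Proof. by move=> /forall_inP h /h /eqP. Qed.

Let fL u : u \in L -> f u = f a0. Proof. by case/levelP. Qed.
Let vL : v \notin L. Proof. by rewrite inE eqxx. Qed.
Let aL : a \in L. Proof. by rewrite LE !inE eqxx. Qed.
Let bL : b \in L. Proof. by rewrite LE !inE eqxx orbT. Qed.
Let b'L : b' \in L. Proof. by rewrite LE !inE eqxx !orbT. Qed.

Let E0S : nbhd E0 v \in nbhds f v. Proof. exact: imset_f. Qed.

Let odd0 : odd_at (nbhd E0 v) a.
Proof.
apply/forall_inP=> w; rewrite LE !in_setU !in_set1 => /orP[/orP[]|] /eqP->.
- by rewrite eqxx eqb_id.
- by rewrite [b == a]eq_sym (negPf ab) /t sa; case: (b \in _).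
- by rewrite [b' == a]eq_sym (negPf ab') /t sa -sb; case: (b \in _).
Qed.

Let odd_img S u s : perm_on L s -> odd_at S u -> odd_at (s @: S) (s u).
Proof.
move=> sL /forall_inP h; apply/forall_inP=> w wL.
rewrite -[w](permKV s) mem_imset ?(inj_eq perm_inj) //; last exact: perm_inj.
by apply: h; rewrite -(perm_closed _ sL) permKV.
Qed.

Let odd_ex S : S \in nbhds f v -> exists2 u, u \in L & odd_at S u.
Proof.
move=> SF; have [||s [sL sS]] := @perm_to V (nbhd E0 v) S L.
- by rewrite !out.
- by rewrite (nbhds_card SF) (nbhds_card E0S).
exists (s a); first by rewrite perm_closed.
by rewrite -sS; apply: odd_img.
Qed.

Let odd_eq S R u : S \in nbhds f v -> R \in nbhds f v -> odd_at S u -> odd_at R u -> S = R.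
Proof.
move=> SF RF oS oR; apply/setP=> w; have [wL|wL] := boolP (w \in L).
  by rewrite (odd_atP oS wL) (odd_atP oR wL).
by have /setP/(_ w) := etrans (out SF) (esym (out RF)); rewrite !in_setD wL.
Qed.

Let img_nbhds S s : perm_on L s -> S \in nbhds f v -> s @: S \in nbhds f v.
Proof.
move=> sL /nbhds_class[E EC]; apply: nbhd_class_nbhds (relabel_class fL vL sL EC).
Qed.

(** The classes are indexed by the single elements u1, u2, u3 of their
    neighbourhoods in the level, and swapping two of these names is a perfect
    matching of two classes. The swap of u2 and u3 has a fixed point in the
    class of u1, a renaming of E0. *)
Lemma three_level_ham_path x y : x \in graphs f -> y \in graphs f -> nbhd x v != nbhd y v ->
  ham_path (@switch_adj V) (graphs f) x y.
Proof.
move=> xF yF ne; have xS : nbhd x v \in nbhds f v by apply: imset_f.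
have yS : nbhd y v \in nbhds f v by apply: imset_f.
have [u1 u1L o1] := odd_ex xS; have [u2 u2L o2] := odd_ex yS.
have u12 : u1 != u2.
  by apply: contraNneq ne => e; apply/eqP/(odd_eq (u := u1)) => //; rewrite e.
have cL : #|L| = 3.
  by rewrite LE setUC cardsU1 cards2 !inE ab negb_or eq_sym ab' eq_sym bb.
have [u3 L3 [u13 u23]] : exists2 u3, L = [set u1; u2; u3] & u1 != u3 /\ u2 != u3.
  have : #|L :\ u1 :\ u2| = 1.
    move: cL; rewrite (cardsD1 u1) u1L (cardsD1 u2 (L :\ u1)) in_setD1 u2L eq_sym u12.
    by case.
  move/eqP/cards1P=> [u3 E3]; have : u3 \in L :\ u1 :\ u2 by rewrite E3 set11.
  rewrite !in_setD1 => /and3P[u32 u31 u3L]; exists u3; last by rewrite ![_ == u3]eq_sym.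
  by rewrite -setUA -E3 setD1K ?setD1K // in_setD1 eq_sym u12.
have u3L : u3 \in L by rewrite L3 !inE eqxx !orbT.
have tp u w : u \in L -> w \in L -> perm_on L (tperm u w) by apply: tperm_inL.
set S1 := nbhd x v in xS o1 ne; set S2 := nbhd y v in yS o2 ne.
pose S3 := tperm u1 u3 @: S1.
have S3F : S3 \in nbhds f v by apply: img_nbhds => //; apply: tp.
have o3 : odd_at S3 u3 by rewrite -(tpermL u1 u3); apply: odd_img => //; apply: tp.
have im i j S R : i \in L -> j \in L -> S \in nbhds f v -> R \in nbhds f v ->
    odd_at S i -> odd_at R j -> tperm i j @: S = R.
  move=> iL jL SF RF oi oj; apply: (odd_eq (u := j)) => //.
    by apply: img_nbhds => //; apply: tp.
  by rewrite -{2}(tpermL i j); apply: odd_img => //; apply: tp.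
have clsim i j S R : i \in L -> j \in L -> S \in nbhds f v -> R \in nbhds f v ->
    odd_at S i -> odd_at R j -> nbhd_class f v R = relabel (tperm i j) @: nbhd_class f v S.
  move=> iL jL SF RF oi oj; apply/setP=> E; apply/idP/imsetP => [EC|[E' E'C ->]].
    exists (relabel (tperm i j) E); last by rewrite relabel_tpermK.
    rewrite -(im j i R S) // tpermC; apply: (relabel_class fL vL) => //; exact: tp.
  by rewrite -(im i j S R) //; apply: (relabel_class fL vL) => //; apply: tp.
have adjt i j S E : i \in L -> j \in L -> i != j -> odd_at S i -> E \in nbhd_class f v S ->
    switch_adj E (relabel (tperm i j) E).
  move=> iL jL ij oi /nbhd_classP[EF ES]; apply: (rigid_swap rg EF iL jL).
  by rewrite ES (odd_atP oi iL) (odd_atP oi jL) eqxx [j == i]eq_sym (negPf ij); case: t.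
have disj i j S R : i != j -> i \in L -> odd_at S i -> odd_at R j ->
    [disjoint nbhd_class f v S & nbhd_class f v R].
  move=> ij iL oi oj; apply/pred0P=> E /=; apply/negbTE/andP=> -[/nbhd_classP[_ ES] /nbhd_classP[_ ER]].
  have := odd_atP oi iL; rewrite -ES ER (odd_atP oj iL) eqxx (negPf ij).
  by case: t.
have cover : graphs f = nbhd_class f v S1 :|: nbhd_class f v S3 :|: nbhd_class f v S2.
  apply/setP=> E; rewrite !in_setU; apply/idP/orP; last first.
    by case=> [/orP[]|] /nbhd_classP[].
  move=> EF; have ES : nbhd E v \in nbhds f v by apply: imset_f.
  have [u uL ou] := odd_ex ES; move: uL; rewrite L3 !in_setU !in_set1.
  have mem S : S \in nbhds f v -> odd_at S u -> E \in nbhd_class f v S.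
    by move=> SF oS; apply/nbhd_classP; split=> //; apply: odd_eq oS.
  by case/orP=> [/orP[]|] /eqP ue; rewrite ue in mem ou;
    [left; rewrite mem|right; rewrite mem|left; rewrite (mem S3) // orbT].
have [bi1 gt1 _] := rg xS.
rewrite cover; apply: (@three_class _ _ _ _ _ (relabel (tperm u1 u2))
  (relabel (tperm u1 u3)) (relabel (tperm u2 u3))) => //.
- exact: switch_adj_sym.
- exact: switch_adj_irr.
- exact: switch_adj_relabel.
- exact: switch_adj_relabel.
- exact: switch_adj_relabel.
- exact: relabel_tpermK.
- exact: relabel_tpermK.
- exact: clsim.
- exact: clsim.
- exact: (disj u1 u2).
- exact: (disj u1 u3).
- exact: (disj u2 u3).
- move=> E EC; have <- : tperm u2 u3 @: S1 = S1.
    apply: (odd_eq (u := u1)) => //; first by apply: img_nbhds => //; apply: tp.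
    rewrite -(tpermD _ _ : tperm u2 u3 u1 = u1) 1?eq_sym //.
    by apply: odd_img => //; apply: tp.
  by apply: (relabel_class fL vL) => //; apply: tp.
- by move=> E; apply: adjt.
- by move=> E; apply: adjt.
- by move=> E EC; rewrite tpermC; apply: (adjt _ _ S3) => //; rewrite eq_sym.
- have t231 : tperm u2 u3 u1 = u1 by rewrite tpermD // eq_sym.
  move=> E; rewrite -!relabelM; congr (relabel _ E); apply/permP=> w.
  rewrite !permM; case: (tpermP u1 u3 w) => [->|->|/eqP w1 /eqP w3].
  + by rewrite tpermR tpermR t231.
  + by rewrite t231 tpermL tpermR.
  + case: (tpermP u2 u3 w) => [_|w3'|/eqP w2 _].
    * by rewrite tpermD.
    * by rewrite w3' eqxx in w3.
    * by rewrite tpermD // eq_sym.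
- pose s := tperm a u1; have sL : perm_on L s by apply: tp.
  have sa1 : s a = u1 by rewrite tpermL.
  exists (relabel s E0).
    (* E0 is fixed by the swap of b and b'; renaming a to u1 turns this into
       the swap of u2 and u3. *)
    have <- : s @: nbhd E0 v = S1.
      apply: (odd_eq (u := u1)) => //; first exact: img_nbhds.
      by rewrite -sa1; apply: odd_img.
    by apply: (relabel_class fL vL) => //; apply/nbhd_classP.
  have sbn : s b != u1 by rewrite -sa1 (inj_eq perm_inj) eq_sym.
  have sb'n : s b' != u1 by rewrite -sa1 (inj_eq perm_inj) eq_sym.
  have sbL : s b \in L by rewrite perm_closed.
  have sb'L : s b' \in L by rewrite perm_closed.
  have sbb : s b != s b' by rewrite (inj_eq perm_inj).
  have -> : tperm u2 u3 = tperm (s b) (s b').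
    move: sbL sb'L sbn sb'n sbb; rewrite L3 !in_setU !in_set1.
    case/orP=> [/orP[]|] /eqP->; case/orP=> [/orP[]|] /eqP->; rewrite ?eqxx //.
    by move=> *; rewrite tpermC.
  rewrite -tpermJ -relabelM conjgE mulgA mulgA mulgV mul1g relabelM.
  by rewrite fixE0.
- by apply/nbhd_classP.
- by apply/nbhd_classP.
Qed.

End ThreeElementLevel.

Section Main.
Variable V : finType.
Implicit Types (f : V -> nat) (x y : {set {set V}}).

Lemma graphs_edge f x y : x \in graphs f -> y \in graphs f -> x != y ->
  exists E E', [/\ E \in graphs f, E' \in graphs f & switch_adj E E'].
Proof.
move=> xF yF xy; have [v [nv _]] := good_vertex xF yF xy.
have xC : x \in nbhd_class f v (nbhd x v) by apply/nbhd_classP.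
have yC : y \in nbhd_class f v (nbhd y v) by apply/nbhd_classP.
have [a ax ay] : exists2 a, a \in nbhd x v & a \notin nbhd y v.
  apply/subsetPn; apply: contra nv => sub.
  by rewrite eqEcard sub (graphs_deg v xF) (graphs_deg v yF) /=.
have [b by' bx] := nbhdD_move xF yF ax ay.
have av : a != v by apply: contraTneq ax => ->; rewrite in_nbhd adj_irr // (graphs_simple xF).
have bv : b != v by apply: contraTneq by' => ->; rewrite in_nbhd adj_irr // (graphs_simple yF).
have [le|lt] := leqP (f a) (f b).
  have [E /nbhd_classP[EF _] xE] := cross_ex xC ax bx bv le.
  by exists x, E.
have [E /nbhd_classP[EF _] yE] := cross_ex yC by' ay av (ltnW lt).
by exists y, E.
Qed.

(** If v is rigid and there is no proper colouring, the level has at least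
    three elements, so a vertex a0 of the level by which the neighbourhoods of
    v differ is not exceptional by exceptional_level_graphs. A fork at a
    vertex of the level can be renamed to a fork at a0, so a0 is not rigid,
    and the classes of a0 are chained instead. *)
Theorem graphs_max_ham f : max_ham (@switch_adj V) (graphs f).
Proof.
move: {2}(\sum_u f u) (leqnn (\sum_u f u)) => n.
elim: n f => [|n IH] f le.
  have one x y : x \in graphs f -> y \in graphs f -> x = y.
    move=> xF yF; apply: nbhd_ext; rewrite ?(graphs_simple xF) ?(graphs_simple yF) // => u.
    have fu : f u = 0.
      by apply/eqP; rewrite -leqn0 (leq_trans _ le) // f_le_sum.
    have z E : E \in graphs f -> nbhd E u = set0.
      by move=> EF; apply/eqP; rewrite -cards_eq0 (graphs_deg u EF) fu.
    by rewrite !z.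
  split.
  - by move=> c _ x y xF yF; rewrite (one x y) // eqxx.
  - by move=> _ x y xF yF; rewrite (one x y) // eqxx.
  - by case/card_gt1P=> x [y [xF yF]]; rewrite (one x y) // eqxx.
have mh v : 0 < f v -> forall S, max_ham (@switch_adj V) (nbhd_class f v S).
  move=> fv S; apply: max_ham_class; apply: IH; rewrite -ltnS.
  exact: leq_trans (resid_lt S fv) le.
have fpos v x y : x \in graphs f -> y \in graphs f -> nbhd x v != nbhd y v -> 0 < f v.
  move=> xF yF; apply: contraNltn; rewrite leqn0 => /eqP fv.
  have z E : E \in graphs f -> nbhd E v = set0.
    by move=> EF; apply/eqP; rewrite -cards_eq0 (graphs_deg v EF) fv.
  by rewrite !z.
have edge : 1 < #|graphs f| -> exists x y, [/\ x \in graphs f, y \in graphs f & switch_adj x y].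
  by case/card_gt1P=> x [y [xF yF xy]]; apply: graphs_edge xy.
split=> //.
  move=> c cP x y xF yF cxy; have xy : x != y by apply: contraNneq cxy => ->.
  have [v [nv nex]] := good_vertex xF yF xy.
  have q := nbhds_ham_path xF yF nv nex; have mhv := mh v (fpos v x y xF yF nv).
  case: (chain_ham_path mhv xF yF nv q) => [//|rg].
  exact: (parity_ham_path mhv cP rg).
move=> nbi x y xF yF xy.
have [v [nv nex]] := good_vertex xF yF xy.
have mhv := mh v (fpos v x y xF yF nv).
case: (chain_ham_path mhv xF yF nv (nbhds_ham_path xF yF nv nex)) => [//|rg].
have xS : nbhd x v \in nbhds f v by apply: imset_f.
have yS : nbhd y v \in nbhds f v by apply: imset_f.
have [a0 a0x a0y] : exists2 a, a \in nbhd x v & a \notin nbhd y v.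
  apply/subsetPn; apply: contra nv => sub.
  by rewrite eqEcard sub (graphs_deg v xF) (graphs_deg v yF) /=.
have [b0 b0y b0x] := nbhdD_move xF yF a0x a0y.
have a0v : a0 != v by apply: contraTneq a0x => ->; apply: (nbhds_v xS).
have b0v : b0 != v by apply: contraTneq b0y => ->; apply: (nbhds_v yS).
have f0 : f a0 = f b0.
  apply/eqP; rewrite eqn_leq (rigid_top rg xS a0x b0x b0v).
  by rewrite (rigid_top rg yS b0y a0y a0v).
have [c3 [E EF]] := rigid_nonbipartite rg xS a0x b0x b0v f0 nbi.
case=> [[u [s [c [w1 [w2 [/levelP[uv fu] fk]]]]]]|].
  have a0n : nbhd x a0 != nbhd y a0.
    by apply: contraNneq a0y => h; rewrite nbhd_memC -h nbhd_memC.
  have nex0 : ~~ exceptional (nbhds f a0) (nbhd x a0) (nbhd y a0).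
    apply/negP=> /(exceptional_level_graphs xF)[b [e [[xb xe yE] [fb fe lev]]]].
    have vb : v = b.
      have : v \notin nbhd y a0 by rewrite nbhd_memC.
      rewrite yE !inE negb_or negb_and negbK => /andP[_ /orP[/eqP//|]].
      by rewrite adj_sym -in_nbhd a0x.
    have sub : level f v a0 \subset [set a0; e].
      apply/subsetP=> w /levelP[wv /lev]; rewrite -vb (negPf wv) /= !inE.
      by case/orP=> ->; rewrite ?orbT.
    have := leq_trans c3 (subset_leq_card sub); rewrite cards2.
    by case: (a0 != e).
  have mh0 := mh a0 (fpos a0 x y xF yF a0n).
  case: (chain_ham_path mh0 xF yF a0n (nbhds_ham_path xF yF a0n nex0)) => [//|rg0].
  (* The fork at u becomes a fork at a0, as u and a0 have the same degree. *)
  pose t := tperm u a0; have tF : relabel t E \in graphs f.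
    by apply: graphs_relabel => //; apply: tperm_invariant.
  case: (rigid_fork (s := t s) (c := t c) (w1 := t w1) (w2 := t w2) rg0 tF).
  rewrite -(tpermL u a0) -/t.
  have [h1 h2 h3 [h4 h5 h6]] := fk.
  split; rewrite ?adj_relabel ?(inj_eq perm_inj) //; split;
    by rewrite ?(inj_eq perm_inj) // /privateb !adj_relabel (inj_eq perm_inj).
move=> [a [b [b' [bb [[ab ab' LE fixE sa] sb]]]]].
exact: (three_level_ham_path mhv rg xS a0x b0x b0v f0 EF bb ab ab' LE fixE sa sb xF yF nv).
Qed.

End Main.

(** * The realization graph *)

Section Realizations.
Variables (V : finType) (d : V -> 'I_#|V|).
Implicit Types (E : {set {set V}}).

Lemma degree_nbhd E u : simple_edges E -> degree E u = #|nbhd E u|.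
Proof.
move=> s; rewrite -(card_in_imset (f := fun w => [set u; w])) => [|w w' wE w'E].
  apply: eq_card => e; rewrite inE; apply/andP/imsetP => [[eE ue]|[w wE ->]].
    have /cards2P[x [y [xy ee]]] : #|e| == 2 by rewrite (simple_card2 s eE).
    move: ue; rewrite ee !inE => /orP[] /eqP ux.
      by exists y; rewrite ?ux // in_nbhd /adj -ee.
    by exists x; rewrite ?ux 1?setUC // in_nbhd /adj setUC -ee.
  by split; [rewrite in_nbhd in wE|rewrite !inE eqxx].
move=> E2; have : w \in [set u; w'] by rewrite -E2 set22.
rewrite !inE => /orP[/eqP wu|/eqP//].
by rewrite wu in_nbhd adj_irr in wE.
Qed.

Lemma realizes_graphs E : realizes d E = (E \in graphs (fun u => d u)).
Proof.
rewrite inE /realizes; case s: (simple_edges E) => //=.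
by apply: eq_forallb => u; rewrite degree_nbhd.
Qed.

End Realizations.

Theorem theorem1p1 (V : finType) (d : V -> 'I_#|V|) (hd : graphical d) :
  maximally_hamiltonian (@realization_graph V d).
Proof.
have [w0 w0P] := hd; pose f u : nat := d u.
(* Outside the realizations of d the value of phi is irrelevant; w0 serves as
   default. *)
pose phi : {set {set V}} -> realization d := insubd (Sub w0 w0P).
have valphi E : E \in graphs f -> val (phi E) = E.
  by move=> EF; rewrite val_insubd realizes_graphs EF.
have in_graphs (x : realization d) : val x \in graphs f by rewrite -realizes_graphs (valP x).
have phival (x : realization d) : phi (val x) = x by apply: val_inj; rewrite valphi.
have mono E E' : E \in graphs f -> E' \in graphs f ->
    @realization_graph V d (phi E) (phi E') = switch_adj E E'.
  by move=> EF E'F; rewrite /realization_graph !valphi.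
have lift (x y : realization d) : ham_path (@switch_adj V) (graphs f) (val x) (val y) ->
    exists p, hamilton_path (@realization_graph V d) x y p.
  move=> h; have inj : {in graphs f &, injective phi}.
    by move=> E E' EF E'F pE; rewrite -(valphi E EF) pE valphi.
  have [p [h1 h2 h3 h4]] := ham_path_map inj mono h.
  rewrite !phival in h1 h2 h3 h4; exists p; split=> // z.
  by rewrite h4 -(phival z) imset_f.
have mh := graphs_max_ham f.
have [bi|nbi] := boolP (bipartite_on (@switch_adj V) (graphs f)); last first.
  apply: Or32; split.
    move=> [c cP]; case/negP: nbi; apply/bipartite_onP; exists (c \o phi) => E E' EF E'F n.
    by apply: cP; rewrite mono.
  move=> x y xy; apply: lift; apply: (mh_conn mh) => //.
have [c cP] := bipartite_onP _ _ bi.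
have [le1|gt1] := leqP #|graphs f| 1.
  have one (x y : realization d) : x = y.
    apply: val_inj; apply/eqP; apply: contraT => ne.
    have : 1 < #|graphs f| by apply/card_gt1P; exists (val x), (val y).
    by rewrite ltnNge le1.
  apply: Or33; left; split; last first.
    by move=> x y; rewrite (one x y) eqxx realization_graph_irrefl.
  by apply/eqP/fintype1P; exists (Sub w0 w0P) => x; apply: one.
have [E [E' [EF E'F n]]] := mh_edge mh gt1.
have cE : c E != c E' by apply: cP.
apply: Or31; exists (c \o val); split.
- by move=> x y xy; apply: cP.
- by case h: (c E); [exists (phi E)|exists (phi E')]; rewrite /= valphi //;
    move: cE; rewrite h; case: (c E').
- by case h: (c E); [exists (phi E')|exists (phi E)]; rewrite /= valphi //;
    move: cE; rewrite h; case: (c E').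
- by move=> x y cxy; apply: lift; apply: (mh_lace mh cP).
Qed.
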